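(* Let $(p,p')$ be a pair of coprime integers with $p\geq 2$, $p'\geq 2$, and put $a:=p'/p$. Let $\varepsilon,\varepsilon'\in\{0,1\}$, $(r,s)\in K_{p,p'}$ and $x\in\mathbb{C}$. Then for all $(\tau,u,t)\in\mathbb{H}\times\mathbb{C}\times\mathbb{C}$: $$\mathbf{T}_{r,s;x}^{\varepsilon,\varepsilon'}\left(-\frac{1}{\tau},\frac{u}{\tau},t-\frac{u^{2}}{6\tau}\right)=\sum_{(r',s')\in K_{p,p'}}\int_{\mathbb{R}}\mathrm{d}x'\,S_{(r,s;x),(r',s';x')}^{tt,(\varepsilon,\varepsilon')}\,\mathbf{T}_{r',s';x'}^{\varepsilon',\varepsilon}(\tau,u,t),$$ $$\mathbf{T}_{r,s;x}^{\varepsilon,\varepsilon'}(\tau+1,u,t)=e^{2\pi i\left(a\left(x-\frac{i\varepsilon}{2}\right)^{2}+\frac{(rp'-sp)^{2}}{4pp'}-\frac{1-\varepsilon}{8}\right)}\,\mathbf{T}_{r,s;x}^{\varepsilon,\,\varepsilon\varepsilon'+(1-\varepsilon)(1-\varepsilon')}(\tau,u,t),$$ where $$S_{(r,s;x),(r',s';x')}^{tt,(\varepsilon,\varepsilon')}:=i^{-\varepsilon\varepsilon'}\,S_{(r,s),(r',s')}\,\sqrt{2a}\;e^{-4\pi ia\left(x-\frac{i\varepsilon}{2}\right)\left(x'-\frac{i\varepsilon'}{2}\right)}.$$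
   Context: $\mathbb{H}$ is the upper half plane; for $(\tau,u,t)\in\mathbb{H}\times\mathbb{C}\times\mathbb{C}$ write $(q,z,w)=(e^{2\pi i\tau},e^{2\pi iu},e^{2\pi it})$, with $q^y:=e^{2\pi i\tau y}$, $z^y:=e^{2\pi iuy}$, $w^y:=e^{2\pi ity}$. Put $$\eta(\tau)=q^{1/24}\prod_{n>0}(1-q^n),\qquad \vartheta_{\varepsilon,\varepsilon'}(u;\tau)=z^{\frac{\varepsilon}{2}}q^{\frac{\varepsilon}{8}}\prod_{n>0}(1-q^{n})\left(1+(-1)^{\varepsilon'}zq^{n-\frac{1-\varepsilon}{2}}\right)\left(1+(-1)^{\varepsilon'}z^{-1}q^{n-\frac{1+\varepsilon}{2}}\right).$$ $K_{p,p'}:=\{(m,n)\in\mathbb{Z}^2\mid 1\le m\le p-1,\ 1\le n\le p'-1,\ mp'+np\le pp'\}$. For $(r,s)\in K_{p,p'}$ and $x\in\mathbb{C}$, $$\chi_{r,s}(\tau):=\frac{1}{\eta(\tau)}\sum_{n\in\mathbb{Z}}\left(q^{pp'\left(n+\frac{rp'-sp}{2pp'}\right)^{2}}-q^{pp'\left(n+\frac{-rp'-sp}{2pp'}\right)^{2}}\right),$$ $$\mathbf{T}^{\varepsilon,\varepsilon'}_{r,s;x}(\tau,u,t):=(-1)^{\varepsilon\varepsilon'}q^{a\left(x-\frac{i\varepsilon}{2}\right)^{2}}z^{2ia\left(x-\frac{i\varepsilon}{2}\right)}w^{3(1-2a)}\frac{\vartheta_{\varepsilon,\varepsilon'}(u;\tau)}{\eta(\tau)^{2}}\chi_{r,s}(\tau).$$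 The (Virasoro minimal series) $S$-matrix is, for $(r,s),(r',s')\in K_{p,p'}$, $$S_{(r,s),(r',s')}:=\sqrt{\frac{8}{pp'}}\,(-1)^{(r+s)(r'+s')}\sin\left(\frac{\pi(p-p')rr'}{p}\right)\sin\left(\frac{\pi(p-p')ss'}{p'}\right).$$ *)

(* Defs.v *)
From Stdlib Require Import Reals ZArith Lia List FinFun.
From Coquelicot Require Import Coquelicot.

Open Scope C_scope.

(** Coquelicot's [Lim_seq], [Series] are real-valued. As with [RInt_gen], the
    [iota] below returns the limit (or sum) when it exists and an unspecified
    value otherwise. *)

Definition Clim_seq (u : nat -> C) : C :=
  iota (T := C_CompleteNormedModule)
    (fun l => filterlim u eventually (locally l)).

Definition Cseries (v : nat -> C) : C :=
  iota (T := C_CompleteNormedModule) (is_series v).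

(** The sum over all integers is split into [n >= 0] and [n <= -1]. *)
Definition Cseries_Z (v : Z -> C) : C :=
  Cseries (fun n : nat => v (Z.of_nat n)) +
  Cseries (fun n : nat => v (- Z.of_nat n - 1)%Z).

Fixpoint Cprod (v : nat -> C) (N : nat) : C :=
  match N with
  | O => 1
  | S k => Cprod v k * v N
  end.

(** The product over [n > 0]; the factor [v 0] is not used. *)
Definition Cprod_pos (v : nat -> C) : C := Clim_seq (Cprod v).

Definition Csum_list {A : Type} (l : list A) (f : A -> C) : C :=
  fold_right (fun k acc => f k + acc) 0 l.

Definition Cintegral_R (f : R -> C) : C :=
  RInt_gen (V := C_R_CompleteNormedModule) f
    (Rbar_locally m_infty) (Rbar_locally p_infty).

(** Asking for [Cmod (f x)] as well makes the convergence absolute, so that the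
    improper Riemann integral agrees with the Lebesgue integral. *)
Definition Cintegrable_R (f : R -> C) : Prop :=
  ex_RInt_gen (V := C_R_NormedModule) f
    (Rbar_locally m_infty) (Rbar_locally p_infty) /\
  ex_RInt_gen (fun x => Cmod (f x))
    (Rbar_locally m_infty) (Rbar_locally p_infty).

Definition Cexp (z : C) : C :=
  (exp (Re z) * cos (Im z), exp (Re z) * sin (Im z))%R.

(** [epow v y] is [e^(2 pi i v y)]: it is the power [q^y], [z^y] or [w^y]
    when [v] is [tau], [u] or [t]. *)
Definition epow (v y : C) : C := Cexp (2 * PI * Ci * v * y).

Definition eta (tau : C) : C :=
  epow tau (1 / 24) * Cprod_pos (fun n => 1 - epow tau (INR n)).

Definition theta (e e' : nat) (u tau : C) : C :=
  epow u (INR e / 2) * epow tau (INR e / 8) *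
  Cprod_pos (fun n =>
    (1 - epow tau (INR n)) *
    (1 + (-1) ^ e' * epow u 1 * epow tau (INR n - (1 - INR e) / 2)) *
    (1 + (-1) ^ e' * epow u (-1) * epow tau (INR n - (1 + INR e) / 2))).

Definition Kac (p p' : Z) (rs : Z * Z) : Prop :=
  let (m, n) := rs in
  (1 <= m <= p - 1 /\ 1 <= n <= p' - 1 /\ m * p' + n * p <= p * p')%Z.

Definition Kac_list (p p' : Z) : list (Z * Z) :=
  filter (fun mn => (fst mn * p' + snd mn * p <=? p * p')%Z)
    (list_prod (map Z.of_nat (seq 1 (Z.to_nat (p - 1))))
               (map Z.of_nat (seq 1 (Z.to_nat (p' - 1))))).

Lemma Kac_list_NoDup (p p' : Z) : NoDup (Kac_list p p').
Proof.
  assert (H : forall n, NoDup (map Z.of_nat (seq 1 n))).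
  { intros n. apply Injective_map_NoDup; [|apply seq_NoDup].
    intros a b. apply Nat2Z.inj. }
  apply NoDup_filter.
  generalize (H (Z.to_nat (p - 1))) (H (Z.to_nat (p' - 1))).
  generalize (map Z.of_nat (seq 1 (Z.to_nat (p - 1)))).
  generalize (map Z.of_nat (seq 1 (Z.to_nat (p' - 1)))).
  intros l' l Hl Hl'. induction Hl as [|a l Ha Hl IH]; simpl; [constructor|].
  apply NoDup_app.
  - apply Injective_map_NoDup; [|assumption]. intros b c E. now inversion E.
  - assumption.
  - intros [b c] Hb Hc. apply in_map_iff in Hb. destruct Hb as [d [E _]].
    inversion E; subst. apply in_prod_iff in Hc. tauto.
Qed.

Lemma in_Kac_list (p p' : Z) (rs : Z * Z) : In rs (Kac_list p p') <-> Kac p p' rs.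
Proof.
  assert (H : forall N a, In a (map Z.of_nat (seq 1 (Z.to_nat (N - 1)))) <->
                          (1 <= a <= N - 1)%Z).
  { intros N a. rewrite in_map_iff. split.
    - intros [k [<- Hk]]. apply in_seq in Hk. lia.
    - intros Ha. exists (Z.to_nat a). split; [lia|]. apply in_seq. lia. }
  destruct rs as [m n]. unfold Kac_list, Kac.
  rewrite filter_In, in_prod_iff, !H, Z.leb_le. simpl. tauto.
Qed.

Definition chi (p p' r s : Z) (tau : C) : C :=
  / eta tau *
  Cseries_Z (fun n =>
    epow tau (RtoC (IZR (p * p') *
      (IZR n + IZR (r * p' - s * p) / IZR (2 * p * p')) ^ 2)%R) -
    epow tau (RtoC (IZR (p * p') *
      (IZR n + IZR (- r * p' - s * p) / IZR (2 * p * p')) ^ 2)%R)).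

Definition T_char (p p' : Z) (e e' : nat) (r s : Z) (x tau u t : C) : C :=
  let a : R := (IZR p' / IZR p)%R in
  (-1) ^ (e * e') *
  epow tau (a * (x - Ci * INR e / 2) ^ 2) *
  epow u (2 * Ci * a * (x - Ci * INR e / 2)) *
  epow t (3 * (1 - 2 * a)) *
  (theta e e' u tau / eta tau ^ 2) *
  chi p p' r s tau.

Definition S_Vir (p p' : Z) (rs rs' : Z * Z) : R :=
  let (r, s) := rs in
  let (r', s') := rs' in
  (sqrt (8 / IZR (p * p')) *
   powerRZ (-1) ((r + s) * (r' + s')) *
   sin (PI * IZR (p - p') * IZR (r * r') / IZR p) *
   sin (PI * IZR (p - p') * IZR (s * s') / IZR p'))%R.

Definition S_tt (p p' : Z) (e e' : nat)
    (rs : Z * Z) (x : C) (rs' : Z * Z) (x' : C) : C :=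
  let a : R := (IZR p' / IZR p)%R in
  / Ci ^ (e * e') *
  S_Vir p p' rs rs' *
  sqrt (2 * a) *
  Cexp (- (4) * PI * Ci * a *
        (x - Ci * INR e / 2) * (x' - Ci * INR e' / 2)).

(* Main.v *)
Require Import Defs.
From Stdlib Require Import Reals ZArith List.
From Coquelicot Require Import Coquelicot.
From Stdlib Require Import Lia Lra Psatz Permutation FunctionalExtensionality.

Open Scope C_scope.

(** Everything rests on Poisson summation for Gaussians with complex coefficients,
    [poisson_gauss]. Write [g(tau)] for the integral of [e^(pi i tau x^2)] over the real
    line, here [gauss_tau tau]; its value [(- i tau)^(-1/2)] never enters the argument.

    The four factors of [T] transform under [tau -> - 1 / tau] as follows.
    - By Jacobi's triple product ([triple_product]), [theta] is a sum of Gaussians over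
      the integers, and Poisson summation exchanges the two characteristics and yields a
      factor [g(-1/tau)] ([theta_S]).
    - The product of the three even theta constants is [2 eta^3], so [eta^3] acquires
      [g(-1/tau)^3] ([eta3_S]).
    - The numerator of [chi] is a difference of theta series of level [N = p p'].
      Poisson summation, followed by sorting the dual sum into residues modulo [2 N], gives a
      finite Fourier transform over these residues ([level_theta_S]), which folds onto
      the Kac table by parity and the Chinese remainder theorem ([chi_num_S],
      [residues_Kac]). This yields the S-matrix and another factor [g(-1/tau)].
    - The Gaussian prefactor in [x], together with the exponentials of [u^2 / tau] coming
      from [theta] and from the shift of [t], is matched by the integral over [x'] on the
      right, which produces [g(tau)] by completing the square ([kernel_integral]).

    The two sides thus differ by [g(tau) g(-1/tau)], and this is 1: transform the theta
    constant with zero characteristics twice, and divide by it; it is nonzero because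
    [eta] is ([gauss_tau_inv]). No square root of a complex number is ever taken.

    Poisson summation is proved with the Fejer kernel: integrating a Gaussian against it
    over the line gives on the one hand the Cesaro means of the Fourier coefficients, and on
    the other hand approximates the sum of the values at the integers. The Fourier
    coefficients are Gaussian integrals with a complex linear term, evaluated by moving the
    contour ([gauss_integral]).

    Under [tau -> tau + 1] the products for [eta] and [theta] change factor by factor, and
    each term of the series in [chi] is multiplied by the same phase ([T_char_T]). *)

(** * Limits of complex sequences *)

(** Convergence is tested on real and imaginary parts, so that facts on real limits
    carry over componentwise; [Clim_filterlim] ties it to the filter version. *)
Definition Clim (u : nat -> C) (l : C) : Prop :=
  is_lim_seq (fun n => Re (u n)) (Re l) /\ is_lim_seq (fun n => Im (u n)) (Im l).

Lemma Ceq (a b : C) : Re a = Re b -> Im a = Im b -> a = b.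
Proof. destruct a, b; simpl; intros; subst; reflexivity. Qed.

Lemma Im_le_Cmod (z : C) : (Rabs (Im z) <= Cmod z)%R.
Proof.
  apply Rle_trans with (Rmax (Rabs (fst z)) (Rabs (snd z))).
  apply Rmax_r. apply Rmax_Cmod.
Qed.

Lemma Cmod_le_Re_Im (z : C) : (Cmod z <= Rabs (Re z) + Rabs (Im z))%R.
Proof.
  replace z with (RtoC (Re z) + Ci * RtoC (Im z)) at 1.
  eapply Rle_trans; [apply Cmod_triangle|].
  rewrite Cmod_mult, Cmod_Ci, !Cmod_R. lra.
  apply Ceq; destruct z; simpl; ring.
Qed.

Lemma Clim_ext u v l : (forall n, u n = v n) -> Clim u l -> Clim v l.
Proof.
  intros E [H1 H2]; split; (eapply is_lim_seq_ext; [|eassumption]); intros n; simpl; now rewrite E.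
Qed.

Lemma Clim_unique u l l' : Clim u l -> Clim u l' -> l = l'.
Proof.
  intros [H1 H2] [H3 H4]; apply Ceq.
  - apply is_lim_seq_unique in H1. apply is_lim_seq_unique in H3.
    rewrite H1 in H3. now inversion H3.
  - apply is_lim_seq_unique in H2. apply is_lim_seq_unique in H4.
    rewrite H2 in H4. now inversion H4.
Qed.

Lemma Clim_const l : Clim (fun _ => l) l.
Proof. split; apply is_lim_seq_const. Qed.

Lemma Clim_plus u v l m : Clim u l -> Clim v m -> Clim (fun n => u n + v n) (l + m).
Proof. intros [H1 H2] [H3 H4]; split; now apply (is_lim_seq_plus' _ _ _ _). Qed.

Lemma Clim_mult u v l m : Clim u l -> Clim v m -> Clim (fun n => u n * v n) (l * m).
Proof.
  intros [H1 H2] [H3 H4]; split.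
  - apply (is_lim_seq_minus' _ _ _ _); now apply (is_lim_seq_mult' _ _ _ _).
  - apply (is_lim_seq_plus' _ _ _ _); now apply (is_lim_seq_mult' _ _ _ _).
Qed.

Lemma Clim_scal c u l : Clim u l -> Clim (fun n => c * u n) (c * l).
Proof. intros H. apply Clim_mult; [apply Clim_const|exact H]. Qed.

Lemma Clim_opp u l : Clim u l -> Clim (fun n => - u n) (- l).
Proof.
  intros H. replace (- l) with (- (1) * l) by ring.
  eapply Clim_ext; [|apply Clim_scal, H]. intros; simpl; ring.
Qed.

Lemma Clim_minus u v l m : Clim u l -> Clim v m -> Clim (fun n => u n - v n) (l - m).
Proof. intros. apply Clim_plus; [|apply Clim_opp]; assumption. Qed.

Lemma Clim_Cmod u l : Clim u l -> is_lim_seq (fun n => Cmod (u n)) (Cmod l).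
Proof.
  intros [H1 H2]. unfold Cmod.
  apply (is_lim_seq_continuous sqrt).
  - apply continuity_pt_filterlim, continuous_sqrt.
  - assert (sq : forall (w : nat -> R) (m : R), is_lim_seq w m ->
      is_lim_seq (fun n => (w n ^ 2)%R) (m ^ 2)%R).
    { intros w m Hw. apply is_lim_seq_ext with (fun n => (w n * w n)%R).
      intros; simpl; ring. replace (m ^ 2)%R with (m * m)%R by ring.
      now apply is_lim_seq_mult'. }
    apply is_lim_seq_plus'; now apply sq.
Qed.

Lemma Clim_squeeze u l (b : nat -> R) :
  (forall n, Cmod (u n - l) <= b n)%R -> is_lim_seq b 0 -> Clim u l.
Proof.
  intros Hb H. split.
  - apply is_lim_seq_ext with (fun n => (Re (u n - l) + Re l)%R).
    { intros; simpl; unfold Re; ring. }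
    replace (Finite (Re l)) with (Finite (0 + Re l)) by (f_equal; ring).
    apply (is_lim_seq_plus' _ _ _ _); [|apply is_lim_seq_const].
    apply is_lim_seq_abs_0, is_lim_seq_le_le with (fun _ => 0%R) b; [|apply is_lim_seq_const|exact H].
    intros n; split; [apply Rabs_pos|]. eapply Rle_trans; [apply re_le_Cmod|apply Hb].
  - apply is_lim_seq_ext with (fun n => (Im (u n - l) + Im l)%R).
    { intros; simpl; unfold Im; ring. }
    replace (Finite (Im l)) with (Finite (0 + Im l)) by (f_equal; ring).
    apply (is_lim_seq_plus' _ _ _ _); [|apply is_lim_seq_const].
    apply is_lim_seq_abs_0, is_lim_seq_le_le with (fun _ => 0%R) b; [|apply is_lim_seq_const|exact H].
    intros n; split; [apply Rabs_pos|]. eapply Rle_trans; [apply Im_le_Cmod|apply Hb].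
Qed.

Lemma Clim_subseq u l (f : nat -> nat) :
  (forall n, (n <= f n)%nat) -> Clim u l -> Clim (fun n => u (f n)) l.
Proof.
  intros Hf [H1 H2]; split.
  - apply (is_lim_seq_subseq (fun n => Re (u n)) (Re l) f); [|exact H1].
    intros P [N HN]. exists N. intros n Hn. apply HN. specialize (Hf n). lia.
  - apply (is_lim_seq_subseq (fun n => Im (u n)) (Im l) f); [|exact H2].
    intros P [N HN]. exists N. intros n Hn. apply HN. specialize (Hf n). lia.
Qed.

Lemma Clim_bounded u l : Clim u l -> exists B, forall n, (Cmod (u n) <= B)%R.
Proof.
  intros H. apply Clim_Cmod in H.
  destruct (filterlim_bounded (K := R_AbsRing) (V := R_NormedModule) (fun n => Cmod (u n))) as [B HB].
  - exists (Cmod l). exact H.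
  - exists B. intros n. specialize (HB n). unfold norm in HB; simpl in HB.
    unfold abs in HB; simpl in HB. eapply Rle_trans; [apply Rle_abs|exact HB].
Qed.

Lemma Clim_Cmod_le u l B :
  (forall n, Cmod (u n) <= B)%R -> Clim u l -> (Cmod l <= B)%R.
Proof.
  intros HB H. apply Clim_Cmod in H.
  apply (is_lim_seq_le _ _ (Cmod l) B HB H (is_lim_seq_const B)).
Qed.

Lemma Clim_filterlim (u : nat -> C) (l : C) :
  Clim u l <-> filterlim u eventually (locally (T := C_UniformSpace) l).
Proof.
  split.
  - intros [H1 H2].
    apply (filterlim_ext (fun n => (Re (u n), Im (u n)))).
    { intros n. now destruct (u n). }
    replace l with (Re l, Im l) by (now destruct l).
    intros P [eps HP].
    assert (HA : eventually (fun n => ball (Re l) eps (Re (u n)))) by (apply (proj1 (filterlim_locally (F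
      := eventually) (fun n => Re (u n)) (Re l)) H1 eps)).
    assert (HB : eventually (fun n => ball (Im l) eps (Im (u n)))) by (apply (proj1 (filterlim_locally (F
      := eventually) (fun n => Im (u n)) (Im l)) H2 eps)).
    unfold filtermap. generalize (filter_and _ _ HA HB). apply filter_imp.
    intros n [Ha Hb]. apply HP. split; assumption.
  - intros H. split.
    + apply filterlim_locally. intros eps.
      generalize (proj1 (filterlim_locally (F := eventually) u l) H eps).
      apply filter_imp. intros n Hn. apply Hn.
    + apply filterlim_locally. intros eps.
      generalize (proj1 (filterlim_locally (F := eventually) u l) H eps).
      apply filter_imp. intros n Hn. apply Hn.
Qed.

Lemma Clim_seq_unique u l : Clim u l -> Clim_seq u = l.
Proof.
  intros H. unfold Clim_seq.
  apply (iota_filterlim_locally (V := C_CompleteNormedModule) (F := eventually)).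
  now apply Clim_filterlim.
Qed.

Lemma Clim_inv (u : nat -> C) (l : C) :
  (forall n, u n <> 0) -> l <> 0 -> Clim u l -> Clim (fun n => / u n) (/ l).
Proof.
  intros Hu Hl H.
  assert (Hm : is_lim_seq (fun n => Cmod (u n - l) * / (Cmod (u n) * Cmod l))%R 0).
  { apply Cmod_gt_0 in Hl.
    replace (Finite 0) with (Finite (0 * / (Cmod l * Cmod l))) by (f_equal; ring).
    apply is_lim_seq_mult'.
    - replace 0%R with (Cmod (l - l)) by (replace (l - l) with (RtoC 0) by ring; apply Cmod_0).
      apply Clim_Cmod, Clim_minus; [exact H|apply Clim_const].
    - apply (is_lim_seq_inv _ (Cmod l * Cmod l)%R).
      + apply is_lim_seq_mult'; [now apply Clim_Cmod|apply is_lim_seq_const].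
      + intros E; inversion E. nra. }
  eapply Clim_squeeze; [|exact Hm].
  intros n. simpl. specialize (Hu n).
  replace (/ u n - / l) with (- ((u n - l) * / (u n * l))) by (field; split; assumption).
  rewrite Cmod_opp, Cmod_mult, Cmod_inv, Cmod_mult. lra.
  now apply Cmult_neq_0.
Qed.

(** * Absolutely convergent series, one- and two-sided *)

Fixpoint csum (v : nat -> C) (n : nat) : C :=
  match n with O => 0 | S k => csum v k + v k end.

Lemma csum_ext u v n : (forall k, (k < n)%nat -> u k = v k) -> csum u n = csum v n.
Proof.
  induction n; simpl; intros H; [reflexivity|].
  rewrite IHn, H; auto.
Qed.

Lemma csum_plus u v n : csum (fun k => u k + v k) n = csum u n + csum v n.
Proof. induction n; simpl; [|rewrite IHn]; ring. Qed.

Lemma csum_scal c u n : csum (fun k => c * u k) n = c * csum u n.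
Proof. induction n; simpl; [|rewrite IHn]; ring. Qed.

Lemma csum_zero n : csum (fun _ => 0) n = 0.
Proof. induction n; simpl; [|rewrite IHn]; ring. Qed.

Lemma csum_S_l v n : csum v (S n) = v O + csum (fun k => v (S k)) n.
Proof.
  induction n; [simpl; ring|].
  change (csum v (S (S n))) with (csum v (S n) + v (S n)). rewrite IHn. simpl. ring.
Qed.

Lemma csum_add v n m : csum v (n + m) = csum v n + csum (fun k => v (n + k)%nat) m.
Proof.
  induction m; simpl; [rewrite Nat.add_0_r; ring|].
  rewrite Nat.add_succ_r; simpl. rewrite IHm. ring.
Qed.

Lemma Clim_csum (f : nat -> nat -> C) (g : nat -> C) n :
  (forall k, (k < n)%nat -> Clim (fun N => f N k) (g k)) ->
  Clim (fun N => csum (f N) n) (csum g n).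
Proof.
  induction n; simpl; intros H; [apply Clim_const|].
  apply Clim_plus; [apply IHn; auto|apply H; auto].
Qed.

Lemma csum_sum_n v n : sum_n (G := C_NormedModule) v n = csum v (S n).
Proof.
  induction n; [rewrite sum_O; symmetry; apply (Cplus_0_l (v O))|].
  rewrite sum_Sn, IHn. reflexivity.
Qed.

Lemma Clim_csum_is_series v l :
  Clim (csum v) l -> is_series (V := C_NormedModule) v l.
Proof.
  intros H. unfold is_series.
  apply (filterlim_ext (fun n => csum v (S n))).
  { intros n. now rewrite <- csum_sum_n. }
  apply (proj1 (Clim_filterlim (fun n => csum v (S n)) l)).
  apply (Clim_subseq (csum v) l S); [auto|exact H].
Qed.

Lemma Cseries_unique v l : Clim (csum v) l -> Cseries v = l.
Proof.
  intros H. unfold Cseries.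
  apply (iota_filterlim_locally (V := C_CompleteNormedModule) (F := eventually)).
  apply (Clim_csum_is_series v l H).
Qed.

(** A geometric majorant covers every series and product below: theta series decay
    like Gaussians and the factors of the products tend to 1 like [q^n]. *)
Definition geom_bounded (u : nat -> C) : Prop :=
  exists K rho, (0 <= rho < 1)%R /\ forall n, (Cmod (u n) <= K * rho ^ n)%R.

Lemma geom_tail u K rho n m :
  (0 <= rho < 1)%R -> (forall n, Cmod (u n) <= K * rho ^ n)%R -> (n <= m)%nat ->
  (Cmod (csum u m - csum u n) <= K * rho ^ n / (1 - rho))%R.
Proof.
  intros Hr H Hnm.
  assert (HK : (0 <= K)%R).
  { specialize (H O). simpl in H. pose proof (Cmod_ge_0 (u O)). lra. }
  assert (Hp : forall j, (0 <= rho ^ j)%R) by (intros; apply pow_le; lra).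
  replace m with (n + (m - n))%nat by lia. rewrite csum_add.
  replace (csum u n + csum (fun k => u (n + k)%nat) (m - n) - csum u n)
    with (csum (fun k => u (n + k)%nat) (m - n)) by ring.
  apply Rle_trans with (K * rho ^ n * (1 - rho ^ (m - n)) / (1 - rho))%R.
  - generalize (m - n)%nat as d. induction d; simpl.
    + rewrite Cmod_0. unfold Rdiv. rewrite Rminus_diag. lra.
    + eapply Rle_trans; [apply Cmod_triangle|].
      eapply Rle_trans; [apply Rplus_le_compat; [exact IHd|apply H]|].
      rewrite pow_add. apply Req_le. field. lra.
  - apply Rmult_le_compat_r; [apply Rlt_le, Rinv_0_lt_compat; lra|].
    specialize (Hp (m - n)%nat) as h1. specialize (Hp n) as h2.
    assert (0 <= K * rho ^ n)%R by (apply Rmult_le_pos; lra). nra.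
Qed.

Lemma geom_bounded_Clim u : geom_bounded u -> exists l, Clim (csum u) l.
Proof.
  intros (K & rho & Hr & H).
  assert (G : forall g : C -> R, (forall z, Rabs (g z) <= Cmod z)%R ->
     (forall a b : C, g (a + b)%C = g a + g b)%R -> g (RtoC 0) = 0%R ->
     exists l, is_lim_seq (fun n => g (csum u n)) (Finite l)).
  { intros g Hg Hadd H0.
    assert (Hs : ex_series (fun n => g (u n))).
    { apply (ex_series_le (K := R_AbsRing) (V := R_CompleteNormedModule) _ (fun n => K * rho ^ n)%R).
      - intros n. eapply Rle_trans; [apply Hg|apply H].
      - apply (ex_series_scal_l (K := R_AbsRing) K (fun n => rho ^ n)%R).
        apply ex_series_geom. rewrite Rabs_pos_eq; lra. }
    destruct Hs as [l Hl]. exists l.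
    apply (is_lim_seq_incr_1 (fun n => g (csum u n))).
    apply is_lim_seq_ext with (2 := Hl).
    intros n. induction n.
    - rewrite sum_O; simpl. now rewrite Hadd, H0, Rplus_0_l.
    - rewrite sum_Sn, IHn. simpl. rewrite !Hadd. reflexivity. }
  destruct (G Re) as [a Ha]; [apply re_le_Cmod|reflexivity|reflexivity|].
  destruct (G Im) as [b Hb]; [apply Im_le_Cmod|reflexivity|reflexivity|].
  exists (a, b); split; assumption.
Qed.

(** Dominated convergence for series: the common geometric majorant makes the tails
    uniformly small, and on the remaining finite range the limit is termwise. *)
Lemma Tannery (f : nat -> nat -> C) (g : nat -> C) (L : nat -> C) l K rho :
  (0 <= rho < 1)%R -> (forall N k, Cmod (f N k) <= K * rho ^ k)%R ->
  (forall k, Clim (fun N => f N k) (g k)) ->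
  (forall N, Clim (csum (f N)) (L N)) -> Clim (csum g) l -> Clim L l.
Proof.
  intros Hr Hf Hfg HL Hl.
  assert (Hg : forall k, (Cmod (g k) <= K * rho ^ k)%R).
  { intros k. apply (Clim_Cmod_le (fun N => f N k)); [intros; apply Hf|apply Hfg]. }
  assert (tail : forall u m M, (forall n, Cmod (u n) <= K * rho ^ n)%R -> Clim (csum u) m ->
     (Cmod (m - csum u M) <= K * rho ^ M / (1 - rho))%R).
  { intros u m M Hu Hm.
    apply (Clim_Cmod_le (fun n => csum u (M + n) - csum u M)).
    - intros n. apply geom_tail; [exact Hr|exact Hu|lia].
    - apply Clim_minus; [|apply Clim_const].
      apply (Clim_subseq (csum u) m (fun n => M + n)%nat); [intros; lia|exact Hm]. }
  apply Clim_squeeze with (fun N => Cmod (L N - l)); [intros; lra|].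
  apply is_lim_seq_spec. intros eps.
  assert (HM : exists M, (K * rho ^ M / (1 - rho) < eps / 3)%R).
  { assert (Hz : is_lim_seq (fun M => (K * rho ^ M / (1 - rho))%R) 0).
    { apply is_lim_seq_ext with (fun M => (K / (1 - rho)) * rho ^ M)%R.
      intros; field; lra.
      replace (Finite 0) with (Finite (K / (1 - rho) * 0)) by (f_equal; ring).
      apply is_lim_seq_mult'; [apply is_lim_seq_const|].
      apply is_lim_seq_geom. rewrite Rabs_pos_eq; lra. }
    apply is_lim_seq_spec in Hz.
    assert (He : (0 < eps / 3)%R) by (pose proof (cond_pos eps); lra).
    destruct (Hz (mkposreal _ He)) as [M HM]. exists M.
    specialize (HM M (le_n _)). simpl in HM. rewrite Rminus_0_r in HM.
    eapply Rle_lt_trans; [apply Rle_abs|exact HM]. }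
  destruct HM as [M HM].
  assert (Hfin : Clim (fun N => csum (f N) M - csum g M) 0).
  { replace (RtoC 0) with (csum g M - csum g M) by ring.
    apply Clim_minus; [apply Clim_csum; auto|apply Clim_const]. }
  apply Clim_Cmod in Hfin. rewrite Cmod_0 in Hfin.
  apply is_lim_seq_spec in Hfin.
  assert (He : (0 < eps / 3)%R) by (pose proof (cond_pos eps); lra).
  destruct (Hfin (mkposreal _ He)) as [N0 HN0]. exists N0. intros N HN.
  specialize (HN0 N HN). simpl in HN0. rewrite Rminus_0_r in HN0 |- *.
  rewrite Rabs_pos_eq in HN0 |- * by apply Cmod_ge_0.
  pose proof (tail _ _ M (Hf N) (HL N)) as T1.
  pose proof (tail _ _ M Hg Hl) as T2.
  replace (L N - l) with ((L N - csum (f N) M) + (csum (f N) M - csum g M) + - (l - csum g M)) by ring.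
  eapply Rle_lt_trans; [apply Cmod_triangle|]. rewrite Cmod_opp.
  pose proof (Cmod_triangle (L N - csum (f N) M) (csum (f N) M - csum g M)). lra.
Qed.

(** * The complex exponential *)

Lemma Cexp_plus (a b : C) : Cexp (a + b) = Cexp a * Cexp b.
Proof.
  destruct a as [a1 a2], b as [b1 b2]. apply Ceq; unfold Cexp; simpl;
  rewrite exp_plus, ?cos_plus, ?sin_plus; ring.
Qed.

Lemma Cexp_0 : Cexp 0 = 1.
Proof. apply Ceq; unfold Cexp; simpl; rewrite exp_0, ?cos_0, ?sin_0; ring. Qed.

Lemma Cmod_Cexp (z : C) : Cmod (Cexp z) = exp (Re z).
Proof.
  unfold Cmod, Cexp; simpl.
  replace (_ + _)%R with ((exp (Re z))² * ((sin (Im z))² + (cos (Im z))²))%R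
    by (unfold Rsqr; ring).
  rewrite sin2_cos2, Rmult_1_r. apply sqrt_Rsqr, Rlt_le, exp_pos.
Qed.

Lemma Cexp_neq_0 (z : C) : Cexp z <> 0.
Proof.
  apply Cmod_gt_0. rewrite Cmod_Cexp. apply exp_pos.
Qed.

Lemma Cexp_opp (z : C) : Cexp (- z) = / Cexp z.
Proof.
  assert (H : Cexp z * Cexp (- z) = 1).
  { rewrite <- Cexp_plus, <- Cexp_0. f_equal. ring. }
  rewrite <- (Cmult_1_r (/ Cexp z)), <- H. field. apply Cexp_neq_0.
Qed.

Lemma Cexp_pow (z : C) n : Cexp z ^ n = Cexp (INR n * z).
Proof.
  induction n.
  - simpl. rewrite <- Cexp_0. f_equal. ring.
  - rewrite Cpow_S, IHn, <- Cexp_plus. f_equal. rewrite S_INR, RtoC_plus. ring.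
Qed.

Lemma Cexp_PI : Cexp (PI * Ci) = - (1).
Proof.
  unfold Cexp. apply Ceq; simpl.
  - replace (PI * 0 - 0 * 1)%R with 0%R by ring.
    replace (PI * 1 + 0 * 0)%R with PI by ring. rewrite exp_0, cos_PI. ring.
  - replace (PI * 0 - 0 * 1)%R with 0%R by ring.
    replace (PI * 1 + 0 * 0)%R with PI by ring. rewrite sin_PI. ring.
Qed.

Lemma Cexp_PI_nat n : Cexp (INR n * (PI * Ci)) = (- (1)) ^ n.
Proof. now rewrite <- Cexp_pow, Cexp_PI. Qed.

Lemma Cexp_2PI_Z (n : Z) : Cexp (2 * PI * Ci * IZR n) = 1.
Proof.
  assert (H : forall k : nat, Cexp (2 * PI * Ci * INR k) = 1).
  { intros k. replace (2 * PI * Ci * INR k) with (INR k * (PI * Ci + PI * Ci)) by ring.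
    rewrite <- Cexp_pow, Cexp_plus, Cexp_PI.
    replace (- (1) * - (1)) with (RtoC 1) by ring. apply Cpow_1_l. }
  destruct (Z_le_gt_dec 0 n) as [Hn|Hn].
  - rewrite <- (Z2Nat.id n Hn), <- INR_IZR_INZ. apply H.
  - replace n with (- Z.of_nat (Z.to_nat (- n)))%Z by lia.
    rewrite opp_IZR, <- INR_IZR_INZ, RtoC_opp.
    replace (2 * PI * Ci * - INR (Z.to_nat (- n))) with (- (2 * PI * Ci * INR (Z.to_nat (- n)))) by ring.
    rewrite Cexp_opp, H. field. 
Qed.

Lemma Cexp_eq_mod (a b : C) (n : Z) : a = b + 2 * PI * Ci * IZR n -> Cexp a = Cexp b.
Proof. intros ->. rewrite Cexp_plus, Cexp_2PI_Z. ring. Qed.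

Lemma Re_plus (a b : C) : Re (a + b) = (Re a + Re b)%R.
Proof. reflexivity. Qed.

Lemma Re_mult_r (a : C) (x : R) : Re (a * x) = (Re a * x)%R.
Proof. destruct a; simpl; ring. Qed.

(** * Sums over the integers *)

Definition fold_Z (v : Z -> C) (n : nat) : C := v (Z.of_nat n) + v (- Z.of_nat n - 1)%Z.

(** The partial sum over the half-open window [-M <= n < M]. Such windows are
    unions of complete residue systems modulo [L] when [L] divides [M], which
    [Zlim_residues] exploits. *)
Definition zsum (v : Z -> C) (M : nat) : C := csum (fold_Z v) M.

Definition Zlim (v : Z -> C) (l : C) : Prop := Clim (zsum v) l.

(** Geometric decay in both directions; it yields convergence of both halves of the
    sum and lets the summation window be moved. *)
Definition geo (v : Z -> C) : Prop :=
  exists K rho, (0 <= rho < 1)%R /\ forall n, (Cmod (v n) <= K * rho ^ Z.abs_nat n)%R.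

Lemma geo_pow_pos K rho v : (0 <= rho < 1)%R ->
  (forall n : Z, Cmod (v n) <= K * rho ^ Z.abs_nat n)%R -> (0 <= K)%R.
Proof.
  intros Hr H. specialize (H 0%Z). simpl in H. pose proof (Cmod_ge_0 (v 0%Z)). lra.
Qed.

Lemma geo_halves v : geo v ->
  geom_bounded (fun n => v (Z.of_nat n)) /\ geom_bounded (fun n => v (- Z.of_nat n - 1)%Z).
Proof.
  intros (K & rho & Hr & H). pose proof (geo_pow_pos _ _ _ Hr H) as HK.
  split; exists K, rho; (split; [exact Hr|]); intros n.
  - eapply Rle_trans; [apply H|]. rewrite Zabs2Nat.id. lra.
  - eapply Rle_trans; [apply H|].
    replace (Z.abs_nat (- Z.of_nat n - 1)) with (S n) by lia. simpl.
    assert (0 <= rho ^ n)%R by (apply pow_le; lra).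
    apply Rmult_le_compat_l; [exact HK|]. nra.
Qed.

Lemma geo_Zlim v : geo v -> Zlim v (Cseries_Z v).
Proof.
  intros H. destruct (geo_halves v H) as [H1 H2].
  apply geom_bounded_Clim in H1. apply geom_bounded_Clim in H2.
  destruct H1 as [a Ha], H2 as [b Hb].
  unfold Cseries_Z. rewrite (Cseries_unique _ _ Ha), (Cseries_unique _ _ Hb).
  unfold Zlim, zsum.
  eapply Clim_ext; [|apply Clim_plus; [exact Ha|exact Hb]].
  intros n; simpl. now rewrite <- csum_plus.
Qed.

Lemma Zlim_Cseries v l : geo v -> Zlim v l -> Cseries_Z v = l.
Proof. intros H1 H2. apply (Clim_unique (zsum v)); [now apply geo_Zlim|exact H2]. Qed.

Lemma Zlim_ext u v l : (forall n, u n = v n) -> Zlim u l -> Zlim v l.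
Proof.
  intros E. apply Clim_ext. intros n. apply csum_ext. intros; unfold fold_Z. now rewrite !E.
Qed.

Lemma zsum_scal c v n : zsum (fun k => c * v k) n = c * zsum v n.
Proof.
  unfold zsum. rewrite <- csum_scal. apply csum_ext. intros; unfold fold_Z; ring.
Qed.

Lemma zsum_plus u v n : zsum (fun k => u k + v k) n = zsum u n + zsum v n.
Proof.
  unfold zsum. rewrite <- csum_plus. apply csum_ext. intros; unfold fold_Z; ring.
Qed.

Lemma Zlim_scal c v l : Zlim v l -> Zlim (fun n => c * v n) (c * l).
Proof.
  intros H. eapply Clim_ext; [|apply Clim_scal, H].
  intros; simpl; now rewrite zsum_scal.
Qed.

Lemma Zlim_plus u v l m : Zlim u l -> Zlim v m -> Zlim (fun n => u n + v n) (l + m).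
Proof.
  intros H H'. eapply Clim_ext; [|apply Clim_plus; [apply H|apply H']].
  intros; simpl; now rewrite zsum_plus.
Qed.

Lemma geo_ext u v : (forall n, u n = v n) -> geo u -> geo v.
Proof. intros E (K & rho & Hr & H). exists K, rho. split; [exact Hr|]. intros n. now rewrite <- E. Qed.

Lemma geo_ends v (f : nat -> Z) : (forall n, (n <= Z.abs_nat (f n))%nat) -> geo v ->
  Clim (fun M => v (f M)) 0.
Proof.
  intros Hf (K & rho & Hr & H). pose proof (geo_pow_pos _ _ _ Hr H) as HK.
  apply Clim_squeeze with (fun n => K * rho ^ n)%R.
  - intros n. replace (v (f n) - 0) with (v (f n)) by ring.
    eapply Rle_trans; [apply H|]. apply Rmult_le_compat_l; [exact HK|].
    replace (Z.abs_nat (f n)) with (n + (Z.abs_nat (f n) - n))%nat by (specialize (Hf n); lia).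
    rewrite pow_add. rewrite <- (Rmult_1_r (rho ^ n)) at 2.
    apply Rmult_le_compat_l; [apply pow_le; lra|].
    generalize (Z.abs_nat (f n) - n)%nat as k. intros k. rewrite <- (pow1 k).
    apply pow_incr; lra.
  - replace (Finite 0) with (Finite (K * 0)) by (f_equal; ring).
    apply is_lim_seq_mult'; [apply is_lim_seq_const|].
    apply is_lim_seq_geom. rewrite Rabs_pos_eq; lra.
Qed.

Lemma Zlim_window v l (w : Z -> C) (f g : nat -> Z) :
  geo v -> Zlim v l ->
  (forall n, (n <= Z.abs_nat (f n))%nat) -> (forall n, (n <= Z.abs_nat (g n))%nat) ->
  (forall M, zsum w M = zsum v M + v (f M) - v (g M)) -> Zlim w l.
Proof.
  intros Hg Hv Hf1 Hg1 E.
  apply Clim_ext with (fun M => zsum v M + v (f M) - v (g M)); [intros; now rewrite E|].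
  replace l with (l + 0 - 0) by ring.
  apply Clim_minus; [apply Clim_plus; [exact Hv|]|]; apply geo_ends; assumption.
Qed.

Lemma Zlim_shift v l : geo v -> Zlim v l -> Zlim (fun n => v (n + 1)%Z) l.
Proof.
  intros Hg Hv. apply (Zlim_window v l _ Z.of_nat (fun M => - Z.of_nat M)%Z Hg Hv); try (intros; lia).
  induction M; [unfold zsum; simpl; ring|].
  unfold zsum in *. cbn [csum]. rewrite IHM. unfold fold_Z.
  replace (Z.of_nat (S M)) with (Z.of_nat M + 1)%Z by lia.
  replace (- Z.of_nat M - 1 + 1)%Z with (- Z.of_nat M)%Z by lia.
  replace (- (Z.of_nat M + 1))%Z with (- Z.of_nat M - 1)%Z by lia. ring.
Qed.

Lemma Zlim_reflect v l : geo v -> Zlim v l -> Zlim (fun n => v (- n)%Z) l.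
Proof.
  intros Hg Hv. apply (Zlim_window v l _ Z.of_nat (fun M => - Z.of_nat M)%Z Hg Hv); try (intros; lia).
  induction M; [unfold zsum; simpl; ring|].
  unfold zsum in *. cbn [csum]. rewrite IHM. unfold fold_Z.
  replace (Z.of_nat (S M)) with (Z.of_nat M + 1)%Z by lia.
  replace (- (- Z.of_nat M - 1))%Z with (Z.of_nat M + 1)%Z by lia.
  replace (- (Z.of_nat M + 1))%Z with (- Z.of_nat M - 1)%Z by lia. ring.
Qed.

Lemma geo_reindex v (s : Z) (e : Z) : (e = 1 \/ e = -1)%Z -> geo v -> geo (fun n => v (e * n + s)%Z).
Proof.
  intros He (K & rho & Hr & H). pose proof (geo_pow_pos _ _ _ Hr H) as HK.
  destruct (Req_dec rho 0) as [->|Hr0].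
  - (* for a null ratio, 1/2 is used instead so that powers can be inverted *)
    exists (K * 2 ^ Z.abs_nat s)%R, (/ 2)%R. split; [lra|]. intros n.
    eapply Rle_trans; [apply H|]. rewrite Rmult_assoc. apply Rmult_le_compat_l; [exact HK|].
    destruct (Z.abs_nat (e * n + s)) eqn:E.
    + simpl. assert (E2 : Z.abs_nat n = Z.abs_nat s) by lia. rewrite E2, <- Rpow_mult_distr.
      replace (2 * / 2)%R with 1%R by field. rewrite pow1. lra.
    + simpl. rewrite Rmult_0_l. apply Rmult_le_pos; apply pow_le; lra.
  - exists (K * (/ rho) ^ Z.abs_nat s)%R, rho. split; [lra|]. intros n.
    eapply Rle_trans; [apply H|]. rewrite Rmult_assoc. apply Rmult_le_compat_l; [exact HK|].
    assert (Hp : (0 < rho ^ Z.abs_nat s)%R) by (apply pow_lt; lra).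
    apply Rmult_le_reg_l with (1 := Hp).
    rewrite <- Rmult_assoc, <- Rpow_mult_distr, Rinv_r, pow1, Rmult_1_l by lra.
    rewrite <- pow_add.
    replace (Z.abs_nat s + Z.abs_nat (e * n + s))%nat with
      (Z.abs_nat n + (Z.abs_nat s + Z.abs_nat (e * n + s) - Z.abs_nat n))%nat by lia.
    rewrite pow_add. rewrite <- (Rmult_1_r (rho ^ Z.abs_nat n)) at 2.
    apply Rmult_le_compat_l; [apply pow_le; lra|].
    match goal with |- (_ ^ ?k <= _)%R => rewrite <- (pow1 k) end. apply pow_incr; lra.
Qed.

Lemma Zlim_shift_back v l : geo v -> Zlim v l -> Zlim (fun n => v (n - 1)%Z) l.
Proof.
  intros Hg Hv.
  assert (Hg' : geo (fun n => v (- n)%Z)).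
  { apply geo_ext with (fun n => v (-1 * n + 0)%Z); [intros; f_equal; lia|].
    apply geo_reindex; [lia|exact Hg]. }
  assert (Hg2 : geo (fun n => v (- (n + 1))%Z)).
  { apply geo_ext with (fun n => v (-1 * n + -1)%Z); [intros; f_equal; lia|].
    apply geo_reindex; [lia|exact Hg]. }
  pose proof (Zlim_reflect _ _ Hg2 (Zlim_shift _ _ Hg' (Zlim_reflect _ _ Hg Hv))) as H.
  apply Zlim_ext with (2 := H). intros n; simpl. f_equal. lia.
Qed.

Lemma csum_rev v n : csum (fun k => v (n - 1 - k)%nat) n = csum v n.
Proof.
  induction n; [reflexivity|].
  rewrite csum_S_l. cbn [csum]. rewrite <- IHn.
  replace (S n - 1 - 0)%nat with n by lia.
  rewrite Cplus_comm. f_equal. apply csum_ext. intros k Hk. f_equal. lia.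
Qed.

Lemma zsum_residues v (L M : nat) :
  zsum v (L * M) = csum (fun mu => zsum (fun n => v (Z.of_nat L * n + Z.of_nat mu)%Z) M) L.
Proof.
  induction M.
  - rewrite Nat.mul_0_r. unfold zsum; simpl. now rewrite csum_zero.
  - rewrite Nat.mul_succ_r. unfold zsum at 1. rewrite csum_add.
    change (csum (fold_Z v) (L * M)) with (zsum v (L * M)). rewrite IHM.
    unfold zsum at 2. cbn [csum]. rewrite csum_plus. f_equal.
    unfold fold_Z. rewrite !csum_plus. f_equal.
    + apply csum_ext. intros; f_equal; lia.
    + rewrite <- csum_rev. apply csum_ext. intros k Hk. f_equal. lia.
Qed.

(** Along windows whose half-length is a multiple of [L], the partial sums split exactly
    into those of the residue classes; the rest is uniqueness of limits. *)
Lemma Zlim_residues v l (L : nat) (lm : nat -> C) :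
  (0 < L)%nat -> Zlim v l ->
  (forall mu, (mu < L)%nat -> Zlim (fun n => v (Z.of_nat L * n + Z.of_nat mu)%Z) (lm mu)) ->
  l = csum lm L.
Proof.
  intros HL Hv Hm. apply (Clim_unique (fun M => zsum v (L * M))).
  - apply (Clim_subseq (zsum v) l (fun M => L * M)%nat); [intros; nia|exact Hv].
  - apply Clim_ext with (fun M => csum (fun mu => zsum (fun n => v (Z.of_nat L * n + Z.of_nat mu)%Z) M) L).
    + intros M. now rewrite zsum_residues.
    + apply Clim_csum. exact Hm.
Qed.

Lemma zsum_Zlim_sym v l : geo v -> Zlim v l -> Clim (fun n => zsum v n + v (Z.of_nat n)) l.
Proof.
  intros Hg Hv. replace l with (l + 0) by ring. apply Clim_plus; [exact Hv|].
  apply geo_ends; [intros; lia|exact Hg].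
Qed.

(** A negative quadratic form beats any linear one, which makes a Gaussian decay
    like [exp (- |x|)]. *)
Lemma quadratic_bound (a b : R) : (a < 0)%R -> exists K, forall x, (a * x ^ 2 + b * x <= K - Rabs x)%R.
Proof.
  intros Ha. exists ((Rabs b + 1) ^ 2 / (4 * - a))%R. intros x.
  assert (H1 : (b * x <= Rabs b * Rabs x)%R).
  { rewrite <- Rabs_mult. apply Rle_abs. }
  assert (H2 : (x ^ 2 = Rabs x ^ 2)%R) by (rewrite <- Rsqr_pow2, Rsqr_abs, Rsqr_pow2; reflexivity).
  rewrite H2. set (y := Rabs x) in *. set (c := Rabs b) in *.
  assert (H3 : ((c + 1) ^ 2 / (4 * - a) - (a * y ^ 2 + (c + 1) * y) =
    (2 * - a * y - (c + 1)) ^ 2 / (4 * - a))%R) by (field; lra).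
  assert (0 <= (2 * - a * y - (c + 1)) ^ 2 / (4 * - a))%R.
  { apply Rmult_le_pos; [apply pow2_ge_0|]. apply Rlt_le, Rinv_0_lt_compat; lra. }
  nra.
Qed.

Definition gauss (A B D : C) (x : R) : C := Cexp (A * x ^ 2 + B * x + D).

Lemma gauss_bound (A B D : C) : (Re A < 0)%R ->
  exists K, (0 <= K)%R /\ forall x, (Cmod (gauss A B D x) <= K * exp (- Rabs x))%R.
Proof.
  intros HA. destruct (quadratic_bound (Re A) (Re B) HA) as [K HK].
  exists (exp (K + Re D)). split; [apply Rlt_le, exp_pos|]. intros x.
  unfold gauss. rewrite Cmod_Cexp, <- exp_plus.
  assert (E : (Re (A * x ^ 2 + B * x + D) = Re A * x ^ 2 + Re B * x + Re D)%R).
  { rewrite !Re_plus, <- RtoC_pow, !Re_mult_r. reflexivity. }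
  rewrite E. specialize (HK x).
  assert (H : (Re A * x ^ 2 + Re B * x + Re D <= K + Re D + - Rabs x)%R) by lra.
  destruct H as [H|H]; [left; now apply exp_increasing|right; now rewrite H].
Qed.

Lemma exp_neg_Rabs_IZR (n : Z) : exp (- Rabs (IZR n)) = (exp (- 1) ^ Z.abs_nat n)%R.
Proof.
  rewrite <- abs_IZR, <- Zabs2Nat.id_abs, <- INR_IZR_INZ.
  generalize (Z.abs_nat n) as k. induction k.
  - simpl. now rewrite Ropp_0, exp_0.
  - rewrite S_INR. simpl. rewrite <- IHk, <- exp_plus. f_equal. ring.
Qed.

Lemma exp_neg_1_bounds : (0 <= exp (- 1) < 1)%R.
Proof.
  split; [apply Rlt_le, exp_pos|]. rewrite <- exp_0. apply exp_increasing. lra.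
Qed.

Lemma geo_gauss (A B D : C) : (Re A < 0)%R -> geo (fun n => gauss A B D (IZR n)).
Proof.
  intros HA. destruct (gauss_bound A B D HA) as (K & HK & H).
  exists K, (exp (- 1)). split; [exact exp_neg_1_bounds|].
  intros n. rewrite <- exp_neg_Rabs_IZR. apply H.
Qed.

(** * Integrals of complex functions of a real variable *)

Notation CM := C_R_CompleteNormedModule.

Definition Ccont (f : R -> C) : Prop := forall x, continuous (U := CM) f x.

Definition CInt (f : R -> C) (a b : R) : C := RInt (V := CM) f a b.

Lemma norm_Cmod (z : C) : norm (V := CM) z = Cmod z.
Proof.
  unfold Cmod. destruct z as [a b]. unfold norm; simpl. unfold prod_norm; simpl.
  unfold norm; simpl. unfold abs; simpl. f_equal. rewrite !Rmult_1_r, <- !Rabs_mult.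
  rewrite !Rabs_pos_eq; nra.
Qed.

Lemma Ccont_pair (f : R -> C) :
  (forall x, continuous (fun t => Re (f t)) x) -> (forall x, continuous (fun t => Im (f t)) x) ->
  Ccont f.
Proof.
  intros H1 H2 x. 
  apply (continuous_ext (fun t => (Re (f t), Im (f t)))).
  { intros t; now destruct (f t). }
  apply filterlim_locally. intros eps.
  generalize (filter_and _ _ (proj1 (filterlim_locally _ _) (H1 x) eps) (proj1 (filterlim_locally _ _)
    (H2 x) eps)).
  apply filter_imp. intros t [Ha Hb]. split; assumption.
Qed.

Lemma Ccont_Re f : Ccont f -> forall x, continuous (fun t => Re (f t)) x.
Proof.
  intros H x. apply filterlim_locally. intros eps.
  generalize (proj1 (filterlim_locally _ _) (H x) eps). apply filter_imp.
  intros t Ht. apply Ht.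
Qed.

Lemma Ccont_Im f : Ccont f -> forall x, continuous (fun t => Im (f t)) x.
Proof.
  intros H x. apply filterlim_locally. intros eps.
  generalize (proj1 (filterlim_locally _ _) (H x) eps). apply filter_imp.
  intros t Ht. apply Ht.
Qed.

Lemma Ccont_mult f g : Ccont f -> Ccont g -> Ccont (fun x => f x * g x).
Proof.
  intros Hf Hg. apply Ccont_pair; intros x; simpl.
  - apply (continuous_minus (V := R_NormedModule)); apply (continuous_mult (K := R_AbsRing));
    first [now apply Ccont_Re | now apply Ccont_Im].
  - apply (continuous_plus (V := R_NormedModule)); apply (continuous_mult (K := R_AbsRing));
    first [now apply Ccont_Re | now apply Ccont_Im].
Qed.

Lemma Ccont_const c : Ccont (fun _ => c).
Proof. intros x. apply continuous_const. Qed.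

Lemma Ccont_plus f g : Ccont f -> Ccont g -> Ccont (fun x => f x + g x).
Proof. intros Hf Hg x. apply (continuous_plus (V := CM)); [apply Hf|apply Hg]. Qed.

Lemma Ccont_Cmod f : Ccont f -> forall x, continuous (fun t => Cmod (f t)) x.
Proof.
  intros H x. apply (continuous_ext (fun t => norm (V := CM) (f t))).
  { intros; apply norm_Cmod. }
  apply (continuous_comp (V := CM) (W := R_UniformSpace) f (fun z => norm z)); [apply H|].
  apply (filterlim_norm (V := CM)).
Qed.

Lemma Ccont_gauss A B D : Ccont (gauss A B D).
Proof.
  destruct A as [a1 a2], B as [b1 b2], D as [d1 d2].
  apply Ccont_pair; intros x; apply (ex_derive_continuous (K := R_AbsRing) (V := R_NormedModule));
  unfold gauss, Cexp; simpl; auto_derive; trivial.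
Qed.

Lemma CInt_correct f a b : Ccont f -> is_RInt (V := CM) f a b (CInt f a b).
Proof.
  intros H. apply (RInt_correct (V := CM)), (ex_RInt_continuous (V := CM)). intros; apply H.
Qed.

Lemma CInt_unique f a b l : is_RInt (V := CM) f a b l -> CInt f a b = l.
Proof. apply (is_RInt_unique (V := CM)). Qed.

Lemma CInt_ext f g a b : (forall x, f x = g x) -> CInt f a b = CInt g a b.
Proof. intros H. apply (RInt_ext (V := CM)). intros; apply H. Qed.

Lemma is_CInt_scal c f a b l : is_RInt (V := CM) f a b l -> is_RInt (V := CM) (fun x => c * f x) a b (c * l).
Proof.
  intros H.
  pose proof (is_RInt_fct_extend_fst (U := R_NormedModule) (V := R_NormedModule) f a b l H) as H1.
  pose proof (is_RInt_fct_extend_snd (U := R_NormedModule) (V := R_NormedModule) f a b l H) as H2.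
  apply (is_RInt_fct_extend_pair (U := R_NormedModule) (V := R_NormedModule)).
  - apply (is_RInt_minus (V := R_NormedModule)); now apply (is_RInt_scal (V := R_NormedModule)).
  - apply (is_RInt_plus (V := R_NormedModule)); now apply (is_RInt_scal (V := R_NormedModule)).
Qed.

Lemma CInt_scal c f a b : Ccont f -> CInt (fun x => c * f x) a b = c * CInt f a b.
Proof. intros H. now apply CInt_unique, is_CInt_scal, CInt_correct. Qed.

Lemma CInt_plus f g a b : Ccont f -> Ccont g ->
  CInt (fun x => f x + g x) a b = CInt f a b + CInt g a b.
Proof.
  intros H1 H2. apply CInt_unique.
  apply (is_RInt_plus (V := CM)); now apply CInt_correct.
Qed.

Lemma CInt_Chasles f a b c : Ccont f -> CInt f a b + CInt f b c = CInt f a c.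
Proof.
  intros H. symmetry. apply CInt_unique.
  apply (is_RInt_Chasles (V := CM) f a b c); now apply CInt_correct.
Qed.

Lemma CInt_Cmod_le f (g : R -> R) a b lg : (a <= b)%R -> Ccont f ->
  (forall x, a <= x <= b -> Cmod (f x) <= g x)%R -> is_RInt g a b lg ->
  (Cmod (CInt f a b) <= lg)%R.
Proof.
  intros Hab Hf Hg Hi. rewrite <- norm_Cmod.
  apply (norm_RInt_le (V := CM) f g a b _ lg Hab); [|now apply CInt_correct|exact Hi].
  intros x Hx. rewrite norm_Cmod. now apply Hg.
Qed.

Lemma CInt_comp_lin f (k c a b : R) : Ccont f ->
  CInt (fun x => k * f (k * x + c)%R) a b = CInt f (k * a + c) (k * b + c).
Proof.
  intros H. apply CInt_unique.
  apply (is_RInt_ext (V := CM) (fun x => scal k (f (k * x + c)%R))).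
  - intros x _. apply Ceq; simpl; unfold Re, Im; unfold scal; simpl; unfold mult; simpl; ring.
  - apply (is_RInt_comp_lin (V := CM)). now apply CInt_correct.
Qed.

Section AbelianGroup.

Context {G : AbelianGroup}.
Implicit Types a b c : G.

Lemma plus_minus_chain a b c : minus a c = plus (minus a b) (minus b c).
Proof.
  unfold minus. now rewrite <- plus_assoc, (plus_assoc (opp b)), plus_opp_l, plus_zero_l.
Qed.

Lemma opp_minus a b : opp (minus a b) = minus b a.
Proof.
  apply (plus_reg_l (minus a b)). rewrite plus_opp_r, <- plus_minus_chain.
  symmetry. apply minus_eq_zero.
Qed.

Lemma plus_minus_middle a b c : minus (plus a (plus b c)) b = plus a c.
Proof.
  unfold minus.
  rewrite (plus_comm b c), (plus_assoc a c b), <- (plus_assoc (plus a c) b).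
  now rewrite plus_opp_r, plus_zero_r.
Qed.

End AbelianGroup.

Lemma norm_minus_trans {V : NormedModule R_AbsRing} (x y z : V) (e1 e2 : R) :
  (norm (minus x y) <= e1)%R -> (norm (minus y z) <= e2)%R -> (norm (minus x z) <= e1 + e2)%R.
Proof.
  intros H1 H2. rewrite (plus_minus_chain x y z).
  eapply Rle_trans; [apply norm_triangle|]. lra.
Qed.

Lemma norm_minus_sym {V : NormedModule R_AbsRing} (x y : V) (e : R) :
  (norm (minus x y) <= e)%R -> (norm (minus y x) <= e)%R.
Proof. intros H. now rewrite <- (opp_minus x y), norm_opp. Qed.

Lemma exp_neg_small (c : R) (eps : posreal) : (0 <= c)%R ->
  exists n : nat, forall T, (INR n <= T)%R -> (c * exp (- T) < eps)%R.
Proof.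
  intros Hc. destruct (nfloor_ex (c / eps)%R) as [n [_ Hn]].
  { apply Rmult_le_pos; [exact Hc|]. apply Rlt_le, Rinv_0_lt_compat, cond_pos. }
  exists (S n). intros T HT. rewrite S_INR in HT.
  assert (HT0 : (c < T * eps)%R).
  { apply Rmult_lt_reg_r with (/ eps)%R; [apply Rinv_0_lt_compat, cond_pos|].
    rewrite Rmult_assoc, Rinv_r by (apply Rgt_not_eq, cond_pos).
    unfold Rdiv in Hn. lra. }
  pose proof (exp_ineq1_le T). pose proof (exp_pos T). pose proof (cond_pos eps).
  rewrite exp_Ropp. apply Rmult_lt_reg_r with (exp T); [lra|].
  rewrite Rmult_assoc, Rinv_l by lra. nra.
Qed.

Section ExponentialDecay.

Context {V : CompleteNormedModule R_AbsRing} (f : R -> V) (K : R).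
Hypothesis Hf : forall x, continuous f x.
Hypothesis HK : forall x, (norm (f x) <= K * exp (- Rabs x))%R.

Let HI a b : is_RInt f a b (RInt f a b).
Proof. apply (RInt_correct f), (ex_RInt_continuous f). intros; apply Hf. Qed.

Let K_pos : (0 <= K)%R.
Proof.
  specialize (HK 0%R). rewrite Rabs_R0, Ropp_0, exp_0 in HK.
  pose proof (norm_ge_0 (f 0%R)). lra.
Qed.

Lemma decay_right T b : (0 <= T <= b)%R -> (norm (RInt f T b) <= K * exp (- T))%R.
Proof.
  intros HT. pose proof K_pos.
  apply Rle_trans with (minus (- K * exp (- b)) (- K * exp (- T)))%R.
  - apply (norm_RInt_le f (fun x => K * exp (- x))%R T b); [lra| |apply HI|].
    + intros x Hx. eapply Rle_trans; [apply HK|]. rewrite Rabs_pos_eq; lra.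
    + apply (is_RInt_derive (fun x => - K * exp (- x))%R).
      * intros x _. auto_derive; [trivial|ring].
      * intros x _. apply (ex_derive_continuous (K := R_AbsRing) (V := R_NormedModule)).
        auto_derive; trivial.
  - unfold minus, plus, opp; simpl. pose proof (exp_pos (- b)). nra.
Qed.

Lemma decay_left T a : (0 <= T <= - a)%R -> (norm (RInt f a (- T)) <= K * exp (- T))%R.
Proof.
  intros HT. pose proof K_pos.
  apply Rle_trans with (minus (K * exp (- T)) (K * exp a))%R.
  - apply (norm_RInt_le f (fun x => K * exp x)%R a (- T)); [lra| |apply HI|].
    + intros x Hx. eapply Rle_trans; [apply HK|]. rewrite Rabs_left1, Ropp_involutive; lra.
    + apply (is_RInt_derive (fun x => K * exp x)%R).
      * intros x _. auto_derive; [trivial|ring].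
      * intros x _. apply (ex_derive_continuous (K := R_AbsRing) (V := R_NormedModule)).
        auto_derive; trivial.
  - unfold minus, plus, opp; simpl. pose proof (exp_pos a). nra.
Qed.

Lemma decay_windows T a b : (0 <= T)%R -> (a <= - T)%R -> (T <= b)%R ->
  (norm (minus (RInt f a b) (RInt f (- T) T)) <= 2 * K * exp (- T))%R.
Proof.
  intros HT Ha Hb.
  replace (minus (RInt f a b) (RInt f (- T) T)) with (plus (RInt f a (- T)) (RInt f T b)).
  - eapply Rle_trans; [apply (norm_triangle (K := R_AbsRing) (V := V))|].
    pose proof (decay_left T a) as h1. pose proof (decay_right T b) as h2.
    assert (norm (RInt f a (- T)) <= K * exp (- T))%R by (apply h1; lra).
    assert (norm (RInt f T b) <= K * exp (- T))%R by (apply h2; lra). lra.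
  - assert (E : RInt f a b = plus (RInt f a (- T)) (plus (RInt f (- T) T) (RInt f T b))).
    { apply (is_RInt_unique f), (is_RInt_Chasles f a (- T)); [apply HI|].
      apply (is_RInt_Chasles f (- T) T); apply HI. }
    rewrite E.
    symmetry. apply (plus_minus_middle (G := V)).
Qed.

(** Integrals over two windows containing [[- T, T]] differ by at most two tails beyond [T],
    so the centred windows form a Cauchy sequence, and the same estimate bounds its error. *)
Lemma decay_RInt_gen : exists l,
  is_RInt_gen f (Rbar_locally m_infty) (Rbar_locally p_infty) l /\
  forall T, (0 <= T)%R -> (norm (minus (RInt f (- T) T) l) <= 2 * K * exp (- T))%R.
Proof.
  pose proof K_pos as HK0.
  set (u := fun n : nat => RInt f (- INR n) (INR n)).
  assert (Hu : exists l : V, filterlim u eventually (locally l)).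
  { apply (proj1 (filterlim_locally_cauchy (U := V) (F := eventually) u)). intros eps.
    assert (He : (0 < eps / 2)%R) by (pose proof (cond_pos eps); lra).
    destruct (exp_neg_small (2 * K) (mkposreal _ He)) as [N HN]; [lra|].
    exists (fun n => (N <= n)%nat). split; [exists N; auto|].
    intros n m Hn Hm. apply (norm_compat1 (K := R_AbsRing) (V := V)).
    specialize (HN (INR N) (Rle_refl _)). simpl in HN.
    pose proof (pos_INR N). apply le_INR in Hn. apply le_INR in Hm.
    pose proof (decay_windows (INR N) (- INR n) (INR n) ltac:(lra) ltac:(lra) ltac:(lra)) as h1.
    pose proof (decay_windows (INR N) (- INR m) (INR m) ltac:(lra) ltac:(lra) ltac:(lra)) as h2.
    eapply Rle_lt_trans; [exact (norm_minus_trans (V := V) _ _ _ _ _ h2 (norm_minus_sym (V := V) _ _ _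
      h1))|]. lra. }
  destruct Hu as [l Hl]. exists l.
  assert (Htail : forall T, (0 <= T)%R -> (norm (minus (RInt f (- T) T) l) <= 2 * K * exp (- T))%R).
  { intros T HT. apply le_epsilon. intros eps Heps.
    assert (He : (0 < eps / (@norm_factor _ V))%R).
    { apply Rdiv_lt_0_compat; [exact Heps|apply norm_factor_gt_0]. }
    destruct (proj1 (filterlim_locally _ _) Hl (mkposreal _ He)) as [N HN].
    destruct (nfloor_ex T HT) as [n0 [_ Hn0]].
    set (n := (N + S n0)%nat). specialize (HN n ltac:(unfold n; lia)).
    apply (norm_compat2 (K := R_AbsRing) (V := V)) in HN. simpl in HN.
    replace (@norm_factor _ V * (eps / @norm_factor _ V))%R with eps in HN
      by (field; apply Rgt_not_eq, norm_factor_gt_0).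
    assert (HTn : (T <= INR n)%R).
    { unfold n. rewrite plus_INR, S_INR. pose proof (pos_INR N). lra. }
    pose proof (decay_windows T (- INR n) (INR n) HT ltac:(lra) HTn) as h.

    eapply Rle_trans; [exact (norm_minus_trans (V := V) _ _ _ _ _ (norm_minus_sym (V := V) _ _ _ h)
      (Rlt_le _ _ HN))|]. lra. }
  split; [|exact Htail].
  intros P [eps HP].
  destruct (exp_neg_small (4 * K) eps) as [N HN]; [lra|].
  specialize (HN (INR N) (Rle_refl _)). pose proof (pos_INR N).
  apply (Filter_prod _ _ _ (fun a => a <= - INR N)%R (fun b => INR N <= b)%R).
  - exists (- INR N)%R. intros; lra.
  - exists (INR N). intros; lra.
  - intros a b Ha Hb. exists (RInt f a b). split; [apply HI|].
    apply HP, (norm_compat1 (K := R_AbsRing) (V := V)).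
    pose proof (decay_windows (INR N) a b ltac:(lra) Ha Hb) as h1.
    pose proof (Htail (INR N) ltac:(lra)) as h2.
    eapply Rle_lt_trans; [exact (norm_minus_trans (V := V) _ _ _ _ _ h1 h2)|]. lra.
Qed.

End ExponentialDecay.

Lemma decay_Cintegrable (f : R -> C) K : Ccont f ->
  (forall x, Cmod (f x) <= K * exp (- Rabs x))%R ->
  Cintegrable_R f /\
  forall T, (0 <= T)%R -> (Cmod (CInt f (- T) T - Cintegral_R f) <= 2 * K * exp (- T))%R.
Proof.
  intros Hf HK.
  assert (HK' : forall x, (norm (V := CM) (f x) <= K * exp (- Rabs x))%R).
  { intros x. rewrite norm_Cmod. apply HK. }
  destruct (decay_RInt_gen (V := CM) f K Hf HK') as (l & Hl & HT).
  assert (El : Cintegral_R f = l).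
  { exact (is_RInt_gen_unique (V := CM) (Fa := Rbar_locally m_infty) (Fb := Rbar_locally p_infty) f l Hl). }
  split; [split|].
  - exists l. exact Hl.
  - destruct (decay_RInt_gen (V := R_CompleteNormedModule) (fun x => Cmod (f x)) K) as (l' & Hl' & _).
    + now apply Ccont_Cmod.
    + intros x. unfold norm; simpl. unfold abs; simpl.
      rewrite Rabs_pos_eq by apply Cmod_ge_0. apply HK.
    + exists l'. exact Hl'.
  - intros T H. rewrite El. specialize (HT T H). rewrite norm_Cmod in HT. exact HT.
Qed.

(** * Gaussian integrals *)

Lemma CInt_Re f a b : Ccont f -> Re (CInt f a b) = RInt (fun x => Re (f x)) a b.
Proof.
  intros H. symmetry. apply is_RInt_unique.
  apply (is_RInt_fct_extend_fst (U := R_NormedModule) (V := R_NormedModule) f a b _ (CInt_correct f a b H)).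
Qed.

Section ContourShift.

Variables (A c D : C).
Hypothesis HA : (Re A < 0)%R.

Let a1 := Re A. Let a2 := Im A.
Let c1 := Re c. Let c2 := Im c.
Let w1 := (2 * (a1 * c1 - a2 * c2))%R.
Let w2 := (2 * (a1 * c2 + a2 * c1))%R.
Let v1 := (a1 * (c1 ^ 2 - c2 ^ 2) - 2 * a2 * c1 * c2)%R.
Let v2 := (a2 * (c1 ^ 2 - c2 ^ 2) + 2 * a1 * c1 * c2)%R.

(** Real and imaginary parts of the exponent [A (x + s c)^2 + D]. *)
Let P (s x : R) := (a1 * x ^ 2 + s * w1 * x + s ^ 2 * v1 + Re D)%R.
Let Q (s x : R) := (a2 * x ^ 2 + s * w2 * x + s ^ 2 * v2 + Im D)%R.
Let h (s x : R) := (exp (P s x) * cos (Q s x))%R.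
Let hs (s x : R) := (exp (P s x) *
  ((w1 * x + 2 * s * v1) * cos (Q s x) - (w2 * x + 2 * s * v2) * sin (Q s x)))%R.
Let g (s x : R) := (exp (P s x) * (c1 * cos (Q s x) - c2 * sin (Q s x)))%R.

Let shifted (s : R) : R -> C := gauss A (2 * A * (s * c)) (A * (s * c) ^ 2 + D).

Lemma shifted_Re s x : Re (shifted s x) = h s x.
Proof.
  unfold shifted, gauss, Cexp, h, P, Q, w1, w2, v1, v2, a1, a2, c1, c2.
  destruct A as [A1 A2], c as [C1 C2], D as [D1 D2]; simpl.
  f_equal; [f_equal; ring|f_equal; ring].
Qed.

Lemma is_derive_h s x : is_derive (fun u => h u x) s (hs s x).
Proof. unfold h, hs, P, Q. auto_derive; [trivial|]. simpl. ring. Qed.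

(** The integrand is a function of [x + s c]; so moving the contour by [s] amounts
    to [c] times differentiating in [x]. *)
Lemma is_derive_g s x : is_derive (g s) x (hs s x).
Proof.
  unfold g, hs, P, Q. auto_derive; [trivial|].
  unfold w1, w2, v1, v2. simpl. ring.
Qed.

Let c2d_poly (k1 k2 k3 k4 s x : R) :
  continuity_2d_pt (fun s x => k1 * x ^ 2 + s * k2 * x + s ^ 2 * k3 + k4)%R s x.
Proof.
  apply continuity_2d_pt_ext with (fun s x => k1 * (x * x) + (s * k2) * x + (s * s) * k3 + k4)%R.
  { intros; ring. }
  repeat first [ apply continuity_2d_pt_plus | apply continuity_2d_pt_mult
    | apply continuity_2d_pt_id1 | apply continuity_2d_pt_id2 | apply continuity_2d_pt_const ].
Qed.

Lemma continuity_2d_hs s x : continuity_2d_pt hs s x.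
Proof.
  unfold hs.
  repeat first [ apply continuity_2d_pt_minus | apply continuity_2d_pt_plus | apply continuity_2d_pt_mult
    | apply continuity_2d_pt_id1 | apply continuity_2d_pt_id2 | apply continuity_2d_pt_const ].
  - apply continuity_1d_2d_pt_comp; [apply derivable_continuous, derivable_exp|apply c2d_poly].
  - apply continuity_1d_2d_pt_comp; [apply derivable_continuous, derivable_cos|apply c2d_poly].
  - apply continuity_1d_2d_pt_comp; [apply derivable_continuous, derivable_sin|apply c2d_poly].
Qed.

Lemma continuous_h s x : continuous (h s) x.
Proof.
  apply (ex_derive_continuous (K := R_AbsRing) (V := R_NormedModule)).
  unfold h, P, Q. auto_derive; trivial.
Qed.

Lemma continuous_hs s x : continuous (hs s) x.
Proof.
  apply (ex_derive_continuous (K := R_AbsRing) (V := R_NormedModule)).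
  unfold hs, P, Q. auto_derive; trivial.
Qed.

Lemma is_derive_window T s :
  is_derive (fun u => RInt (h u) (- T) T) s (g s T - g s (- T))%R.
Proof.
  assert (E : RInt (fun t => Derive (fun u => h u t) s) (- T) T = (g s T - g s (- T))%R).
  { rewrite (RInt_ext _ (hs s)) by (intros x _; apply is_derive_unique, is_derive_h).
    apply is_RInt_unique. apply (is_RInt_derive (g s)).
    - intros; apply is_derive_g.
    - intros; apply continuous_hs. }
  rewrite <- E. apply is_derive_RInt_param.
  - apply filter_forall. intros u t _. eexists. apply is_derive_h.
  - intros t _. apply continuity_2d_pt_ext with hs; [|apply continuity_2d_hs].
    intros u v. symmetry. apply is_derive_unique, is_derive_h.
  - apply filter_forall. intros u. apply (ex_RInt_continuous (h u)).
    intros; apply continuous_h.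
Qed.

Lemma window_shift_bound : exists M, forall T, (0 <= T)%R ->
  (Rabs (RInt (h 1) (- T) T - RInt (h 0) (- T) T) <= M * exp (- T))%R.
Proof.
  destruct (quadratic_bound a1 (Rabs w1) HA) as [K HK].
  exists (2 * (exp (K + Rabs v1 + Re D) * (Rabs c1 + Rabs c2)))%R. intros T HT.
  destruct (MVT_gen (fun u => RInt (h u) (- T) T) 0 1 (fun s => g s T - g s (- T))%R) as (s & Hs & E).
  - intros; apply is_derive_window.
  - intros s _. apply derivable_continuous_pt. exists (g s T - g s (- T))%R.
    apply is_derive_Reals, is_derive_window.
  - rewrite E. rewrite Rmin_left, Rmax_right in Hs by lra.
    assert (Hg : forall x, (Rabs x = T)%R ->
      (Rabs (g s x) <= exp (K + Rabs v1 + Re D) * (Rabs c1 + Rabs c2) * exp (- T))%R).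
    { intros x Hx. unfold g. rewrite Rabs_mult, (Rabs_pos_eq (exp _)) by apply Rlt_le, exp_pos.
      rewrite (Rmult_comm (exp (K + _ + _))), Rmult_assoc, <- exp_plus, Rmult_comm.
      apply Rmult_le_compat; [apply Rabs_pos|apply Rlt_le, exp_pos| |].
      - eapply Rle_trans; [apply Rabs_triang|]. rewrite Rabs_Ropp, !Rabs_mult.
        assert (Rabs (cos (Q s x)) <= 1)%R by (apply Rabs_le; pose proof (COS_bound (Q s x)); lra).
        assert (Rabs (sin (Q s x)) <= 1)%R by (apply Rabs_le; pose proof (SIN_bound (Q s x)); lra).
        pose proof (Rabs_pos c1). pose proof (Rabs_pos c2). nra.
      - assert (HP : (P s x <= K + Rabs v1 + Re D + - T)%R).
        { unfold P. specialize (HK (Rabs x)). rewrite Hx, (Rabs_pos_eq T) in HK by lra.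
          assert (x ^ 2 = T ^ 2)%R by (rewrite <- Hx, <- !Rsqr_pow2; apply Rsqr_abs).
          assert (s * w1 * x <= Rabs w1 * T)%R.
          { apply Rle_trans with (Rabs (s * w1 * x)); [apply Rle_abs|].
            rewrite !Rabs_mult, Hx, (Rabs_pos_eq s) by lra.
            apply Rmult_le_compat_r; [lra|]. pose proof (Rabs_pos w1). nra. }
          assert (s ^ 2 * v1 <= Rabs v1)%R.
          { pose proof (Rle_abs v1). pose proof (Rabs_pos v1).
            pose proof (pow2_ge_0 s). assert (s ^ 2 <= 1)%R by nra.
              apply Rle_trans with (s ^ 2 * Rabs v1)%R; [apply Rmult_le_compat_l; lra|]. nra. }
          rewrite H. lra. }
        destruct HP as [HP|HP]; [left; now apply exp_increasing|right; now rewrite HP]. }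
    pose proof (Hg T (Rabs_pos_eq _ HT)) as h1.
    pose proof (Hg (- T)%R ltac:(rewrite Rabs_Ropp; apply (Rabs_pos_eq _ HT))) as h2.
    replace ((g s T - g s (- T)) * (1 - 0))%R with (g s T + - g s (- T))%R by ring.
    eapply Rle_trans; [apply Rabs_triang|]. rewrite Rabs_Ropp. lra.
Qed.

(** The two sides of the rectangle swept by the contour contribute [O(exp (- T))]. *)
Lemma Re_shift_bound : exists M, forall T, (0 <= T)%R ->
  (Rabs (Re (CInt (gauss A (2 * A * c) (A * c ^ 2 + D)) (- T) T)
         - Re (CInt (gauss A 0 D) (- T) T)) <= M * exp (- T))%R.
Proof.
  destruct window_shift_bound as [M HM]. exists M. intros T HT. specialize (HM T HT).
  assert (E : forall s f, (forall x, shifted s x = f x) -> Ccont f ->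
     RInt (h s) (- T) T = Re (CInt f (- T) T)).
  { intros s f Hf Hc. rewrite CInt_Re by exact Hc. apply RInt_ext. intros x _.
    rewrite <- Hf. symmetry. apply shifted_Re. }
  rewrite (E 1%R (gauss A (2 * A * c) (A * c ^ 2 + D))) in HM; [|intros x; unfold shifted; f_equal;
    ring|apply Ccont_gauss].
  rewrite (E 0%R (gauss A 0 D)) in HM; [exact HM|intros x; unfold shifted; f_equal; ring|apply Ccont_gauss].
Qed.

End ContourShift.

Lemma gauss_scal A B D E x : Cexp E * gauss A B D x = gauss A B (E + D) x.
Proof. unfold gauss. rewrite <- Cexp_plus. f_equal. ring. Qed.

(** Multiplication by [- i], absorbed in the constant of the exponent, turns statements
    on real parts into statements on imaginary parts. *)
Lemma Im_as_Re (z : C) : Im z = Re (Cexp (- (PI * Ci / 2)) * z).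
Proof.
  unfold Cexp. destruct z as [x y]; simpl.
  match goal with |- context [exp ?a] => replace a with 0%R by field end.
  match goal with |- context [cos ?a] => replace a with (- (PI / 2))%R by field end.
  rewrite exp_0, cos_neg, sin_neg, cos_PI2, sin_PI2. ring.
Qed.

(** Equal to [sqrt (- pi / A)] for a suitable branch of the root. It is kept as a symbol,
    so that no branch has to be followed. *)
Definition gauss_int (A : C) : C := Cintegral_R (gauss A 0 0).

Lemma Cintegral_windows (f : R -> C) K l : Ccont f ->
  (forall x, Cmod (f x) <= K * exp (- Rabs x))%R ->
  Clim (fun n => CInt f (- INR n) (INR n)) l -> Cintegral_R f = l.
Proof.
  intros Hc HK Hl. destruct (decay_Cintegrable f K Hc HK) as [_ HT].
  apply (Clim_unique (fun n => CInt f (- INR n) (INR n))); [|exact Hl].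
  eapply Clim_squeeze; [intros n; apply HT, pos_INR|].
  apply is_lim_seq_spec. intros eps.
  assert (HK0 : (0 <= K)%R).
  { specialize (HK 0%R). rewrite Rabs_R0, Ropp_0, exp_0 in HK. pose proof (Cmod_ge_0 (f 0%R)). lra. }
  destruct (exp_neg_small (2 * K) eps) as [N HN]; [lra|]. exists N. intros n Hn.
  rewrite Rminus_0_r, Rabs_pos_eq.
  - apply HN, le_INR, Hn.
  - pose proof (exp_pos (- INR n)). nra.
Qed.

Lemma exp_neg_lim (M : R) : is_lim_seq (fun n => M * exp (- INR n))%R 0.
Proof.
  replace (Finite 0) with (Finite (M * 0)) by (f_equal; ring).
  apply is_lim_seq_mult'; [apply is_lim_seq_const|].
  apply is_lim_seq_spec. intros eps.
  destruct (exp_neg_small 1 eps) as [N HN]; [lra|]. exists N. intros n Hn.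
  rewrite Rminus_0_r, Rabs_pos_eq by apply Rlt_le, exp_pos.
  specialize (HN (INR n) (le_INR _ _ Hn)). lra.
Qed.

Lemma gauss_integrable A B D (k : C) : (Re A < 0)%R -> Cintegrable_R (fun x => k * gauss A B D x).
Proof.
  intros HA. destruct (gauss_bound A B D HA) as (K & HK0 & HK).
  apply (decay_Cintegrable _ (Cmod k * K)).
  - apply Ccont_mult; [apply Ccont_const|apply Ccont_gauss].
  - intros x. rewrite Cmod_mult, Rmult_assoc. apply Rmult_le_compat_l; [apply Cmod_ge_0|apply HK].
Qed.

Lemma gauss_windows A B D : (Re A < 0)%R ->
  Clim (fun n => CInt (gauss A B D) (- INR n) (INR n)) (Cintegral_R (gauss A B D)).
Proof.
  intros HA. destruct (gauss_bound A B D HA) as (K & HK0 & HK).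
  destruct (decay_Cintegrable _ K (Ccont_gauss A B D) HK) as [_ HT].
  eapply Clim_squeeze; [intros n; apply HT, pos_INR|]. apply exp_neg_lim.
Qed.

Lemma gauss_integral_scal A B D (k : C) : (Re A < 0)%R ->
  Cintegral_R (fun x => k * gauss A B D x) = k * Cintegral_R (gauss A B D).
Proof.
  intros HA. destruct (gauss_bound A B D HA) as (K & HK0 & HK).
  apply (Cintegral_windows _ (Cmod k * K) _).
  - apply Ccont_mult; [apply Ccont_const|apply Ccont_gauss].
  - intros x. rewrite Cmod_mult, Rmult_assoc. apply Rmult_le_compat_l; [apply Cmod_ge_0|apply HK].
  - eapply Clim_ext; [|apply Clim_scal, gauss_windows, HA].
    intros n; simpl. symmetry. apply CInt_scal, Ccont_gauss.
Qed.

Lemma Cintegral_ext f g : (forall x, f x = g x) -> Cintegral_R f = Cintegral_R g.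
Proof. intros H. f_equal. now apply FunctionalExtensionality.functional_extensionality. Qed.

(** After completing the square the integrand is a translate, by a complex number, of the
    Gaussian without linear term; [Re_shift_bound] moves the contour back to the real line. *)
Lemma gauss_integral A B D : (Re A < 0)%R ->
  Cintegral_R (gauss A B D) = Cexp (D - B ^ 2 / (4 * A)) * gauss_int A.
Proof.
  intros HA.
  assert (HA0 : A <> 0) by (intros ->; simpl in HA; lra).
  set (c := B / (2 * A)).
  assert (E : forall E x, Cexp E * gauss A B D x = Cexp (D - B ^ 2 / (4 * A)) * gauss A (2 * A * c) (A *
    c ^ 2 + E) x).
  { intros E x. unfold gauss, c. rewrite <- !Cexp_plus. f_equal. field. exact HA0. }
  assert (S : Cintegral_R (gauss A (2 * A * c) (A * c ^ 2 + 0)) = gauss_int A).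
  { destruct (gauss_bound A (2 * A * c) (A * c ^ 2 + 0) HA) as (K & HK0 & HK).
    apply (Cintegral_windows _ K _ (Ccont_gauss _ _ _) HK).
    replace (gauss_int A) with (0 + gauss_int A) by ring.
    eapply Clim_ext; [|apply Clim_plus; [|apply gauss_windows, HA]].
    { intros n. instantiate (1 := fun n => CInt (gauss A (2 * A * c) (A * c ^ 2 + 0)) (- INR n) (INR n) -
      CInt (gauss A 0 0) (- INR n) (INR n)). simpl. ring. }
    destruct (Re_shift_bound A c 0 HA) as [M1 HM1].
    destruct (Re_shift_bound A c (- (PI * Ci / 2)) HA) as [M2 HM2].
    apply Clim_squeeze with (fun n => (M1 + M2) * exp (- INR n))%R; [|apply exp_neg_lim].
    intros n. specialize (HM1 (INR n) (pos_INR n)). specialize (HM2 (INR n) (pos_INR n)).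
    eapply Rle_trans; [apply Cmod_le_Re_Im|].
    rewrite Rmult_plus_distr_r. apply Rplus_le_compat.
    - eapply Rle_trans; [|exact HM1]. apply Req_le. f_equal. simpl. unfold Re. ring.
    - eapply Rle_trans; [|exact HM2]. apply Req_le. f_equal.
      assert (G : forall B' D' a b, Re (CInt (gauss A B' (D' + - (PI * Ci / 2))) a b) = Im (CInt (gauss A
        B' (D' + 0)) a b)).
      { intros. rewrite Im_as_Re, <- CInt_scal by apply Ccont_gauss. f_equal.
        apply CInt_ext. intros x. rewrite gauss_scal. f_equal. ring. }
      rewrite G. replace (- (PI * Ci / 2)) with (0 + - (PI * Ci / 2)) by ring.
      rewrite G, !Cplus_0_r. simpl. unfold Im. ring. }
  rewrite <- S, <- gauss_integral_scal by exact HA.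
  apply Cintegral_ext. intros x. rewrite <- E, Cexp_0. ring.
Qed.

Lemma gauss_int_scale A (k : R) : (Re A < 0)%R -> (0 < k)%R ->
  k * gauss_int (k ^ 2 * A) = gauss_int A.
Proof.
  intros HA Hk.
  assert (HkA : (Re (k ^ 2 * A) < 0)%R).
  { rewrite <- RtoC_pow, Cmult_comm, Re_mult_r. assert (0 < k ^ 2)%R by (apply pow_lt; lra). nra. }
  assert (E : forall T, k * CInt (gauss (k ^ 2 * A) 0 0) (- T) T = CInt (gauss A 0 0) (- (k * T)) (k * T)).
  { intros T. rewrite <- CInt_scal by apply Ccont_gauss.
    replace (CInt (gauss A 0 0) (- (k * T)) (k * T))
      with (CInt (gauss A 0 0) (k * - T + 0) (k * T + 0)) by (f_equal; ring).
    rewrite <- CInt_comp_lin by apply Ccont_gauss. apply CInt_ext. intros x.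
    unfold gauss. f_equal. f_equal. rewrite Rplus_0_r, RtoC_mult. ring. }
  destruct (gauss_bound A 0 0 HA) as (K & HK0 & HK).
  destruct (decay_Cintegrable _ K (Ccont_gauss A 0 0) HK) as [_ HT].
  apply (Clim_unique (fun n => k * CInt (gauss (k ^ 2 * A) 0 0) (- INR n) (INR n))).
  - apply Clim_scal, gauss_windows, HkA.
  - apply Clim_squeeze with (fun n => 2 * K * exp (- (k * INR n)))%R.
    + intros n. rewrite E. apply HT. apply Rmult_le_pos; [lra|apply pos_INR].
    + replace (Finite 0) with (Finite (2 * K * 0)) by (f_equal; ring).
      apply is_lim_seq_mult'; [apply is_lim_seq_const|].
      apply is_lim_seq_ext with (fun n => exp (- k) ^ n)%R.
      { intros n. induction n; simpl.
        - now rewrite Rmult_0_r, Ropp_0, exp_0.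
        - rewrite IHn, <- exp_plus. f_equal. destruct n; simpl; ring. }
      apply is_lim_seq_geom. rewrite Rabs_pos_eq by apply Rlt_le, exp_pos.
      rewrite <- exp_0. apply exp_increasing. lra.
Qed.

(** * Poisson summation for Gaussians *)

(** The Dirichlet kernel, and the unnormalized Fejer kernel [fejer N], which is
    [N] times the usual one. *)
Fixpoint dirichlet (n : nat) (x : R) : R :=
  match n with
  | O => 1
  | S k => (dirichlet k x + 2 * cos (2 * PI * INR (S k) * x))%R
  end.

Fixpoint fejer (N : nat) (x : R) : R :=
  match N with O => 0 | S k => (fejer k x + dirichlet k x)%R end.

Lemma dirichlet_sin n x :
  (dirichlet n x * sin (PI * x) = sin (PI * x * (2 * INR n + 1)))%R.
Proof.
  induction n.
  - simpl. rewrite Rmult_1_l. f_equal. ring.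
  - cbn [dirichlet]. rewrite Rmult_plus_distr_r, IHn, S_INR.
    replace (PI * x * (2 * INR n + 1))%R with (2 * PI * (INR n + 1) * x - PI * x)%R by ring.
    replace (PI * x * (2 * (INR n + 1) + 1))%R with (2 * PI * (INR n + 1) * x + PI * x)%R by ring.
    rewrite sin_plus, sin_minus. ring.
Qed.

(** Source of both the positivity of the kernel and its concentration at the integers. *)
Lemma fejer_sin N x : (fejer N x * sin (PI * x) ^ 2 = sin (PI * x * INR N) ^ 2)%R.
Proof.
  induction N.
  - simpl. rewrite Rmult_0_r, sin_0. ring.
  - cbn [fejer]. rewrite Rmult_plus_distr_r, IHN.
    replace (dirichlet N x * sin (PI * x) ^ 2)%R with (dirichlet N x * sin (PI * x) * sin (PI * x))%R by ring.
    rewrite dirichlet_sin, S_INR.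
    set (u := (PI * x * INR N)%R). set (v := (PI * x)%R).
    replace (v * (2 * INR N + 1))%R with (u + (u + v))%R by (unfold u, v; ring).
    replace (v * (INR N + 1))%R with (u + v)%R by (unfold u, v; ring).
    (* sin (u + w) sin (w - u) = sin^2 w - sin^2 u, with w = u + v *)
    replace (sin v) with (sin ((u + v) - u)) by (f_equal; ring).
    set (w := (u + v)%R). rewrite sin_plus, sin_minus.
    pose proof (sin2_cos2 u) as h1. pose proof (sin2_cos2 w) as h2. unfold Rsqr in *.
    replace (sin u ^ 2)%R with (1 - cos u * cos u)%R by (rewrite <- h1; ring).
    transitivity (1 - cos u * cos u + (sin w * sin w * (cos u * cos u) - sin u * sin u * (cos w * cos
      w)))%R; [ring|].
    replace (cos w * cos w)%R with (1 - sin w * sin w)%R by (rewrite <- h2; ring).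
    replace (sin u * sin u)%R with (1 - cos u * cos u)%R by (rewrite <- h1; ring). ring.
Qed.

Lemma ex_derive_dirichlet n x : ex_derive (dirichlet n) x.
Proof.
  induction n; simpl.
  - apply (ex_derive_const (V := R_NormedModule)).
  - apply (ex_derive_plus (V := R_NormedModule)); [exact IHn|]. auto_derive. trivial.
Qed.

Lemma continuous_dirichlet n x : continuous (dirichlet n) x.
Proof. apply (ex_derive_continuous (K := R_AbsRing) (V := R_NormedModule)), ex_derive_dirichlet. Qed.

Lemma continuous_fejer N x : continuous (fejer N) x.
Proof.
  induction N; simpl; [apply continuous_const|].
  apply (continuous_plus (V := R_NormedModule)); [exact IHN|apply continuous_dirichlet].
Qed.

Lemma sin_PI_Z (n : Z) : sin (PI * IZR n) = 0%R.
Proof. apply sin_eq_0_1. exists n. ring. Qed.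

(** A weak form of Jordan's inequality. *)
Lemma sin_PI_lower (t : R) : (Rabs t <= / 2)%R -> (t ^ 2 <= sin (PI * t) ^ 2)%R.
Proof.
  assert (H : forall t, (0 <= t <= / 2)%R -> (t <= sin (PI * t))%R).
  { intros s Hs. pose proof PI_4. pose proof PI2_3_2. pose proof PI_RGT_0.
    assert (Hy : (0 <= PI * s <= 2)%R) by nra.
    destruct (pre_sin_bound (PI * s) 0) as [h _]; [lra|lra|].
    eapply Rle_trans; [|exact h]. unfold sin_approx, sin_term. simpl.
    set (y := (PI * s)%R) in *.
    replace (_ + _)%R with (y - y ^ 3 / 6)%R by field.
    assert (s <= y / 3)%R by (unfold y; nra). 
    assert (0 <= y * (4 - y ^ 2))%R by (apply Rmult_le_pos; nra). nra. }
  intros Ht. destruct (Rle_dec 0 t) as [H0|H0].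
  - rewrite Rabs_pos_eq in Ht by lra. specialize (H t ltac:(lra)). nra.
  - rewrite Rabs_left in Ht by lra. specialize (H (- t)%R ltac:(lra)).
    replace (PI * - t)%R with (- (PI * t))%R in H by ring. rewrite sin_neg in H. nra.
Qed.

Lemma dirichlet_ge_0_Z n (m : Z) : (0 <= dirichlet n (IZR m))%R.
Proof.
  assert (H : forall k, cos (2 * PI * INR k * IZR m) = 1%R).
  { intros k. replace (2 * PI * INR k * IZR m)%R with (2 * (PI * IZR (Z.of_nat k * m)))%R.
    - rewrite cos_2a_sin, sin_PI_Z. ring.
    - rewrite mult_IZR, <- INR_IZR_INZ. ring. }
  induction n; cbn [dirichlet]; [lra|]. rewrite H. lra.
Qed.

Lemma fejer_ge_0 N x : (0 <= fejer N x)%R.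
Proof.
  destruct (Req_dec (sin (PI * x)) 0) as [H|H].
  - apply sin_eq_0_0 in H. destruct H as [m Hm].
    assert (x = IZR m) as -> by (pose proof PI_RGT_0; nra).
    induction N; simpl; [lra|]. pose proof (dirichlet_ge_0_Z N m). lra.
  - assert (0 < sin (PI * x) ^ 2)%R by (pose proof (pow2_gt_0 _ H); lra).
    pose proof (fejer_sin N x). pose proof (pow2_ge_0 (sin (PI * x * INR N))). nra.
Qed.

Lemma is_RInt_constant (k a b l : R) : l = ((b - a) * k)%R -> is_RInt (fun _ => k) a b l.
Proof. intros ->. apply (is_RInt_const (V := R_NormedModule)). Qed.

Lemma is_RInt_dirichlet n a : is_RInt (dirichlet n) a (a + 1) 1%R.
Proof.
  induction n; cbn [dirichlet].
  - apply is_RInt_constant. ring.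
  - replace 1%R with (plus 1 0)%R at 2 by (unfold plus; simpl; ring).
    apply (is_RInt_plus (V := R_NormedModule)); [exact IHn|].
    set (k := INR (S n)). assert (Hk : (0 < k)%R) by (apply lt_0_INR; lia).
    pose proof PI_RGT_0.
    replace 0%R with (minus (sin (2 * PI * k * (a + 1)) / (PI * k)) (sin (2 * PI * k * a) / (PI * k)))%R.
    + apply (is_RInt_derive (fun x => sin (2 * PI * k * x) / (PI * k))%R).
      * intros x _. auto_derive; [trivial|]. field. lra.
      * intros x _. apply (ex_derive_continuous (K := R_AbsRing) (V := R_NormedModule)).
        auto_derive; trivial.
    + unfold minus, plus, opp; simpl.
      replace (2 * PI * k * (a + 1))%R with (2 * PI * k * a + 2 * INR (S n) * PI)%R by (unfold k; ring).
      rewrite sin_period. ring.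
Qed.

Lemma is_RInt_fejer N a : is_RInt (fejer N) a (a + 1) (INR N).
Proof.
  induction N; cbn [fejer].
  - apply is_RInt_constant. simpl. ring.
  - rewrite S_INR. apply (is_RInt_plus (V := R_NormedModule)); [exact IHN|apply is_RInt_dirichlet].
Qed.

Lemma RtoC_continuous (f : R -> R) : (forall x, continuous f x) -> Ccont (fun x => RtoC (f x)).
Proof. intros H. apply Ccont_pair; intros x; simpl; [apply H|apply continuous_const]. Qed.

(** The kernel has mass [N] on a unit interval and satisfies [fejer N x * sin^2 (pi x) <= 1].
    With [y = |x - n| <= delta + y^2 / delta] and [y^2 <= sin^2 (pi x)], the Lipschitz
    error integrates to at most [delta N + 1 / delta]. *)
Lemma fejer_sampling (f : R -> C) (n : Z) (H delta : R) N : Ccont f -> (0 < delta)%R -> (0 <= H)%R ->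
  (forall x, Rabs (x - IZR n) <= / 2 -> Cmod (f x - f (IZR n))%C <= H * Rabs (x - IZR n))%R ->
  (Cmod (CInt (fun x => fejer N x * f x)%C (IZR n - / 2) (IZR n + / 2) - INR N * f (IZR n))%C
    <= H * (delta * INR N + / delta))%R.
Proof.
  intros Hf Hd HH Hlip.
  assert (Hfej : Ccont (fun x => RtoC (fejer N x))) by (apply RtoC_continuous, continuous_fejer).
  assert (Hint : is_RInt (fejer N) (IZR n - / 2) (IZR n + / 2) (INR N)).
  { replace (IZR n + / 2)%R with (IZR n - / 2 + 1)%R by field. apply is_RInt_fejer. }
  assert (E : CInt (fun x => fejer N x * f x) (IZR n - / 2) (IZR n + / 2) - INR N * f (IZR n) =
     CInt (fun x => fejer N x * (f x - f (IZR n))) (IZR n - / 2) (IZR n + / 2)).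
  { rewrite (CInt_ext (fun x => fejer N x * (f x - f (IZR n)))
       (fun x => fejer N x * f x + (- f (IZR n)) * fejer N x)) by (intros; ring).
    rewrite CInt_plus, CInt_scal.
    - replace (CInt (fun x => RtoC (fejer N x)) (IZR n - / 2) (IZR n + / 2)) with (RtoC (INR N)); [ring|].
      symmetry. apply CInt_unique.
      apply (is_RInt_fct_extend_pair (U := R_NormedModule) (V := R_NormedModule)); [exact Hint|].
      apply (is_RInt_constant 0). ring.
    - exact Hfej.
    - now apply Ccont_mult.
    - apply Ccont_mult; [apply Ccont_const|exact Hfej]. }
  rewrite E.
  apply (CInt_Cmod_le _ (fun x => H * (delta * fejer N x + / delta)) (IZR n - / 2) (IZR n + / 2))%R.
  - lra.
  - apply Ccont_mult; [exact Hfej|].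
    apply (Ccont_plus f (fun _ => - f (IZR n)) Hf). apply Ccont_const.
  - intros x Hx. set (t := (x - IZR n)%R).
    assert (Ht : (Rabs t <= / 2)%R) by (apply Rabs_le; unfold t; lra).
    specialize (Hlip x Ht). fold t in Hlip.
    rewrite Cmod_mult, Cmod_R, Rabs_pos_eq by apply fejer_ge_0.
    pose proof (fejer_ge_0 N x) as HF.
    assert (Hs : (fejer N x * t ^ 2 <= 1)%R).
    { apply Rle_trans with (fejer N x * sin (PI * x) ^ 2)%R.
      - apply Rmult_le_compat_l; [exact HF|].
        replace (sin (PI * x) ^ 2)%R with (sin (PI * t) ^ 2)%R; [now apply sin_PI_lower|].
        replace (PI * t)%R with (PI * x - PI * IZR n)%R by (unfold t; ring).
        rewrite sin_minus, sin_PI_Z.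
        pose proof (sin2_cos2 (PI * IZR n)) as h. rewrite sin_PI_Z in h. unfold Rsqr in h.
        transitivity (sin (PI * x) ^ 2 * (0 * 0 + cos (PI * IZR n) * cos (PI * IZR n)))%R; [ring|].
        rewrite h. ring.
      - rewrite fejer_sin. pose proof (SIN_bound (PI * x * INR N)). nra. }
    apply Rle_trans with (fejer N x * (H * Rabs t))%R; [now apply Rmult_le_compat_l|].
    assert (Hy : (Rabs t <= delta + t ^ 2 / delta)%R).
    { replace (t ^ 2)%R with (Rabs t ^ 2)%R by (rewrite <- !Rsqr_pow2; symmetry; apply Rsqr_abs).
      pose proof (Rabs_pos t). apply Rmult_le_reg_r with delta; [exact Hd|].
      replace ((delta + Rabs t ^ 2 / delta) * delta)%R with (delta ^ 2 + Rabs t ^ 2)%R by (field; lra).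
      pose proof (pow2_ge_0 (Rabs t - delta)). nra. }
    apply Rle_trans with (H * (fejer N x * (delta + t ^ 2 / delta)))%R.
    + rewrite <- Rmult_assoc, (Rmult_comm (fejer N x)), Rmult_assoc.
      apply Rmult_le_compat_l; [exact HH|]. now apply Rmult_le_compat_l.
    + apply Rmult_le_compat_l; [exact HH|].
      replace (fejer N x * (delta + t ^ 2 / delta))%R with (delta * fejer N x + (fejer N x * t ^ 2) * /
        delta)%R by (field; lra).
      apply Rplus_le_compat_l. rewrite <- (Rmult_1_l (/ delta)) at 2.
      apply Rmult_le_compat_r; [|exact Hs]. apply Rlt_le, Rinv_0_lt_compat, Hd.
  - replace (H * (delta * INR N + / delta))%R with (scal H (plus (scal delta (INR N)) (scal (IZR n + / 2
    - (IZR n - / 2)) (/ delta))))%R.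
    + apply (is_RInt_scal (V := R_NormedModule)), (is_RInt_plus (V := R_NormedModule)).
      * now apply (is_RInt_scal (V := R_NormedModule)).
      * apply (is_RInt_const (V := R_NormedModule)).
    + unfold scal, plus; simpl; unfold mult; simpl. field. lra.
Qed.

(** Half of the quadratic exponent absorbs the linear factor of the derivative. *)
Lemma gauss_derive_bound A B D : (Re A < 0)%R -> exists K, (0 <= K)%R /\
  forall x : R, (Cmod ((2 * A * x + B) * gauss A B D x)%C <= K * exp (- Rabs x))%R.
Proof.
  intros HA.
  set (k := (2 * Cmod A + Cmod B)%R).
  assert (H2 : (Re (A / 2) < 0)%R).
  { replace (A / 2) with (A * RtoC (/ 2)) by (rewrite RtoC_inv by lra; reflexivity).
    rewrite Re_mult_r. lra. }
  destruct (gauss_bound (A / 2) B D H2) as (K1 & HK1 & h1).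
  destruct (gauss_bound (A / 2) 0 0 H2) as (K2 & HK2 & h2).
  exists (k * K1 * K2)%R. split.
  { unfold k. pose proof (Cmod_ge_0 A). pose proof (Cmod_ge_0 B). apply Rmult_le_pos; nra. }
  intros x. rewrite Cmod_mult.
  replace (gauss A B D x) with (gauss (A / 2) B D x * gauss (A / 2) 0 0 x).
  2:{ unfold gauss. rewrite <- Cexp_plus. f_equal. field. }
  rewrite Cmod_mult. specialize (h1 x). specialize (h2 x).
  assert (Hx : (Cmod (2 * A * x + B)%C <= k * exp (Rabs x))%R).
  { eapply Rle_trans; [apply Cmod_triangle|]. rewrite !Cmod_mult, !Cmod_R.
    rewrite (Rabs_pos_eq 2) by lra. unfold k.
    pose proof (Cmod_ge_0 A). pose proof (Cmod_ge_0 B). pose proof (Rabs_pos x).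
    pose proof (exp_ineq1_le (Rabs x)). nra. }
  assert (Hk : (0 <= k)%R) by (unfold k; pose proof (Cmod_ge_0 A); pose proof (Cmod_ge_0 B); lra).
  apply Rle_trans with ((k * exp (Rabs x)) * ((K1 * exp (- Rabs x)) * (K2 * exp (- Rabs x))))%R.
  - apply Rmult_le_compat; [apply Cmod_ge_0|apply Rmult_le_pos; apply Cmod_ge_0|exact Hx|].
    apply Rmult_le_compat; try apply Cmod_ge_0; assumption.
  - apply Req_le. 
    transitivity (k * K1 * K2 * exp (- Rabs x) * (exp (Rabs x) * exp (- Rabs x)))%R; [ring|].
    rewrite <- exp_plus, Rplus_opp_r, exp_0. ring.
Qed.

Lemma gauss_Re_diff A B D (x y : R) : exists z : R, (Rmin x y <= z <= Rmax x y)%R /\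
  (Re (gauss A B D y) - Re (gauss A B D x) = Re ((2 * A * z + B) * gauss A B D z)%C * (y - x))%R.
Proof.
  destruct (MVT_gen (fun t => Re (gauss A B D t)) x y (fun z : R => Re ((2 * A * z + B) * gauss A B D
    z))) as (z & Hz & E).
  - intros t _. destruct A as [a1 a2], B as [b1 b2], D as [d1 d2]. unfold gauss, Cexp; simpl.
    auto_derive; [trivial|]. simpl. unfold Rminus. ring.
  - intros t _. apply continuity_pt_filterlim. apply (Ccont_Re _ (Ccont_gauss A B D) t).
  - exists z. split; [exact Hz|exact E].
Qed.

Lemma gauss_lipschitz A B D : (Re A < 0)%R -> exists H, (0 <= H)%R /\
  forall (n : Z) x, (Rabs (x - IZR n) <= / 2)%R ->
   (Cmod (gauss A B D x - gauss A B D (IZR n))%C <= H * exp (- Rabs (IZR n)) * Rabs (x - IZR n))%R.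
Proof.
  intros HA.
  assert (G : forall D', exists H, (0 <= H)%R /\
    forall (n : Z) x, (Rabs (x - IZR n) <= / 2)%R ->
   (Rabs (Re (gauss A B D' x) - Re (gauss A B D' (IZR n))) <= H * exp (- Rabs (IZR n)) * Rabs (x - IZR n))%R).
  { intros D'. destruct (gauss_derive_bound A B D' HA) as (K & HK0 & HK).
    exists (K * exp 1)%R. split; [pose proof (exp_pos 1); nra|]. intros n x Hx.
    destruct (gauss_Re_diff A B D' (IZR n) x) as (z & Hz & E). rewrite E, Rabs_mult.
    apply Rmult_le_compat_r; [apply Rabs_pos|].
    eapply Rle_trans; [apply re_le_Cmod|]. eapply Rle_trans; [apply HK|].
    rewrite Rmult_assoc, <- exp_plus. apply Rmult_le_compat_l; [exact HK0|].
    assert (Hzn : (- Rabs z <= 1 + - Rabs (IZR n))%R).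
    { assert (Rabs (z - IZR n) <= / 2)%R.
      { revert Hz Hx. unfold Rmin, Rmax. destruct (Rle_dec (IZR n) x); intros Hz Hx;
        apply Rabs_le; apply Rabs_le_between in Hx; lra. }
      pose proof (Rabs_triang (- (z - IZR n)) z) as h. rewrite Rabs_Ropp in h.
      replace (- (z - IZR n) + z)%R with (IZR n) in h by ring. lra. }
    destruct Hzn as [h|h]; [left; now apply exp_increasing|right; now rewrite h]. }
  destruct (G D) as (H1 & HH1 & h1). destruct (G (- (PI * Ci / 2) + D)) as (H2 & HH2 & h2).
  exists (H1 + H2)%R. split; [lra|]. intros n x Hx.
  specialize (h1 n x Hx). specialize (h2 n x Hx). rewrite <- !gauss_scal, <- !Im_as_Re in h2.
  eapply Rle_trans; [apply Cmod_le_Re_Im|]. simpl. unfold Re, Im in *. rewrite !Rmult_plus_distr_r.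
    now apply Rplus_le_compat.
Qed.

Lemma Cexp_cos (t : R) : Cexp (Ci * t) + Cexp (- (Ci * t)) = 2 * cos t.
Proof.
  unfold Cexp. apply Ceq; simpl;
  match goal with |- context [exp ?a] => replace a with 0%R by ring end;
  match goal with |- context [exp (- ?a)] => replace (- a)%R with 0%R by ring end;
  replace (0 * 0 + 1 * t)%R with t by ring; rewrite exp_0, ?cos_neg, ?sin_neg; ring.
Qed.

Lemma Re_inv_neg (A : C) (r : R) : (Re A < 0)%R -> (0 < r)%R -> (Re (r / A) < 0)%R.
Proof.
  destruct A as [a b]. simpl. intros HA Hr.
  assert (Hp : (0 < a * (a * 1) + b * (b * 1))%R) by nra.
  replace (r * (a / (a * (a * 1) + b * (b * 1))) - 0 * (- b / (a * (a * 1) + b * (b * 1))))%R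
   with (- (r * - a / (a * (a * 1) + b * (b * 1))))%R by (field; lra).
  apply Ropp_lt_gt_0_contravar. apply Rdiv_lt_0_compat; [nra|exact Hp].
Qed.

Lemma Re_neg_neq_0 (A : C) : (Re A < 0)%R -> A <> 0.
Proof. intros HA E. rewrite E in HA. simpl in HA. lra. Qed.

Lemma Ccont_csum (f : nat -> R -> C) N : (forall n, Ccont (f n)) -> Ccont (fun x => csum (fun n => f n x) N).
Proof.
  intros H. induction N; simpl; [apply Ccont_const|]. now apply Ccont_plus.
Qed.

Lemma CInt_csum (f : nat -> R -> C) N a b : (forall n, Ccont (f n)) ->
  CInt (fun x => csum (fun n => f n x) N) a b = csum (fun n => CInt (f n) a b) N.
Proof.
  intros H. induction N; simpl.
  - apply CInt_unique. apply (is_RInt_ext (V := CM) (fun _ => zero)); [reflexivity|].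
    replace (RtoC 0) with (scal (V := CM) (b - a)%R (zero : CM)) by apply (scal_zero_r (V := CM)).
    apply (is_RInt_const (V := CM)).
  - rewrite CInt_plus, IHN; [reflexivity| |apply H]. now apply Ccont_csum.
Qed.

Lemma CInt_zsum (f : Z -> R -> C) N a b : (forall n, Ccont (f n)) ->
  CInt (fun x => zsum (fun k => f k x) N) a b = zsum (fun k => CInt (f k) a b) N.
Proof.
  intros H. unfold zsum. unfold fold_Z.
  rewrite (CInt_csum (fun n x => f (Z.of_nat n) x + f (- Z.of_nat n - 1)%Z x)).
  - apply csum_ext. intros. now apply CInt_plus.
  - intros. now apply Ccont_plus.
Qed.

Lemma CInt_unit_windows f M : Ccont f ->
  CInt f (- (INR M + / 2)) (INR M + / 2) =
  zsum (fun n => CInt f (IZR n - / 2) (IZR n + / 2)) M + CInt f (INR M - / 2) (INR M + / 2).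
Proof.
  intros Hf. induction M.
  - unfold zsum; simpl. rewrite Cplus_0_l. f_equal; ring.
  - unfold zsum. cbn [csum].
    change (csum (fold_Z ?v) M) with (zsum v M). unfold fold_Z.
    rewrite minus_IZR, opp_IZR, <- INR_IZR_INZ, S_INR.
    replace (zsum (fun n => CInt f (IZR n - / 2) (IZR n + / 2)) M +
     (CInt f (INR M - / 2) (INR M + / 2) + CInt f (- INR M - 1 - / 2) (- INR M - 1 + / 2)) +
     CInt f (INR M + 1 - / 2) (INR M + 1 + / 2))
    with (CInt f (- INR M - 1 - / 2) (- INR M - 1 + / 2) +
      (zsum (fun n => CInt f (IZR n - / 2) (IZR n + / 2)) M + CInt f (INR M - / 2) (INR M + / 2)) +
      CInt f (INR M + 1 - / 2) (INR M + 1 + / 2)) by ring.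
    rewrite <- IHM.
    replace (- INR M - 1 + / 2)%R with (- (INR M + / 2))%R by field.
    replace (INR M + 1 - / 2)%R with (INR M + / 2)%R by field.
    rewrite !CInt_Chasles by exact Hf. f_equal; ring.
Qed.

Lemma Clim_Cesaro (s : nat -> C) (l : C) : Clim s l -> Clim (fun N => / INR (S N) * csum s (S N)) l.
Proof.
  intros [H1 H2].
  assert (G : forall a m, is_lim_seq a (Finite m) -> is_lim_seq (fun N => / INR (S N) * sum_f_R0 a N)%R m).
  { intros a m H. apply is_lim_seq_Reals in H. apply Cesaro_1 in H. apply is_lim_seq_Reals in H.
    apply is_lim_seq_incr_1 in H. apply is_lim_seq_ext with (2 := H).
    intros n. simpl pred. unfold Rdiv. apply Rmult_comm. }
  assert (E : forall (p : C -> R) N, (forall a b : C, p (a + b)%C = p a + p b)%R -> p (RtoC 0) = 0%R ->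
    p (csum s (S N)) = sum_f_R0 (fun n => p (s n)) N).
  { intros p N Ha H0. induction N.
    - simpl. rewrite Ha, H0. ring.
    - cbn [csum] in *. rewrite Ha, IHN. reflexivity. }
  split.
  - apply is_lim_seq_ext with (2 := G _ _ H1). intros N.
    rewrite <- (E Re) by reflexivity. rewrite <- RtoC_inv by (apply not_0_INR; lia).
    rewrite Cmult_comm, Re_mult_r. apply Rmult_comm.
  - apply is_lim_seq_ext with (2 := G _ _ H2). intros N.
    rewrite <- (E Im) by reflexivity. rewrite <- RtoC_inv by (apply not_0_INR; lia).
    simpl. unfold Im. ring.
Qed.

Section Poisson.

Variables A B D : C.
Hypothesis HA : (Re A < 0)%R.

(** The integrand of the [k]-th Fourier coefficient. *)
Let g (k : Z) : R -> C := gauss A (B - 2 * PI * Ci * IZR k) D.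

Lemma dirichlet_gauss n x :
  dirichlet n x * gauss A B D x = zsum (fun k => g k x) n + g (Z.of_nat n) x.
Proof.
  induction n.
  - unfold zsum, g, gauss; simpl. rewrite Cmult_1_l, Cplus_0_l. f_equal. ring.
  - transitivity (dirichlet n x * gauss A B D x + 2 * cos (2 * PI * INR (S n) * x) * gauss A B D x).
    { cbn [dirichlet]. rewrite RtoC_plus, RtoC_mult. ring. }
    rewrite IHn, <- Cexp_cos.
    assert (E : forall k, g k x = Cexp (- (2 * PI * Ci * IZR k * x)) * gauss A B D x).
    { intros k. unfold g, gauss. rewrite <- Cexp_plus. f_equal. ring. }
    unfold zsum. cbn [csum]. change (csum (fold_Z (fun k => g k x)) n) with (zsum (fun k => g k x) n).
    unfold fold_Z. rewrite (E (- Z.of_nat n - 1)%Z), (E (Z.of_nat (S n))).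
    replace (- (2 * PI * Ci * IZR (- Z.of_nat n - 1) * x)) with (Ci * (2 * PI * INR (S n) * x)%R).
    2:{ rewrite minus_IZR, opp_IZR, <- INR_IZR_INZ, S_INR, RtoC_minus, RtoC_opp, !RtoC_mult, RtoC_plus. ring. }
    replace (- (2 * PI * Ci * IZR (Z.of_nat (S n)) * x)) with (- (Ci * (2 * PI * INR (S n) * x)%R)).
    2:{ rewrite <- INR_IZR_INZ, !RtoC_mult. ring. }
    ring.
Qed.

Lemma fejer_gauss N x :
  fejer N x * gauss A B D x = csum (fun n => zsum (fun k => g k x) n + g (Z.of_nat n) x) N.
Proof.
  induction N; cbn [fejer csum]; [ring|].
  rewrite RtoC_plus, Cmult_plus_distr_r, IHN, dirichlet_gauss. reflexivity.
Qed.

Let S0 := Cseries_Z (fun n => gauss A B D (IZR n)).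
Let c (k : Z) := Cintegral_R (g k).

(** Integrating the Gaussian against the kernel over the line gives the Fejer sum of
    Fourier coefficients exactly, and the sum of the samples up to the error of
    [fejer_sampling] on each unit interval. These errors are summable because the Lipschitz
    constants decay geometrically. *)
Lemma fejer_estimate : exists K, (0 <= K)%R /\ forall (N : nat) (delta : R), (0 < delta)%R ->
  (Cmod (csum (fun n => zsum c n + c (Z.of_nat n)) N - INR N * S0)%C <= K * (delta * INR N + / delta))%R.
Proof.
  destruct (gauss_lipschitz A B D HA) as (H & HH & Hlip).
  set (rho := exp (- 1)). pose proof exp_neg_1_bounds as Hr. fold rho in Hr.
  exists (H * (2 / (1 - rho) + 1))%R. split.
  { apply Rmult_le_pos; [exact HH|]. assert (0 < 2 / (1 - rho))%R by (apply Rdiv_lt_0_compat; lra). lra. }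
  intros N delta Hd.
  set (f := fun x : R => fejer N x * gauss A B D x).
  assert (Hf : Ccont f).
  { apply Ccont_mult; [apply RtoC_continuous, continuous_fejer|apply Ccont_gauss]. }
  set (E := (H * (delta * INR N + / delta))%R).
  assert (HE : (0 <= E)%R).
  { unfold E. apply Rmult_le_pos; [exact HH|]. pose proof (pos_INR N).
    assert (0 < / delta)%R by now apply Rinv_0_lt_compat. nra. }
  set (d := fun n : Z => CInt f (IZR n - / 2) (IZR n + / 2) + (- INR N) * gauss A B D (IZR n)).
  assert (Hdn : forall n, (Cmod (d n) <= E * rho ^ Z.abs_nat n)%R).
  { intros n. replace (d n) with (CInt f (IZR n - / 2) (IZR n + / 2) - INR N * gauss A B D (IZR n)) by
    (unfold d; ring).
    eapply Rle_trans.
    - apply (fejer_sampling _ n (H * exp (- Rabs (IZR n))) delta N (Ccont_gauss A B D) Hd).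
      + apply Rmult_le_pos; [exact HH|apply Rlt_le, exp_pos].
      + intros x Hx. apply Hlip, Hx.
    - rewrite exp_neg_Rabs_IZR. fold rho. unfold E. lra. }
  assert (Hwin : forall M, (Cmod (CInt f (- (INR M + / 2)) (INR M + / 2) - INR N * (zsum (fun n => gauss
    A B D (IZR n)) M + gauss A B D (INR M)))%C
     <= E * (2 / (1 - rho) + 1))%R).
  { intros M. rewrite CInt_unit_windows by exact Hf.
    match goal with |- (Cmod ?z <= _)%R => replace z with (zsum d M + d (Z.of_nat M)) end.
    2:{ unfold d at 1. rewrite zsum_plus, zsum_scal. unfold d. rewrite <- INR_IZR_INZ. ring. }
    eapply Rle_trans; [apply Cmod_triangle|]. rewrite Rmult_plus_distr_l. apply Rplus_le_compat.
    - pose proof (geom_tail (fold_Z d) (2 * E) rho 0 M Hr) as T. simpl in T.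
      unfold zsum. replace (csum (fold_Z d) M) with (csum (fold_Z d) M - 0) by ring.
      eapply Rle_trans; [apply T; [|lia]|apply Req_le; field; lra].
      intros n. unfold fold_Z. eapply Rle_trans; [apply Cmod_triangle|].
      pose proof (Hdn (Z.of_nat n)) as h1. pose proof (Hdn (- Z.of_nat n - 1)%Z) as h2.
      rewrite Zabs2Nat.id in h1. replace (Z.abs_nat (- Z.of_nat n - 1)) with (S n) in h2 by lia. simpl in h2.
      assert (0 <= rho ^ n)%R by (apply pow_le; lra).
      assert (rho * rho ^ n <= rho ^ n)%R by nra. nra.
    - eapply Rle_trans; [apply Hdn|]. apply Rmult_le_compat_l; [exact HE|].
      rewrite <- (pow1 (Z.abs_nat (Z.of_nat M))). apply pow_incr. lra. }
  replace (H * (2 / (1 - rho) + 1) * (delta * INR N + / delta))%R with (E * (2 / (1 - rho) + 1))%R by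
    (unfold E; ring).
  apply (Clim_Cmod_le _ _ _ Hwin).
  apply Clim_minus.
  - apply Clim_ext with (fun M => csum (fun n => zsum (fun k => CInt (g k) (- (INR M + / 2)) (INR M + / 2)) n
       + CInt (g (Z.of_nat n)) (- (INR M + / 2)) (INR M + / 2)) N).
    { intros M. rewrite (CInt_ext f (fun x => csum (fun n => zsum (fun k => g k x) n + g (Z.of_nat n) x)
      N)) by (intros; apply fejer_gauss).
      assert (Hg : forall k, Ccont (g k)) by (intros; apply Ccont_gauss).
      assert (Hz : forall n, Ccont (fun x => zsum (fun k => g k x) n)).
      { intros n. unfold zsum, fold_Z. apply (Ccont_csum (fun n x => g (Z.of_nat n) x + g (- Z.of_nat n -
        1)%Z x)).
        intros. now apply Ccont_plus. }
      rewrite (CInt_csum (fun n x => zsum (fun k => g k x) n + g (Z.of_nat n) x)).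
      - apply csum_ext. intros n _. rewrite CInt_plus; auto. now rewrite CInt_zsum.
      - intros n. now apply Ccont_plus. }
    assert (Hk : forall k, Clim (fun M => CInt (g k) (- (INR M + / 2)) (INR M + / 2)) (c k)).
    { intros k. destruct (gauss_bound A (B - 2 * PI * Ci * IZR k) D HA) as (K & HK0 & HK).
      destruct (decay_Cintegrable (g k) K (Ccont_gauss _ _ _) HK) as [_ HT].
      apply Clim_squeeze with (fun M => 2 * K * exp (- INR M))%R; [|apply exp_neg_lim].
      intros M. pose proof (pos_INR M). eapply Rle_trans; [apply HT; lra|].
      apply Rmult_le_compat_l; [lra|]. apply Rlt_le, exp_increasing. lra. }
    apply Clim_csum. intros n _. apply Clim_plus; [|apply Hk].
    apply Clim_csum. intros j _. apply Clim_plus; apply Hk.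
  - apply Clim_scal.
    apply Clim_ext with (fun M => zsum (fun n => gauss A B D (IZR n)) M + gauss A B D (IZR (Z.of_nat M))).
    { intros M. now rewrite <- INR_IZR_INZ. }
    apply (zsum_Zlim_sym (fun n => gauss A B D (IZR n))); [now apply geo_gauss|].
    apply geo_Zlim. now apply geo_gauss.
Qed.

Let dual (k : Z) : C := gauss ((PI ^ 2)%R / A) (PI * Ci * B / A) (D - B ^ 2 / (4 * A)) (IZR k).

Lemma geo_dual : geo dual.
Proof.
  apply geo_gauss. apply Re_inv_neg; [exact HA|]. apply pow_lt, PI_RGT_0.
Qed.

Lemma fourier_coefficient k : c k = gauss_int A * dual k.
Proof.
  unfold c, g. rewrite (gauss_integral _ _ _ HA), Cmult_comm. f_equal.
  unfold dual, gauss. f_equal. rewrite RtoC_pow.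
  assert (Hi : Ci ^ 2 = - (1)) by (apply Ceq; simpl; ring).
  transitivity (D - B ^ 2 / (4 * A) + PI * Ci * B / A * IZR k - Ci ^ 2 * PI ^ 2 / A * IZR k ^ 2).
  - field. exact (Re_neg_neq_0 A HA).
  - rewrite Hi. field. exact (Re_neg_neq_0 A HA).
Qed.

(** The Fourier coefficients being summable, their Cesaro means have the sum as limit;
    dividing [fejer_estimate] by [N] leaves an error of order [delta], which is arbitrary. *)
Theorem poisson_gauss : S0 = gauss_int A * Cseries_Z dual.
Proof.
  destruct fejer_estimate as (K & HK0 & HK).
  set (S1 := gauss_int A * Cseries_Z dual).
  assert (Hgc : geo c).
  { destruct geo_dual as (K1 & rho & Hr & H). exists (Cmod (gauss_int A) * K1)%R, rho. split; [exact Hr|].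
    intros n. rewrite fourier_coefficient, Cmod_mult, Rmult_assoc. apply Rmult_le_compat_l;
      [apply Cmod_ge_0|apply H]. }
  assert (HS1 : Clim (fun n => zsum c n + c (Z.of_nat n)) S1).
  { apply zsum_Zlim_sym; [exact Hgc|].
    apply Zlim_ext with (fun k => gauss_int A * dual k); [intros; symmetry; apply fourier_coefficient|].
    apply Zlim_scal, geo_Zlim, geo_dual. }
  assert (Hdelta : forall delta, (0 < delta)%R -> (Cmod (S1 - S0)%C <= K * delta)%R).
  { intros delta Hd.
    assert (Hlim : is_lim_seq (fun N => K * (delta + / delta * / INR (S N)))%R (K * (delta + / delta * 0))%R).
    { apply is_lim_seq_mult'; [apply is_lim_seq_const|].
      apply is_lim_seq_plus'; [apply is_lim_seq_const|].
      apply is_lim_seq_mult'; [apply is_lim_seq_const|].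
      apply (is_lim_seq_incr_1 (fun n => / INR n)%R).
      apply (is_lim_seq_inv INR p_infty is_lim_seq_INR). discriminate. }
    assert (HL := Clim_Cmod _ _ (Clim_minus _ _ _ _ (Clim_Cesaro _ _ HS1) (Clim_const S0))).
    replace (K * delta)%R with (K * (delta + / delta * 0))%R by ring.
    assert (Hle := fun H => is_lim_seq_le _ _ _ _ H HL Hlim). apply Hle.
    intros N. cbv beta. specialize (HK (S N) delta Hd).
    assert (HN : (0 < INR (S N))%R) by (apply lt_0_INR; lia).
    assert (HNC : RtoC (INR (S N)) <> 0) by (intros h; apply RtoC_inj in h; lra).
    match goal with |- (Cmod ?z <= _)%R => replace z with (/ INR (S N) * (csum (fun n => zsum c n + c
      (Z.of_nat n)) (S N) - INR (S N) * S0)) end.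
    2:{ field. exact HNC. }
    rewrite Cmod_mult, Cmod_inv, Cmod_R, Rabs_pos_eq by first [exact HNC | lra].
    apply Rmult_le_reg_l with (1 := HN). rewrite <- Rmult_assoc, Rinv_r, Rmult_1_l by lra.
    eapply Rle_trans; [exact HK|]. apply Req_le. field. lra. }
  assert (H0 : Cmod (S1 - S0) = 0%R).
  { apply Rle_antisym; [|apply Cmod_ge_0]. apply le_epsilon. intros eps He.
    assert (Hd : (0 < eps / (K + 1))%R) by (apply Rdiv_lt_0_compat; lra).
    eapply Rle_trans; [exact (Hdelta _ Hd)|].
    assert (K * (eps / (K + 1)) <= (K + 1) * (eps / (K + 1)))%R by (apply Rmult_le_compat_r; lra).
    replace ((K + 1) * (eps / (K + 1)))%R with eps in H by (field; lra). lra. }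
  apply Cmod_eq_0 in H0. replace S1 with (S0 + (S1 - S0)) by ring. rewrite H0. ring.
Qed.

End Poisson.

(** * Infinite products and the Jacobi triple product *)

Lemma Cprod_ext u v N : (forall n, u (S n) = v (S n)) -> Cprod u N = Cprod v N.
Proof. intros H. induction N; simpl; [reflexivity|]. now rewrite IHN, H. Qed.

Lemma Cprod_mult u v N : Cprod (fun n => u n * v n) N = Cprod u N * Cprod v N.
Proof. induction N; simpl; [ring|]. rewrite IHN. ring. Qed.

(** The partial products are bounded by [exp] of the geometric sum, so their increments
    decay geometrically. *)
Lemma Cprod_converges (a : nat -> C) K rho : (0 <= rho < 1)%R ->
  (forall n, Cmod (a (S n)) <= K * rho ^ n)%R ->
  exists l, Clim (Cprod (fun n => 1 + a n)) l.
Proof.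
  intros Hr Ha.
  assert (HK : (0 <= K)%R).
  { specialize (Ha O). simpl in Ha. pose proof (Cmod_ge_0 (a 1%nat)). lra. }
  set (P := Cprod (fun n => 1 + a n)).
  assert (HP : forall N, (Cmod (P N) <= exp (K / (1 - rho)))%R).
  { intros N. unfold P. apply Rle_trans with (exp (K * (1 - rho ^ N) / (1 - rho))).
    - induction N; simpl.
      + rewrite Cmod_1, Rminus_diag. unfold Rdiv. rewrite Rmult_0_r, Rmult_0_l, exp_0. lra.
      + rewrite Cmod_mult.
        replace (K * (1 - rho * rho ^ N) / (1 - rho))%R with (K * (1 - rho ^ N) / (1 - rho) + K * rho ^
          N)%R by (field; lra).
        rewrite exp_plus. apply Rmult_le_compat; try apply Cmod_ge_0; [exact IHN|].
        eapply Rle_trans; [apply Cmod_triangle|]. rewrite Cmod_1.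
        eapply Rle_trans; [|apply exp_ineq1_le]. specialize (Ha N). lra.
    - assert (h : (K * (1 - rho ^ N) / (1 - rho) <= K / (1 - rho))%R).
      { apply Rmult_le_compat_r; [apply Rlt_le, Rinv_0_lt_compat; lra|].
        assert (0 <= rho ^ N)%R by (apply pow_le; lra). nra. }
      destruct h as [h|h]; [left; now apply exp_increasing|right; now rewrite h]. }
  destruct (geom_bounded_Clim (fun n => P n * a (S n))) as [l Hl].
  { exists (exp (K / (1 - rho)) * K)%R, rho. split; [exact Hr|]. intros n.
    rewrite Cmod_mult, Rmult_assoc. apply Rmult_le_compat; try apply Cmod_ge_0; [apply HP|apply Ha]. }
  exists (1 + l).
  apply Clim_ext with (fun n => 1 + csum (fun n => P n * a (S n)) n).
  - intros N. induction N; [unfold P; simpl; ring|].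
    change (P (S N)) with (P N * (1 + a (S N))). cbn [csum]. rewrite Cplus_assoc, IHN. ring.
  - apply Clim_plus; [apply Clim_const|exact Hl].
Qed.

Lemma epow_plus v a b : epow v (a + b) = epow v a * epow v b.
Proof. unfold epow. rewrite <- Cexp_plus. f_equal. ring. Qed.

Lemma Re_PI_Ci_neg (tau : C) : (0 < Im tau)%R -> (Re (PI * Ci * tau) < 0)%R.
Proof.
  destruct tau as [a b]; simpl. pose proof PI_RGT_0. nra.
Qed.

Lemma Clim_Zshift (u : Z -> C) l (m : Z) :
  Clim (fun N => u (Z.of_nat N)) l -> Clim (fun N => u (Z.of_nat N + m)%Z) l.
Proof.
  intros H. destruct (Z_le_gt_dec 0 m) as [Hm|Hm].
  - apply Clim_ext with (fun N => u (Z.of_nat (N + Z.to_nat m))); [intros; f_equal; lia|].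
    apply (Clim_subseq (fun N => u (Z.of_nat N)) l (fun N => N + Z.to_nat m)%nat); [intros; lia|exact H].
  - destruct H as [H1 H2]. split.
    + apply (is_lim_seq_incr_n _ (Z.to_nat (- m))). apply is_lim_seq_ext with (2 := H1).
      intros n; do 2 f_equal; lia.
    + apply (is_lim_seq_incr_n _ (Z.to_nat (- m))). apply is_lim_seq_ext with (2 := H2).
      intros n; do 2 f_equal; lia.
Qed.

Section QSeries.

Variable tau : C.
Hypothesis Htau : (0 < Im tau)%R.

Let rho := exp (- (2 * PI * Im tau)).

Lemma rho_bounds : (0 <= rho < 1)%R.
Proof.
  split; [apply Rlt_le, exp_pos|]. unfold rho. rewrite <- exp_0. apply exp_increasing.
  pose proof PI_RGT_0. assert (0 < 2 * PI * Im tau)%R by (apply Rmult_lt_0_compat; lra). lra.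
Qed.

Lemma Cmod_epow_nat n : Cmod (epow tau (INR n)) = (rho ^ n)%R.
Proof.
  unfold epow. rewrite Cmod_Cexp.
  replace (Re _) with (- (2 * PI * Im tau) * INR n)%R by (unfold Re, Im; simpl; ring).
  unfold rho. induction n; [simpl; now rewrite Rmult_0_r, exp_0|].
  simpl pow. rewrite <- IHn, <- exp_plus, S_INR. f_equal. ring.
Qed.

Lemma rho_pow_S_le n : (rho ^ S n <= rho)%R.
Proof.
  pose proof rho_bounds. simpl. rewrite <- (Rmult_1_r rho) at 3.
  apply Rmult_le_compat_l; [lra|]. rewrite <- (pow1 n). apply pow_incr. lra.
Qed.

Definition poch (N : nat) : C := Cprod (fun n => 1 - epow tau (INR n)) N.

Lemma one_minus_lower n : (1 - rho <= Cmod (1 - epow tau (INR (S n))))%R.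
Proof.
  pose proof (Cmod_triangle (1 - epow tau (INR (S n))) (epow tau (INR (S n)))) as h.
  replace (1 - epow tau (INR (S n)) + epow tau (INR (S n))) with (RtoC 1) in h by ring.
  rewrite Cmod_1, Cmod_epow_nat in h. pose proof (rho_pow_S_le n). lra.
Qed.

Lemma one_minus_neq_0 n : 1 - epow tau (INR (S n)) <> 0.
Proof.
  apply Cmod_gt_0. pose proof (one_minus_lower n). pose proof rho_bounds. lra.
Qed.

Lemma poch_neq_0 N : poch N <> 0.
Proof.
  induction N; simpl.
  - intros E. apply RtoC_inj in E. lra.
  - apply Cmult_neq_0; [exact IHN|apply one_minus_neq_0].
Qed.

(** The limit is nonzero because the reciprocal product converges too. *)
Lemma poch_lim : exists L : C, L <> 0 /\ Clim poch L.
Proof.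
  pose proof rho_bounds as Hr.
  destruct (Cprod_converges (fun n => - epow tau (INR n)) rho rho Hr) as [L HL].
  { intros n. rewrite Cmod_opp, Cmod_epow_nat. simpl. lra. }
  destruct (Cprod_converges (fun n => epow tau (INR n) / (1 - epow tau (INR n))) (rho / (1 - rho)) rho
    Hr) as [M HM].
  { intros n. rewrite Cmod_div by apply one_minus_neq_0. rewrite Cmod_epow_nat.
    pose proof (one_minus_lower n) as h.
    replace (rho / (1 - rho) * rho ^ n)%R with (rho ^ S n * / (1 - rho))%R by (simpl; field; lra).
    apply Rmult_le_compat_l; [apply pow_le; lra|]. apply Rinv_le_contravar; lra. }
  assert (HL' : Clim poch L).
  { apply Clim_ext with (2 := HL). intros n. now apply Cprod_ext. }
  exists L. split; [|exact HL'].
  assert (E : L * M = 1).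
  { apply (Clim_unique (fun n => poch n * Cprod (fun n => 1 + epow tau (INR n) / (1 - epow tau (INR n))) n)).
    - now apply Clim_mult.
    - apply Clim_ext with (fun _ => RtoC 1); [|apply Clim_const].
      induction n; [unfold poch; simpl; ring|]. unfold poch in *. cbn [Cprod].
      transitivity (Cprod (fun n => 1 - epow tau (INR n)) n *
         Cprod (fun n => 1 + epow tau (INR n) / (1 - epow tau (INR n))) n *
         ((1 - epow tau (INR (S n))) * (1 + epow tau (INR (S n)) / (1 - epow tau (INR (S n)))))).
      + rewrite <- IHn. field. apply one_minus_neq_0.
      + simpl. ring. }
  intros E0. rewrite E0, Cmult_0_l in E. apply RtoC_inj in E. lra.
Qed.

(** [1 / (q; q)_k], set to zero for negative [k]: with this convention the
    recursion below holds for all integers and no boundary terms appear. *)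
Definition inv_poch (k : Z) : C := if (k <? 0)%Z then 0 else / poch (Z.to_nat k).

Lemma inv_poch_pred k : inv_poch (k - 1) = (1 - epow tau (IZR k)) * inv_poch k.
Proof.
  unfold inv_poch.
  destruct (Z.ltb_spec k 0) as [H|H].
  - replace (k - 1 <? 0)%Z with true by (symmetry; apply Z.ltb_lt; lia). ring.
  - destruct (Z.eq_dec k 0) as [->|Hk].
    + simpl. unfold epow. replace (2 * PI * Ci * tau * 0) with (RtoC 0) by ring. rewrite Cexp_0. ring.
    + replace (k - 1 <? 0)%Z with false by (symmetry; apply Z.ltb_ge; lia).
      set (n := Z.to_nat (k - 1)). replace (Z.to_nat k) with (S n) by lia.
      replace (IZR k) with (INR (S n)) by (rewrite INR_IZR_INZ; f_equal; lia).
      unfold poch. cbn [Cprod]. change (Cprod (fun n => 1 - epow tau (INR n)) n) with (poch n).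
      field. split; [apply one_minus_neq_0|apply poch_neq_0].
Qed.

Variable w : C.

Definition jacobi_prod (N : nat) : C :=
  Cprod (fun n => (1 + Cexp w * epow tau (INR n - 1 / 2)) * (1 + Cexp (- w) * epow tau (INR n - 1 / 2))) N.

Let G (n : Z) : C := gauss (PI * Ci * tau) w 0 (IZR n).

(** The [q]-binomial coefficient [(2N choose N+n)]. *)
Let qbin (N : nat) (n : Z) : C :=
  poch (2 * N) * inv_poch (Z.of_nat N - n) * inv_poch (Z.of_nat N + n).

Lemma qbin_bounded : exists B, forall N n, (Cmod (qbin N n) <= B)%R.
Proof.
  destruct poch_lim as (L & HL0 & HL).
  destruct (Clim_bounded _ _ HL) as [B1 HB1].
  destruct (Clim_bounded _ _ (Clim_inv _ _ poch_neq_0 HL0 HL)) as [B2 HB2].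
  assert (H1 : (0 <= B1)%R) by (eapply Rle_trans; [apply Cmod_ge_0|apply (HB1 O)]).
  assert (H2 : (0 <= B2)%R) by (eapply Rle_trans; [apply Cmod_ge_0|apply (HB2 O)]).
  assert (Hr : forall k, (Cmod (inv_poch k) <= B2)%R).
  { intros k. unfold inv_poch. destruct (k <? 0)%Z; [now rewrite Cmod_0|apply HB2]. }
  exists (B1 * B2 * B2)%R. intros N n. unfold qbin. rewrite !Cmod_mult.
  repeat apply Rmult_le_compat; try apply Rmult_le_pos; try apply Cmod_ge_0; auto.
Qed.

Lemma qbin_G_bound : exists K r, (0 <= r < 1)%R /\
  forall N n, (Cmod (qbin N n * G n) <= K * r ^ Z.abs_nat n)%R.
Proof.
  destruct qbin_bounded as [B HB].
  destruct (geo_gauss (PI * Ci * tau) w 0 (Re_PI_Ci_neg tau Htau)) as (K & r & Hr & HK).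
  exists (B * K)%R, r. split; [exact Hr|]. intros N n.
  rewrite Cmod_mult, Rmult_assoc. apply Rmult_le_compat; try apply Cmod_ge_0; [apply HB|apply HK].
Qed.

Lemma qbin_G_geo N : geo (fun n => qbin N n * G n).
Proof. destruct qbin_G_bound as (K & r & Hr & H). exists K, r. split; [exact Hr|apply H]. Qed.

(** The finite triple product, a form of the [q]-binomial theorem. Stated as a sum over all
    integers, so that the factor [y + y^-1] of the next step acts by shifting [n]. *)
Lemma finite_triple_product N : Zlim (fun n => qbin N n * G n) (jacobi_prod N).
Proof.
  induction N.
  - (* only the term [n = 0] survives *)
    assert (E : forall n, (n <> 0)%Z -> qbin 0 n * G n = 0).
    { intros n Hn. unfold qbin, inv_poch.
      destruct (Z.ltb_spec (Z.of_nat 0 - n) 0); destruct (Z.ltb_spec (Z.of_nat 0 + n) 0); try ring. lia. }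
    apply Clim_ext with (fun M => if Nat.eqb M 0 then 0 else 1).
    + intros M. induction M; [reflexivity|].
      unfold zsum in *. cbn [csum]. rewrite <- IHM. unfold fold_Z. rewrite (E (- Z.of_nat M - 1)%Z) by lia.
      destruct M; simpl.
      * unfold qbin, inv_poch, poch, G, gauss; simpl.
        match goal with |- context [Cexp ?a] => replace a with (RtoC 0) by ring end.
        rewrite Cexp_0. field.
      * rewrite (E (Z.pos (Pos.of_succ_nat M))) by lia. ring.
    + change (jacobi_prod 0) with (RtoC 1). apply Clim_squeeze with (fun n => if Nat.eqb n 0 then 1 else 0)%R.
      * intros n. destruct n; cbn [Nat.eqb].
        -- replace (0 - 1) with (- (1)) by ring. rewrite Cmod_m1. lra.
        -- replace (1 - 1) with (RtoC 0) by ring. rewrite Cmod_0. lra.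
      * apply is_lim_seq_incr_1. simpl. apply is_lim_seq_const.
  - set (Q := epow tau (INR N + 1 / 2)).
    assert (EQ : jacobi_prod (S N) = (1 + Q * Q) * jacobi_prod N + Q * Cexp w * jacobi_prod N + Q * Cexp
      (- w) * jacobi_prod N).
    { unfold jacobi_prod. cbn [Cprod].
      replace (INR (S N) - 1 / 2) with (INR N + 1 / 2) by (rewrite S_INR, RtoC_plus; field).
      fold Q. change (Cprod _ N) with (jacobi_prod N).
      assert (Ew : Cexp w * Cexp (- w) = 1) by (rewrite <- Cexp_plus, <- Cexp_0; f_equal; ring).
      transitivity (jacobi_prod N * (1 + Q * Q * (Cexp w * Cexp (- w)) + Q * Cexp w + Q * Cexp (- w))); [ring|].
      rewrite Ew. ring. }
    rewrite EQ.
    pose proof (qbin_G_geo N) as Hg.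
    pose proof (Zlim_plus _ _ _ _ (Zlim_plus _ _ _ _ (Zlim_scal (1 + Q * Q) _ _ IHN)
        (Zlim_scal (Q * Cexp w) _ _ (Zlim_shift_back _ _ Hg IHN)))
        (Zlim_scal (Q * Cexp (- w)) _ _ (Zlim_shift _ _ Hg IHN))) as H.
    apply Zlim_ext with (2 := H). clear H EQ Hg IHN. intros n. cbv beta.
    set (X := epow tau (IZR (Z.of_nat N - n))). set (Y := epow tau (IZR (Z.of_nat N + n))).
    set (q := epow tau 1).
    (* shifting [n] turns the linear factors into powers of q *)
    assert (E1 : Q * Cexp w * G (n - 1)%Z = q * X * G n).
    { unfold Q, q, X, G, gauss, epow. rewrite <- !Cexp_plus. f_equal.
      rewrite !minus_IZR, <- INR_IZR_INZ, !RtoC_minus. field. }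
    assert (E2 : Q * Cexp (- w) * G (n + 1)%Z = q * Y * G n).
    { unfold Q, q, Y, G, gauss, epow. rewrite <- !Cexp_plus. f_equal.
      rewrite !plus_IZR, <- INR_IZR_INZ, !RtoC_plus. field. }
    assert (E3 : Q * Q = q * X * Y).
    { unfold Q, q, X, Y, epow. rewrite <- !Cexp_plus. f_equal.
      rewrite plus_IZR, minus_IZR, <- INR_IZR_INZ, RtoC_minus, RtoC_plus. field. }
    set (a := inv_poch (Z.of_nat N - n + 1)). set (b := inv_poch (Z.of_nat N + n + 1)).
    assert (R1 : inv_poch (Z.of_nat N - n) = (1 - q * X) * a).
    { replace (Z.of_nat N - n)%Z with (Z.of_nat N - n + 1 - 1)%Z by lia. rewrite inv_poch_pred.
      rewrite plus_IZR, RtoC_plus, epow_plus. fold X q. unfold a. ring. }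
    assert (R2 : inv_poch (Z.of_nat N + n) = (1 - q * Y) * b).
    { replace (Z.of_nat N + n)%Z with (Z.of_nat N + n + 1 - 1)%Z by lia. rewrite inv_poch_pred.
      rewrite plus_IZR, RtoC_plus, epow_plus. fold Y q. unfold b. ring. }
    assert (R3 : inv_poch (Z.of_nat N - n - 1) = (1 - X) * (1 - q * X) * a).
    { rewrite inv_poch_pred, R1. fold X. ring. }
    assert (R4 : inv_poch (Z.of_nat N + n - 1) = (1 - Y) * (1 - q * Y) * b).
    { rewrite inv_poch_pred, R2. fold Y. ring. }
    assert (R5 : poch (2 * S N) = poch (2 * N) * (1 - q * X * Y) * (1 - q * q * X * Y)).
    { replace (2 * S N)%nat with (S (S (2 * N))) by lia. unfold poch. cbn [Cprod].
      rewrite !S_INR, !RtoC_plus, !epow_plus. fold q.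
      replace (epow tau (INR (2 * N))) with (X * Y); [ring|].
      unfold X, Y. rewrite <- epow_plus, <- RtoC_plus, <- plus_IZR. f_equal. f_equal.
      rewrite INR_IZR_INZ. f_equal. lia. }
    transitivity ((1 + Q * Q) * (qbin N n * G n) + qbin N (n - 1) * (Q * Cexp w * G (n - 1)%Z)
       + qbin N (n + 1) * (Q * Cexp (- w) * G (n + 1)%Z)); [ring|].
    rewrite E1, E2, E3. unfold qbin.
    replace (Z.of_nat N - (n - 1))%Z with (Z.of_nat N - n + 1)%Z by lia.
    replace (Z.of_nat N + (n - 1))%Z with (Z.of_nat N + n - 1)%Z by lia.
    replace (Z.of_nat N - (n + 1))%Z with (Z.of_nat N - n - 1)%Z by lia.
    replace (Z.of_nat N + (n + 1))%Z with (Z.of_nat N + n + 1)%Z by lia.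
    replace (Z.of_nat (S N) - n)%Z with (Z.of_nat N - n + 1)%Z by lia.
    replace (Z.of_nat (S N) + n)%Z with (Z.of_nat N + n + 1)%Z by lia.
    rewrite R1, R2, R3, R4, R5. fold a b. ring.
Qed.

(** Jacobi's triple product. As [N] grows, [qbin N n] tends to [1 / L], where [L] is the
    infinite product of the [1 - q^n], and it is bounded, so Tannery's theorem applies. *)
Theorem triple_product :
  Clim (fun N => poch N * jacobi_prod N) (Cseries_Z G).
Proof.
  destruct poch_lim as (L & HL0 & HL).
  assert (HJ : Clim jacobi_prod (/ L * Cseries_Z G)).
  { destruct qbin_G_bound as (K & r & Hr & HK).
    apply (Tannery (fun N => fold_Z (fun n => qbin N n * G n)) (fold_Z (fun n => / L * G n)) _ _ (2 * K) r Hr).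
    - intros N k. unfold fold_Z. eapply Rle_trans; [apply Cmod_triangle|].
      pose proof (HK N (Z.of_nat k)) as h1. pose proof (HK N (- Z.of_nat k - 1)%Z) as h2.
      rewrite Zabs2Nat.id in h1. replace (Z.abs_nat (- Z.of_nat k - 1)) with (S k) in h2 by lia. simpl in h2.
      assert (0 <= r ^ k)%R by (apply pow_le; lra).
      assert (HK0 : (0 <= K)%R) by (apply (geo_pow_pos K r _ Hr (HK O))).
      assert (K * (r * r ^ k) <= K * r ^ k)%R by (apply Rmult_le_compat_l; [exact HK0|nra]). lra.
    - assert (Hq : forall n, Clim (fun N => qbin N n) (/ L)).
      { intros n. unfold qbin. replace (/ L) with (L * / L * / L) by (field; exact HL0).
        assert (Hi : Clim (fun N => inv_poch (Z.of_nat N)) (/ L)).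
        { apply Clim_ext with (fun N => / poch N).
          - intros N. unfold inv_poch. replace (Z.of_nat N <? 0)%Z with false by (symmetry;
            apply Z.ltb_ge; lia).
            now rewrite Nat2Z.id.
          - apply Clim_inv; [apply poch_neq_0|exact HL0|exact HL]. }
        apply Clim_mult; [apply Clim_mult|].
        - apply (Clim_subseq poch L (fun N => 2 * N)%nat); [intros; lia|exact HL].
        - apply Clim_ext with (fun N => inv_poch (Z.of_nat N + - n)); [intros; f_equal; lia|].
          apply (Clim_Zshift inv_poch); exact Hi.
        - apply (Clim_Zshift inv_poch); exact Hi. }
      intros k. unfold fold_Z. apply Clim_plus; (apply Clim_mult; [apply Hq|apply Clim_const]).
    - intros N. apply finite_triple_product.
    - apply Zlim_scal, geo_Zlim, geo_gauss, (Re_PI_Ci_neg tau Htau). }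
  replace (Cseries_Z G) with (L * (/ L * Cseries_Z G)) by (field; exact HL0).
  now apply Clim_mult.
Qed.

End QSeries.

(** * Modular transformation of the theta functions and of [eta^3] *)

Lemma Cseries_Z_ext u v : (forall n, u n = v n) -> Cseries_Z u = Cseries_Z v.
Proof. intros H. f_equal. now apply FunctionalExtensionality.functional_extensionality. Qed.

Lemma Cseries_Z_scal k v : geo v -> Cseries_Z (fun n => k * v n) = k * Cseries_Z v.
Proof.
  intros Hg. apply Zlim_Cseries; [|now apply Zlim_scal, geo_Zlim].
  destruct Hg as (K & rho & Hr & H). exists (Cmod k * K)%R, rho. split; [exact Hr|].
  intros n. rewrite Cmod_mult, Rmult_assoc. apply Rmult_le_compat_l; [apply Cmod_ge_0|apply H].
Qed.

Lemma Cseries_Z_reflect v : geo v -> Cseries_Z (fun n => v (- n)%Z) = Cseries_Z v.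
Proof.
  intros Hg. apply Zlim_Cseries; [|now apply Zlim_reflect, geo_Zlim].
  apply geo_ext with (fun n => v (-1 * n + 0)%Z); [intros; f_equal; lia|].
  apply geo_reindex; [lia|exact Hg].
Qed.

Lemma sign_pow (n : nat) : RtoC (-1) ^ n = Cexp (PI * Ci * INR n).
Proof.
  rewrite (Cmult_comm (PI * Ci)), Cexp_PI_nat. f_equal. apply Ceq; simpl; ring.
Qed.

Lemma sign_pow_inv (n : nat) : RtoC (-1) ^ n = Cexp (- (PI * Ci * INR n)).
Proof.
  rewrite sign_pow. apply (Cexp_eq_mod _ _ (Z.of_nat n)). rewrite <- INR_IZR_INZ. ring.
Qed.

Definition theta_linear (e e' : nat) (u tau : C) : C :=
  2 * PI * Ci * (u + INR e / 2 * tau) + PI * Ci * INR e'.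

(** The infinite product of [theta], in the form given by the triple product. *)
Lemma theta_product e e' u tau : (0 < Im tau)%R ->
  Clim (Cprod (fun n =>
    (1 - epow tau (INR n)) *
    (1 + (-1) ^ e' * epow u 1 * epow tau (INR n - (1 - INR e) / 2)) *
    (1 + (-1) ^ e' * epow u (-1) * epow tau (INR n - (1 + INR e) / 2))))
  (Cseries_Z (fun n => gauss (PI * Ci * tau) (theta_linear e e' u tau) 0 (IZR n))).
Proof.
  intros Ht. apply Clim_ext with (2 := triple_product tau Ht (theta_linear e e' u tau)).
  intros N. unfold poch, jacobi_prod. rewrite <- Cprod_mult. apply Cprod_ext. intros n.
  rewrite <- Cmult_assoc. f_equal. f_equal; f_equal.
  - rewrite sign_pow. unfold epow, theta_linear. rewrite <- !Cexp_plus. f_equal. field.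
  - rewrite sign_pow_inv. unfold epow, theta_linear. rewrite <- !Cexp_plus. f_equal. field.
Qed.

Lemma theta_series e e' u tau : (0 < Im tau)%R ->
  theta e e' u tau = epow u (INR e / 2) * epow tau (INR e / 8) *
    Cseries_Z (fun n => gauss (PI * Ci * tau) (theta_linear e e' u tau) 0 (IZR n)).
Proof.
  intros Ht. unfold theta. f_equal. apply Clim_seq_unique, theta_product, Ht.
Qed.

Lemma Im_pos_neq_0 (tau : C) : (0 < Im tau)%R -> tau <> 0.
Proof. intros H E. rewrite E in H. simpl in H. lra. Qed.

Lemma Im_inv_pos (tau : C) : (0 < Im tau)%R -> (0 < Im (- (1) / tau))%R.
Proof.
  destruct tau as [a b]; simpl. intros H.
  assert (Hp : (0 < a * (a * 1) + b * (b * 1))%R) by nra.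
  match goal with |- (0 < ?x)%R => replace x with (b / (a * (a * 1) + b * (b * 1)))%R by (field; lra) end.
  now apply Rdiv_lt_0_compat.
Qed.

Lemma PI_neq_0_C : RtoC PI <> 0.
Proof. intros E. apply RtoC_inj in E. exact (PI_neq0 E). Qed.

Lemma Ci_neq_0 : Ci <> 0.
Proof. intros E. apply (f_equal Im) in E. simpl in E. lra. Qed.

Lemma Ci2 : Ci ^ 2 = - (1).
Proof. apply Ceq; simpl; ring. Qed.

(** Lets [pi i] cancel as a formal variable in fractions with [pi^2] in the numerator. *)
Lemma PI2_Ci : RtoC (PI ^ 2)%R = - (PI * Ci) ^ 2.
Proof. rewrite RtoC_pow, Cpow_mult_l, Ci2. ring. Qed.

(** The principal branch of [(- i tau)^(-1/2)], again as a symbol. *)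
Definition gauss_tau (tau : C) : C := gauss_int (PI * Ci * tau).

(** Poisson summation applied to the series of [theta], after completing the square. The
    reflection [n -> - n] and the factor [e^(2 pi i e n) = 1] match the dual series
    with that of [theta e' e]. *)
Lemma theta_S e e' u tau : (e = 0 \/ e = 1)%nat -> (e' = 0 \/ e' = 1)%nat -> (0 < Im tau)%R ->
  theta e e' (u / tau) (- (1) / tau) =
  Cexp (- (PI * Ci * INR (e * e') / 2)) * gauss_tau (- (1) / tau) * Cexp (PI * Ci * u ^ 2 / tau) *
  theta e' e u tau.
Proof.
  intros He He' Ht.
  pose proof (Im_inv_pos tau Ht) as Ht'. pose proof (Im_pos_neq_0 tau Ht) as Ht0.
  rewrite (theta_series e e' _ _ Ht'), (theta_series e' e _ _ Ht).
  pose proof (Re_PI_Ci_neg _ Ht') as HA.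
  rewrite (poisson_gauss _ _ _ HA).
  set (A := PI * Ci * (- (1) / tau)) in *. set (B := theta_linear e e' (u / tau) (- (1) / tau)).
  assert (HPC : PI * Ci <> 0) by (apply Cmult_neq_0; [apply PI_neq_0_C|apply Ci_neq_0]).
  assert (HA0 : A <> 0) by (apply Re_neg_neq_0, HA).
  assert (EA : (PI ^ 2)%R / A = PI * Ci * tau).
  { rewrite PI2_Ci. unfold A. field. repeat split; first [exact Ht0|apply Ci_neq_0|apply PI_neq_0_C]. }
  assert (EB : PI * Ci * B / A = - tau * B).
  { unfold A. field. repeat split; first [exact Ht0|apply Ci_neq_0|apply PI_neq_0_C]. }
  rewrite EA, EB.
  set (v := fun n : Z => gauss (PI * Ci * tau) (theta_linear e' e u tau) 0 (IZR n)).
  assert (Hv : geo v) by (apply geo_gauss, Re_PI_Ci_neg, Ht).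
  rewrite <- (Cseries_Z_reflect v Hv).
  rewrite (Cseries_Z_ext _ (fun n => Cexp (0 - B ^ 2 / (4 * A)) * v (- n)%Z)).
  2:{ intros n. unfold v, gauss. rewrite <- Cexp_plus.
      apply (Cexp_eq_mod _ _ (Z.of_nat e * n)).
      unfold B, theta_linear. rewrite mult_IZR, opp_IZR, <- INR_IZR_INZ, RtoC_mult, RtoC_opp. field. 
      repeat split; first [exact Ht0|exact HA0]. }
  rewrite (Cseries_Z_scal _ (fun n => v (- n)%Z)).
  2:{ apply geo_ext with (fun n => v (-1 * n + 0)%Z); [intros; f_equal; lia|].
      apply geo_reindex; [lia|exact Hv]. }
  fold (gauss_tau (- (1) / tau)).
  change (gauss_int A) with (gauss_tau (- (1) / tau)).
  unfold epow.
  transitivity (Cexp (2 * PI * Ci * (u / tau) * (INR e / 2)) * Cexp (2 * PI * Ci * (- (1) / tau) * (INR e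
    / 8)) *
     Cexp (0 - B ^ 2 / (4 * A)) * (gauss_tau (- (1) / tau) * Cseries_Z (fun n => v (- n)%Z))); [ring|].
  transitivity (Cexp (- (PI * Ci * INR (e * e') / 2)) * Cexp (PI * Ci * u ^ 2 / tau) *
     Cexp (2 * PI * Ci * u * (INR e' / 2)) * Cexp (2 * PI * Ci * tau * (INR e' / 8)) *
      (gauss_tau (- (1) / tau) * Cseries_Z (fun n => v (- n)%Z))); [|ring].
  f_equal. rewrite <- !Cexp_plus. f_equal.
  assert (EBA : B ^ 2 / (4 * A) = - (PI * Ci * (2 * u - INR e + INR e' * tau) ^ 2 / (4 * tau))).
  { unfold B, A, theta_linear. field. repeat split; first [exact Ht0|apply Ci_neq_0|apply PI_neq_0_C]. }
  rewrite EBA.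
  assert (Hsq : forall k : nat, (k = 0 \/ k = 1)%nat -> RtoC (INR k) ^ 2 = INR k).
  { intros k [-> | ->]; simpl; ring. }
  rewrite mult_INR, RtoC_mult.
  transitivity (PI * Ci * (u / tau * INR e - INR e / (4 * tau) + u ^ 2 / tau + INR e ^ 2 / (4 * tau) +
    INR e' ^ 2 * tau / 4
     - u * INR e / tau + u * INR e' - INR e * INR e' / 2)); [field; exact Ht0|].
  rewrite (Hsq e He), (Hsq e' He'). field. exact Ht0.
Qed.

(** Since [prod (1 - q^(2n-1)) (1 + q^n) = 1], the product of the even theta constants
    is [2 eta^3], which reduces the modularity of [eta^3] to that of the theta functions.
    For finite products the identity reads [P_N (1 + q^N) = 2 (q)_N (q)_{2N}^2], where
    [P_N] is the product of the three partial products. *)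
Lemma theta_constants_eta tau : (0 < Im tau)%R ->
  theta 0 0 0 tau * theta 0 1 0 tau * theta 1 0 0 tau = 2 * eta tau ^ 3 /\ eta tau <> 0.
Proof.
  intros Ht. destruct (poch_lim tau Ht) as (L & HL0 & HL).
  assert (Eeta : eta tau = epow tau (1 / 24) * L).
  { unfold eta. f_equal. apply Clim_seq_unique, HL. }
  split.
  2:{ rewrite Eeta. apply Cmult_neq_0; [apply Cexp_neq_0|exact HL0]. }
  rewrite !theta_series, Eeta by exact Ht.
  set (p00 := Cseries_Z _). set (p01 := Cseries_Z _). set (p10 := Cseries_Z _).
  assert (E : p00 * p01 * p10 = 2 * L ^ 3).
  { pose proof (Clim_mult _ _ _ _ (Clim_mult _ _ _ _ (theta_product 0 0 0 tau Ht) (theta_product 0 1 0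
    tau Ht)) (theta_product 1 0 0 tau Ht)) as H.
    fold p00 p01 p10 in H.
    pose proof (poch_neq_0 tau Ht) as Hn.
    assert (Hq : Clim (fun N => 1 + epow tau (INR N)) (1 + 0)).
    { apply Clim_plus; [apply Clim_const|].
      apply Clim_squeeze with (fun n => exp (- (2 * PI * Im tau)) ^ n)%R.
      - intros n. replace (epow tau (INR n) - 0) with (epow tau (INR n)) by ring. rewrite Cmod_epow_nat. lra.
      - apply is_lim_seq_geom. pose proof (rho_bounds tau Ht). rewrite Rabs_pos_eq; lra. }
    pose proof (Clim_mult _ _ _ _ H Hq) as H1.
    replace (p00 * p01 * p10) with (p00 * p01 * p10 * (1 + 0)) by ring.
    apply (Clim_unique _ _ _ H1).
    apply Clim_ext with (fun N => 2 * (poch tau N * (poch tau (2 * N) * poch tau (2 * N)))).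
    2:{ replace (2 * L ^ 3) with (2 * (L * (L * L))) by ring. apply Clim_scal.
        assert (H2 : Clim (fun N => poch tau (2 * N)) L).
        { apply (Clim_subseq (poch tau) L (fun N => 2 * N)%nat); [intros; lia|exact HL]. }
        apply Clim_mult; [exact HL|]. now apply Clim_mult. }
    clear H H1 Hq. intros N. induction N as [|N IHN].
    - unfold poch; simpl. unfold epow. replace (2 * PI * Ci * tau * 0) with (RtoC 0) by ring.
      rewrite Cexp_0. ring.
    - rewrite <- !Cprod_mult in *. cbn [Cprod].
      match goal with |- _ = Cprod ?f N * ?x * ?y =>
        transitivity ((Cprod f N * (1 + epow tau (INR N))) * (1 - epow tau (INR (S N))) ^ 3 * (1 - epow
          tau (INR N + INR (S N))) ^ 2 * (1 + epow tau (INR (S N))) ^ 2) end.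
      + rewrite <- IHN. replace (2 * S N)%nat with (S (S (2 * N))) by lia. unfold poch. cbn [Cprod].
        replace (INR (S (2 * N))) with (INR N + INR (S N))%R by (rewrite !S_INR, mult_INR; simpl; ring).
        replace (INR (S (S (2 * N)))) with (INR (S N) + INR (S N))%R by (rewrite !S_INR, mult_INR; simpl; ring).
        rewrite (RtoC_plus (INR (S N)) (INR (S N))), RtoC_plus, (epow_plus tau (INR (S N)) (INR (S N))). ring.
      + assert (Ez : forall k, epow 0 k = 1).
        { intros k. unfold epow. replace (2 * PI * Ci * 0 * k) with (RtoC 0) by ring. apply Cexp_0. }
        rewrite !Ez.
        set (h := epow tau (INR N + 1 / 2)). set (q := epow tau (INR (S N))). set (q0 := epow tau (INR N)).
        replace (epow tau (INR (S N) - (1 - INR 0) / 2)) with h by (unfold h; f_equal;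
          rewrite S_INR, RtoC_plus; simpl; field).
        replace (epow tau (INR (S N) - (1 + INR 0) / 2)) with h by (unfold h; f_equal;
          rewrite S_INR, RtoC_plus; simpl; field).
        replace (epow tau (INR (S N) - (1 - INR 1) / 2)) with q by (unfold q; f_equal; simpl; field).
        replace (epow tau (INR (S N) - (1 + INR 1) / 2)) with q0 by (unfold q0; f_equal;
          rewrite S_INR, RtoC_plus; simpl; field).
        replace (epow tau (INR N + INR (S N))) with (h * h).
        2:{ unfold h. rewrite <- epow_plus. f_equal. rewrite S_INR, RtoC_plus. field. }
        simpl. replace (RtoC (-1)) with (- (1)) by (apply Ceq; simpl; ring). ring. }
  transitivity (epow tau (INR 1 / 8) * (p00 * p01 * p10)).
  - unfold epow. simpl.
    replace (2 * PI * Ci * tau * (0 / 8)) with (RtoC 0) by field.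
    replace (2 * PI * Ci * 0 * (0 / 2)) with (RtoC 0) by field.
    replace (2 * PI * Ci * 0 * (1 / 2)) with (RtoC 0) by field.
    rewrite Cexp_0. ring.
  - rewrite E. transitivity (2 * L ^ 3 * (epow tau (1 / 24) * epow tau (1 / 24) * epow tau (1 / 24))); [|ring].
    rewrite <- !epow_plus. rewrite Cmult_comm. f_equal. f_equal. simpl. field.
Qed.

Lemma eta_neq_0 tau : (0 < Im tau)%R -> eta tau <> 0.
Proof. intros H. apply (theta_constants_eta tau H). Qed.

Lemma theta_S_constant e e' tau : (e = 0 \/ e = 1)%nat -> (e' = 0 \/ e' = 1)%nat -> (e * e' = 0)%nat ->
  (0 < Im tau)%R ->
  theta e e' 0 (- (1) / tau) = gauss_tau (- (1) / tau) * theta e' e 0 tau.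
Proof.
  intros He He' H0 Ht. pose proof (Im_pos_neq_0 tau Ht) as Ht0.
  pose proof (theta_S e e' 0 tau He He' Ht) as H.
  replace (0 / tau) with (RtoC 0) in H by (field; exact Ht0). rewrite H, H0.
  replace (- (PI * Ci * INR 0 / 2)) with (RtoC 0) by (simpl; field).
  replace (PI * Ci * 0 ^ 2 / tau) with (RtoC 0) by (field; exact Ht0).
  rewrite Cexp_0. ring.
Qed.

Lemma eta3_S tau : (0 < Im tau)%R -> eta (- (1) / tau) ^ 3 = gauss_tau (- (1) / tau) ^ 3 * eta tau ^ 3.
Proof.
  intros Ht. destruct (theta_constants_eta tau Ht) as [E _].
  destruct (theta_constants_eta _ (Im_inv_pos tau Ht)) as [E' _].
  rewrite !theta_S_constant in E' by (auto; lia).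
  assert (H2 : RtoC 2 <> 0) by (intros h; apply RtoC_inj in h; lra).
  transitivity (/ 2 * (2 * eta (- (1) / tau) ^ 3)); [field; exact H2|].
  rewrite <- E'. transitivity (/ 2 * gauss_tau (- (1) / tau) ^ 3 * (theta 0 0 0 tau * theta 0 1 0 tau *
    theta 1 0 0 tau)); [ring|].
  rewrite E. field.
Qed.

(** Transforming a theta constant twice shows that the two Gaussian integrals are
    inverse to each other, with no choice of square root. *)
Lemma gauss_tau_inv tau : (0 < Im tau)%R -> gauss_tau tau * gauss_tau (- (1) / tau) = 1.
Proof.
  intros Ht. pose proof (Im_pos_neq_0 tau Ht) as Ht0.
  pose proof (theta_S_constant 0 0 _ (or_introl eq_refl) (or_introl eq_refl) eq_refl (Im_inv_pos tau Ht)) as H.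
  rewrite (theta_S_constant 0 0 tau) in H by auto.
  replace (- (1) / (- (1) / tau)) with tau in H.
  2:{ field. exact Ht0. }
  destruct (theta_constants_eta tau Ht) as [E He].
  assert (Hth : theta 0 0 0 tau <> 0).
  { intros h. rewrite h in E. replace (0 * theta 0 1 0 tau * theta 1 0 0 tau) with (RtoC 0) in E by ring.
    symmetry in E. revert E. apply Cmult_neq_0; [intros h'; apply RtoC_inj in h'; lra|now apply Cpow_nz]. }
  transitivity (gauss_tau tau * (gauss_tau (- (1) / tau) * theta 0 0 0 tau) / theta 0 0 0 tau); [field;
    exact Hth|].
  rewrite <- H. field. exact Hth.
Qed.

Lemma gauss_tau_scale tau (k : R) : (0 < Im tau)%R -> (0 < k)%R -> sqrt k * gauss_tau (k * tau) = gauss_tau tau.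
Proof.
  intros Ht Hk. unfold gauss_tau.
  rewrite <- (gauss_int_scale (PI * Ci * tau) (sqrt k)) by first [now apply Re_PI_Ci_neg |
    now apply sqrt_lt_R0].
  f_equal. f_equal. rewrite <- RtoC_pow.
  replace (sqrt k ^ 2)%R with k by (simpl; rewrite Rmult_1_r, sqrt_sqrt; lra). ring.
Qed.

(** * Finite sums and residue classes *)

Lemma Csum_list_ext {T} (l : list T) f g : (forall x, In x l -> f x = g x) -> Csum_list l f = Csum_list l g.
Proof.
  induction l; simpl; intros H; [reflexivity|].
  rewrite H by now left. rewrite IHl; auto.
Qed.

Lemma Csum_list_app {T} (l l' : list T) f : Csum_list (l ++ l') f = Csum_list l f + Csum_list l' f.
Proof. induction l; simpl; [ring|]. rewrite IHl. ring. Qed.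

Lemma Csum_list_map {T U} (h : T -> U) l f : Csum_list (map h l) f = Csum_list l (fun x => f (h x)).
Proof. induction l; simpl; [reflexivity|]. now rewrite IHl. Qed.

Lemma Csum_list_perm {T} (l l' : list T) f : Permutation l l' -> Csum_list l f = Csum_list l' f.
Proof.
  induction 1; simpl; [reflexivity| | |congruence].
  - now rewrite IHPermutation.
  - ring.
Qed.

Lemma Csum_list_plus {T} (l : list T) f g : Csum_list l (fun x => f x + g x) = Csum_list l f + Csum_list l g.
Proof. induction l; simpl; [ring|]. rewrite IHl. ring. Qed.

Lemma Csum_list_scal {T} c (l : list T) f : Csum_list l (fun x => c * f x) = c * Csum_list l f.
Proof. induction l; simpl; [ring|]. rewrite IHl. ring. Qed.

Lemma Csum_list_prod {T U} (l : list T) (l' : list U) f :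
  Csum_list (list_prod l l') f = Csum_list l (fun a => Csum_list l' (fun b => f (a, b))).
Proof.
  induction l; simpl; [reflexivity|].
  now rewrite Csum_list_app, Csum_list_map, IHl.
Qed.

Lemma Csum_list_filter {T} (P : T -> bool) l f :
  Csum_list l f = Csum_list (filter P l) f + Csum_list (filter (fun x => negb (P x)) l) f.
Proof.
  induction l; simpl; [ring|]. rewrite IHl. destruct (P a); simpl; ring.
Qed.

Definition Zrange (a n : nat) : list Z := map Z.of_nat (seq a n).

Lemma csum_Zrange (f : Z -> C) n : csum (fun k => f (Z.of_nat k)) n = Csum_list (Zrange 0 n) f.
Proof.
  induction n; [reflexivity|].
  unfold Zrange. rewrite seq_S, map_app, Csum_list_app. simpl. fold (Zrange 0 n).
  rewrite <- IHn. ring.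
Qed.

Lemma in_Zrange a n x : In x (Zrange a n) <-> (Z.of_nat a <= x < Z.of_nat (a + n))%Z.
Proof.
  unfold Zrange. rewrite in_map_iff. split.
  - intros [k [<- Hk]]. apply in_seq in Hk. lia.
  - intros Hx. exists (Z.to_nat x). split; [lia|]. apply in_seq. lia.
Qed.

Lemma NoDup_Zrange a n : NoDup (Zrange a n).
Proof. apply FinFun.Injective_map_NoDup; [intros x y; apply Nat2Z.inj|apply seq_NoDup]. Qed.

Lemma Zrange_0 (f : Z -> C) n : (0 < n)%nat -> f 0%Z = 0 -> Csum_list (Zrange 0 n) f = Csum_list (Zrange
  1 (n - 1)) f.
Proof.
  intros Hn H0. destruct n; [lia|]. unfold Zrange. simpl. rewrite H0, Nat.sub_0_r. ring.
Qed.

Lemma Zrange_reflect (f : Z -> C) n :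
  Csum_list (Zrange 1 (n - 1)) (fun x => f (Z.of_nat n - x)%Z) = Csum_list (Zrange 1 (n - 1)) f.
Proof.
  rewrite <- (Csum_list_map (fun x => (Z.of_nat n - x)%Z)). apply Csum_list_perm.
  apply NoDup_Permutation.
  - apply FinFun.Injective_map_NoDup; [intros x y; lia|apply NoDup_Zrange].
  - apply NoDup_Zrange.
  - intros x. rewrite in_map_iff. split.
    + intros [y [<- Hy]]. apply in_Zrange in Hy. apply in_Zrange. lia.
    + intros Hx. apply in_Zrange in Hx. exists (Z.of_nat n - x)%Z. split; [lia|]. apply in_Zrange. lia.
Qed.

Lemma periodic_mod (f : Z -> C) L : (forall x, f (x + L)%Z = f x) -> forall x, f (x mod L)%Z = f x.
Proof.
  intros Hf x.
  assert (G : forall n y, f (y + Z.of_nat n * L)%Z = f y).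
  { induction n; intros y; [f_equal; lia|].
    replace (y + Z.of_nat (S n) * L)%Z with (y + Z.of_nat n * L + L)%Z by lia. now rewrite Hf. }
  destruct (Z_le_gt_dec 0 (x / L)) as [H|H].
  - rewrite <- (G (Z.to_nat (x / L)) (x mod L)%Z). f_equal.
    rewrite Z2Nat.id by exact H. destruct (Z.eq_dec L 0) as [->|HL].
    + rewrite Zmod_0_r. lia.
    + pose proof (Z.div_mod x L HL). lia.
  - rewrite <- (G (Z.to_nat (- (x / L))) x). f_equal.
    rewrite Z2Nat.id by lia. destruct (Z.eq_dec L 0) as [->|HL].
    + rewrite Zmod_0_r. lia.
    + pose proof (Z.div_mod x L HL). lia.
Qed.

Lemma complete_residues_sum (f : Z -> C) (L : nat) (l : list Z) :
  (0 < L)%nat -> (forall x, f (x + Z.of_nat L)%Z = f x) ->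
  NoDup (map (fun x => x mod Z.of_nat L)%Z l) -> length l = L ->
  Csum_list l f = Csum_list (Zrange 0 L) f.
Proof.
  intros HL Hf Hnd Hlen.
  transitivity (Csum_list (map (fun x => x mod Z.of_nat L)%Z l) f).
  - rewrite Csum_list_map. apply Csum_list_ext. intros x _. symmetry. now apply periodic_mod.
  - apply Csum_list_perm, NoDup_Permutation_bis; [exact Hnd| |].
    + unfold Zrange. rewrite !length_map, length_seq. lia.
    + intros x Hx. apply in_map_iff in Hx. destruct Hx as [y [<- _]]. apply in_Zrange.
      pose proof (Z.mod_pos_bound y (Z.of_nat L)). lia.
Qed.

Lemma NoDup_map_In {T U} (h : T -> U) l :
  (forall x y, In x l -> In y l -> h x = h y -> x = y) -> NoDup l -> NoDup (map h l).
Proof.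
  intros Hh Hl. induction Hl as [|a l Ha Hl IH]; simpl; [constructor|]. constructor.
  - intros H. apply in_map_iff in H. destruct H as [b [E Hb]]. apply Ha.
    rewrite <- (Hh b a); [exact Hb|now right|now left|exact E].
  - apply IH. intros x y Hx Hy. apply Hh; now right.
Qed.

Lemma NoDup_list_prod {T U} (l : list T) (l' : list U) : NoDup l -> NoDup l' -> NoDup (list_prod l l').
Proof.
  intros Hl Hl'. induction Hl as [|a l Ha Hl IH]; simpl; [constructor|].
  apply NoDup_app.
  - apply FinFun.Injective_map_NoDup; [|exact Hl']. intros x y E. now inversion E.
  - exact IH.
  - intros [x y] H1 H2. apply in_map_iff in H1. destruct H1 as [z [E _]]. inversion E; subst.
    apply in_prod_iff in H2. tauto.
Qed.

Lemma mod_eq_divide (x y L : Z) : (L <> 0)%Z -> (x mod L = y mod L)%Z -> exists k, (x - y = k * L)%Z.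
Proof.
  intros HL H. exists (x / L - y / L)%Z.
  pose proof (Z.div_mod x L HL). pose proof (Z.div_mod y L HL). lia.
Qed.

(** * Folding the residues modulo [2 p p'] onto the Kac table *)

Section KacSum.

Variables p p' : Z.
Hypothesis Hp : (2 <= p)%Z.
Hypothesis Hp' : (2 <= p')%Z.
Hypothesis Hcop : Z.gcd p p' = 1%Z.

Lemma coprime_divide_l k m : (k * p = m * p')%Z -> exists j, (m = j * p)%Z.
Proof.
  intros E. assert (H : (p | p' * m)%Z) by (exists k; lia).
  apply Z.gauss in H; [|exact Hcop]. exact H.
Qed.

(** By the Chinese remainder theorem, [m p' + n p] with [0 <= m < p], [0 <= n < 2 p']
    runs through the residues modulo [2 p p']. *)
Lemma residues_rectangle (f : Z -> C) :
  (forall x, f (x + 2 * (p * p'))%Z = f x) ->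
  Csum_list (Zrange 0 (Z.to_nat (2 * (p * p')))) f =
  Csum_list (Zrange 0 (Z.to_nat p)) (fun m => Csum_list (Zrange 0 (2 * Z.to_nat p')) (fun n => f (m * p'
    + n * p)%Z)).
Proof.
  intros Hf.
  rewrite <- (Csum_list_prod _ _ (fun mn => f (fst mn * p' + snd mn * p)%Z)).
  rewrite <- (Csum_list_map (fun mn : Z * Z => fst mn * p' + snd mn * p)%Z).
  symmetry. apply complete_residues_sum.
  - nia.
  - intros x. rewrite Z2Nat.id by nia. apply Hf.
  - rewrite map_map. apply NoDup_map_In; [|apply NoDup_list_prod; apply NoDup_Zrange].
    intros [m n] [m1 n1] H H1 E. apply in_prod_iff in H. apply in_prod_iff in H1.
    rewrite !in_Zrange in H, H1. cbn [fst snd] in E. rewrite Z2Nat.id in E by nia.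
    apply mod_eq_divide in E; [|nia]. destruct E as [k E].
    assert (Hm : (0 <= m < p /\ 0 <= m1 < p)%Z) by lia.
    assert (Hn : (0 <= n < 2 * p' /\ 0 <= n1 < 2 * p')%Z) by lia. clear H H1.
    destruct (coprime_divide_l (2 * k * p' - (n - n1)) (m - m1)) as [j Hj]; [lia|].
    assert (Hj0 : (j = 0)%Z) by nia. assert (m = m1) by lia. subst m1.
    assert (E' : (n - n1 = k * (2 * p'))%Z) by nia.
    assert (Hk : (k = 0)%Z) by nia. f_equal. lia.
  - rewrite length_map, length_prod. unfold Zrange. rewrite !length_map, !length_seq. nia.
Qed.

(** The symmetry [(m, n) -> (p - m, p' - n)] exchanges the Kac table and its complement
    in the rectangle. *)
Lemma Kac_fold (h : Z * Z -> C) :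
  (forall m n, h (p - m, p' - n)%Z = h (m, n)) ->
  Csum_list (Zrange 1 (Z.to_nat p - 1)) (fun m => Csum_list (Zrange 1 (Z.to_nat p' - 1)) (fun n => h (m, n))) =
  2 * Csum_list (Kac_list p p') h.
Proof.
  intros Hh. rewrite <- Csum_list_prod.
  rewrite (Csum_list_filter (fun mn => (fst mn * p' + snd mn * p <=? p * p')%Z)).
  replace (Z.to_nat p - 1)%nat with (Z.to_nat (p - 1)) by lia.
  replace (Z.to_nat p' - 1)%nat with (Z.to_nat (p' - 1)) by lia.
  change (filter (fun mn : Z * Z => (fst mn * p' + snd mn * p <=? p * p')%Z)
     (list_prod (Zrange 1 (Z.to_nat (p - 1))) (Zrange 1 (Z.to_nat (p' - 1))))) with (Kac_list p p').
  set (l := filter (fun x => negb _) _).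
  assert (E : Csum_list l h = Csum_list (Kac_list p p') h); [|rewrite E; ring].
  transitivity (Csum_list (map (fun mn : Z * Z => (p - fst mn, p' - snd mn)%Z) l) h).
  - rewrite Csum_list_map. apply Csum_list_ext. intros [m n] _. symmetry. apply Hh.
  - assert (Hl : forall m n, In (m, n) l <-> (1 <= m <= p - 1 /\ 1 <= n <= p' - 1 /\ m * p' + n * p > p *
    p')%Z).
    { intros m n. unfold l. rewrite filter_In, in_prod_iff, !in_Zrange, Bool.negb_true_iff, Z.leb_gt.
      simpl. lia. }
    apply Csum_list_perm, NoDup_Permutation.
    + apply FinFun.Injective_map_NoDup.
      * intros [a b] [c d] H. simpl in H. inversion H. f_equal; lia.
      * apply NoDup_filter, NoDup_list_prod; apply NoDup_Zrange.
    + apply Kac_list_NoDup.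
    + intros [m n]. rewrite in_Kac_list, in_map_iff. unfold Kac. split.
      * intros [[a b] [E H]]. apply Hl in H. simpl in E. inversion E. nia.
      * intros (H1 & H2 & H3). exists (p - m, p' - n)%Z. split; [simpl; f_equal; lia|].
        apply Hl. split; [lia|]. split; [lia|].
        (* the diagonal [m p' + n p = p p'] is empty by coprimality *)
        assert (m * p' + n * p <> p * p')%Z; [|nia].
        intros E. destruct (coprime_divide_l (p' - n) m) as [j Hj]; [lia|]. assert (j < 1)%Z by nia.
          assert (0 < j)%Z by nia. lia.
Qed.

(** In the rectangle of [residues_rectangle] the lines [m = 0], [n = 0] and [n = p'] do not
    contribute. Reflecting the half [n > p'] by [n -> 2 p' - n] gives the terms
    [m p' - n p], and [Kac_fold] supplies the factor 2; so each Kac entry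
    stands for four residues. *)
Lemma residues_Kac (f : Z -> C) :
  (forall x, f (x + 2 * (p * p'))%Z = f x) -> (forall x, f (- x)%Z = f x) ->
  (forall k, f (k * p)%Z = 0) -> (forall k, f (k * p')%Z = 0) ->
  Csum_list (Zrange 0 (Z.to_nat (2 * (p * p')))) f =
  2 * Csum_list (Kac_list p p') (fun mn => f (fst mn * p' - snd mn * p)%Z + f (fst mn * p' + snd mn * p)%Z).
Proof.
  intros Hper Heven H0 H0'.
  rewrite (residues_rectangle f Hper).
  rewrite Zrange_0; [|lia|].
  2:{ rewrite (Csum_list_ext _ _ (fun _ => 0 * 0)); [rewrite Csum_list_scal; ring|].
      intros n _. rewrite Z.mul_0_l, Z.add_0_l, H0. ring. }
  rewrite <- Kac_fold.
  2:{ intros m n. simpl. f_equal.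
      - rewrite <- Heven. f_equal. ring.
      - rewrite <- Heven, <- Hper. f_equal. ring. }
  apply Csum_list_ext. intros m _. simpl. rewrite Csum_list_plus.
  replace (Z.to_nat p' + (Z.to_nat p' + 0))%nat with (Z.to_nat p' + Z.to_nat p')%nat by lia.
  unfold Zrange at 1. rewrite seq_app, map_app, Csum_list_app. fold (Zrange 0 (Z.to_nat p')).
  rewrite Zrange_0; [|lia|].
  2:{ rewrite Z.mul_0_l, Z.add_0_r. apply H0'. }
  rewrite Cplus_comm. f_equal.
  transitivity (Csum_list (Zrange 0 (Z.to_nat p')) (fun n => f (m * p' + (p' + n) * p)%Z)).
  { rewrite Nat.add_0_l. unfold Zrange.
    replace (seq (Z.to_nat p') (Z.to_nat p')) with (map (fun k => Z.to_nat p' + k)%nat (seq 0 (Z.to_nat p'))).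
    - rewrite map_map, !Csum_list_map. apply Csum_list_ext. intros k _. f_equal. lia.
    - generalize (Z.to_nat p') at 1 3 as a. intros a. generalize (Z.to_nat p') as n.
      intros n. revert a. assert (G : forall b a, map (fun k => a + k)%nat (seq b n) = seq (a + b) n).
      { induction n; intros b a; simpl; [reflexivity|]. rewrite IHn. now rewrite Nat.add_succ_r. }
      intros a. rewrite G. now rewrite Nat.add_0_r. }
  rewrite Zrange_0; [|lia|].
  2:{ replace (m * p' + (p' + 0) * p)%Z with ((m + p) * p')%Z by ring. apply H0'. }
  rewrite <- Zrange_reflect. apply Csum_list_ext. intros n _.
  rewrite <- Hper. rewrite <- (Hper (m * p' - n * p)%Z). rewrite Z2Nat.id by lia.
  rewrite Hper. f_equal. ring.
Qed.

End KacSum.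

(** * Modular transformation of the minimal-model characters *)

(** A term of the theta series [K_lambda] of level [N]; the numerator of [chi] is a
    difference of two such series. *)
Definition level_term (N lam : Z) (tau : C) (n : Z) : C :=
  epow tau (RtoC (IZR N * (IZR n + IZR lam / IZR (2 * N)) ^ 2)%R).

Definition level_theta (N lam : Z) (tau : C) : C := Cseries_Z (level_term N lam tau).

Lemma IZR_C_neq_0 (n : Z) : (n <> 0)%Z -> RtoC (IZR n) <> 0.
Proof. intros H E. apply RtoC_inj in E. now apply eq_IZR in E. Qed.

Lemma level_exponent (N lam n : Z) : (0 < N)%Z ->
  RtoC (IZR N * (IZR n + IZR lam / IZR (2 * N)) ^ 2)%R = IZR N * (IZR n + IZR lam / (2 * IZR N)) ^ 2.
Proof.
  intros HN. assert (HN' : IZR N <> 0%R) by (apply eq_IZR_contrapositive; lia).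
  rewrite RtoC_mult, RtoC_pow, RtoC_plus, mult_IZR, RtoC_div, RtoC_mult by lra. reflexivity.
Qed.

Lemma level_term_gauss N lam tau n : (0 < N)%Z ->
  level_term N lam tau n =
  gauss (PI * Ci * (IZR (2 * N) * tau)) (2 * PI * Ci * tau * IZR lam) (2 * PI * Ci * tau * IZR lam ^ 2 /
    (4 * IZR N)) (IZR n).
Proof.
  intros HN. unfold level_term, epow, gauss. rewrite level_exponent by exact HN.
  f_equal. rewrite mult_IZR, RtoC_mult. field. apply IZR_C_neq_0. lia.
Qed.

Lemma Im_scale_pos (k : R) (tau : C) : (0 < k)%R -> (0 < Im tau)%R -> (0 < Im (k * tau))%R.
Proof. destruct tau as [a b]; simpl. intros. nra. Qed.

Lemma geo_level_term N lam tau : (0 < N)%Z -> (0 < Im tau)%R -> geo (level_term N lam tau).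
Proof.
  intros HN Ht. eapply geo_ext; [intros n; symmetry; now apply level_term_gauss|].
  apply geo_gauss, Re_PI_Ci_neg, Im_scale_pos; [apply IZR_lt; lia|exact Ht].
Qed.

Lemma level_theta_opp N lam tau : (0 < N)%Z -> (0 < Im tau)%R ->
  level_theta N (- lam) tau = level_theta N lam tau.
Proof.
  intros HN Ht. unfold level_theta.
  rewrite <- (Cseries_Z_reflect (level_term N lam tau)) by now apply geo_level_term.
  apply Cseries_Z_ext. intros n. unfold level_term. rewrite !level_exponent by exact HN.
  f_equal. rewrite !opp_IZR, !RtoC_opp. field. apply IZR_C_neq_0. lia.
Qed.

Lemma level_theta_period N lam tau : (0 < N)%Z -> (0 < Im tau)%R ->
  level_theta N (lam + 2 * N) tau = level_theta N lam tau.
Proof.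
  intros HN Ht. unfold level_theta. apply Zlim_Cseries; [now apply geo_level_term|].
  pose proof (geo_level_term N lam tau HN Ht) as Hg.
  apply Zlim_ext with (2 := Zlim_shift _ _ Hg (geo_Zlim _ Hg)).
  intros n. unfold level_term. rewrite !level_exponent by exact HN.
  f_equal. rewrite !plus_IZR, mult_IZR, !RtoC_plus, RtoC_mult. field. apply IZR_C_neq_0. lia.
Qed.

(** Poisson summation, followed by sorting the dual sum into residues modulo [2N]. *)
Lemma level_theta_S N lam tau : (0 < N)%Z -> (0 < Im tau)%R ->
  level_theta N lam (- (1) / tau) =
  gauss_tau (- (1) / tau) / sqrt (IZR (2 * N)) *
  Csum_list (Zrange 0 (Z.to_nat (2 * N))) (fun mu => Cexp (PI * Ci * IZR lam * IZR mu / IZR N) *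
    level_theta N mu tau).
Proof.
  intros HN Ht.
  pose proof (Im_inv_pos tau Ht) as Ht'. pose proof (Im_pos_neq_0 tau Ht) as Ht0.
  assert (HNC : RtoC (IZR N) <> 0) by (apply IZR_C_neq_0; lia).
  assert (H2N : (0 < IZR (2 * N))%R) by (apply IZR_lt; lia).
  unfold level_theta at 1.
  rewrite (Cseries_Z_ext _ _ (fun n => level_term_gauss N lam (- (1) / tau) n HN)).
  pose proof (Re_PI_Ci_neg _ (Im_scale_pos _ _ H2N Ht')) as HA.
  rewrite (poisson_gauss _ _ _ HA).
  set (A := PI * Ci * (IZR (2 * N) * (- (1) / tau))) in *.
  assert (Es : gauss_int A = gauss_tau (- (1) / tau) / sqrt (IZR (2 * N))).
  { change (gauss_int A) with (gauss_tau (IZR (2 * N) * (- (1) / tau))).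
    rewrite <- (gauss_tau_scale _ _ Ht' H2N). field.
    intros E. apply RtoC_inj in E. pose proof (sqrt_lt_R0 _ H2N). lra. }
  rewrite Es. f_equal.
  set (v := fun k : Z => Cexp (PI * Ci * tau * IZR k ^ 2 / (2 * IZR N) + PI * Ci * IZR lam * IZR k / IZR N)).
  rewrite (Cseries_Z_ext _ v).
  2:{ intros k. unfold v, gauss. f_equal. rewrite PI2_Ci. unfold A. rewrite mult_IZR, RtoC_mult. field.
      repeat split; first [exact HNC|exact Ht0|apply Ci_neq_0|apply PI_neq_0_C]. }
  assert (Hv : geo v).
  { apply geo_ext with (fun k => gauss (PI * Ci * ((/ IZR (2 * N))%R * tau)) (PI * Ci * IZR lam / IZR N)
    0 (IZR k)).
    - intros k. unfold v, gauss. f_equal. rewrite RtoC_inv, mult_IZR, RtoC_mult by lra. field. exact HNC.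
    - apply geo_gauss, Re_PI_Ci_neg, Im_scale_pos; [now apply Rinv_0_lt_compat|exact Ht]. }
  rewrite <- csum_Zrange.
  apply (Zlim_residues v); [lia|now apply geo_Zlim|].
  intros mu Hmu. rewrite Z2Nat.id by lia.
  apply Zlim_ext with (fun n => Cexp (PI * Ci * IZR lam * IZR (Z.of_nat mu) / IZR N) * level_term N
    (Z.of_nat mu) tau n).
  - intros n. unfold v, level_term, epow. rewrite level_exponent by exact HN.
    rewrite <- Cexp_plus. symmetry. apply (Cexp_eq_mod _ _ (lam * n)).
    rewrite plus_IZR, !mult_IZR, RtoC_plus, !RtoC_mult. field. exact HNC.
  - apply Zlim_scal, geo_Zlim. now apply geo_level_term.
Qed.

Lemma geo_plus u v : geo u -> geo v -> geo (fun n => u n + v n).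
Proof.
  intros (K1 & r1 & Hr1 & H1) (K2 & r2 & Hr2 & H2).
  pose proof (geo_pow_pos _ _ _ Hr1 H1) as P1. pose proof (geo_pow_pos _ _ _ Hr2 H2) as P2.
  exists (K1 + K2)%R, (Rmax r1 r2). split.
  - split; [eapply Rle_trans; [apply Hr1|apply Rmax_l]|apply Rmax_lub_lt; lra].
  - intros n. eapply Rle_trans; [apply Cmod_triangle|]. rewrite Rmult_plus_distr_r.
    apply Rplus_le_compat.
    + eapply Rle_trans; [apply H1|]. apply Rmult_le_compat_l; [exact P1|].
      apply pow_incr. split; [lra|apply Rmax_l].
    + eapply Rle_trans; [apply H2|]. apply Rmult_le_compat_l; [exact P2|].
      apply pow_incr. split; [lra|apply Rmax_r].
Qed.

Lemma Cseries_Z_minus u v : geo u -> geo v ->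
  Cseries_Z (fun n => u n - v n) = Cseries_Z u - Cseries_Z v.
Proof.
  intros Hu Hv.
  assert (Hv' : geo (fun n => - (1) * v n)).
  { destruct Hv as (K & rho & Hr & H). exists K, rho. split; [exact Hr|]. intros n.
    rewrite Cmod_mult, Cmod_m1, Rmult_1_l. apply H. }
  rewrite (Cseries_Z_ext _ (fun n => u n + - (1) * v n)) by (intros; ring).
  replace (Cseries_Z u - Cseries_Z v) with (Cseries_Z u + - (1) * Cseries_Z v) by ring.
  apply Zlim_Cseries; [now apply geo_plus|].
  apply Zlim_plus; [now apply geo_Zlim|now apply Zlim_scal, geo_Zlim].
Qed.

(** [eta] times [chi]. *)
Definition chi_num (p p' r s : Z) (tau : C) : C :=
  level_theta (p * p') (r * p' - s * p) tau - level_theta (p * p') (- r * p' - s * p) tau.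

Lemma chi_eq p p' r s tau : (2 <= p)%Z -> (2 <= p')%Z -> (0 < Im tau)%R ->
  chi p p' r s tau = / eta tau * chi_num p p' r s tau.
Proof.
  intros Hp Hp' Ht. unfold chi, chi_num. f_equal.
  assert (HN : (0 < p * p')%Z) by nia.
  pose proof (geo_level_term (p * p') (r * p' - s * p) tau HN Ht) as H1.
  pose proof (geo_level_term (p * p') (- r * p' - s * p) tau HN Ht) as H2.
  replace (2 * p * p')%Z with (2 * (p * p'))%Z by ring. now apply Cseries_Z_minus.
Qed.

Lemma sin_plus_PI_Z (x : R) (k : Z) : sin (x + PI * IZR k) = (powerRZ (-1) k * sin x)%R.
Proof.
  assert (G : forall n y, sin (y + PI * INR n) = ((-1) ^ n * sin y)%R).
  { induction n; intros y; [simpl; rewrite Rmult_0_r, Rplus_0_r; ring|].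
    rewrite S_INR. replace (y + PI * (INR n + 1))%R with (y + PI * INR n + PI)%R by ring.
    rewrite neg_sin, IHn. simpl. ring. }
  destruct (Z_le_gt_dec 0 k) as [Hk|Hk].
  - replace k with (Z.of_nat (Z.to_nat k)) by lia.
    rewrite <- INR_IZR_INZ, <- pow_powerRZ. apply G.
  - replace k with (- Z.of_nat (Z.to_nat (- k)))%Z by lia. set (n := Z.to_nat (- k)).
    rewrite powerRZ_neg', <- pow_powerRZ, opp_IZR, <- INR_IZR_INZ.
    pose proof (G n (x + PI * - INR n)%R) as h.
    replace (x + PI * - INR n + PI * INR n)%R with x in h by ring. rewrite h.
    rewrite <- Rmult_assoc, Rinv_l; [ring|]. apply pow_nonzero. lra.
Qed.

(** The products of sines arising at the residues [r' p' - s' p] and [r' p' + s' p] are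
    the S-matrix entry with opposite signs, as required by the difference in [chi_num]. *)
Lemma S_Vir_sines p p' r s r' s' : (2 <= p)%Z -> (2 <= p')%Z ->
  (sqrt (8 / IZR (p * p')) *
    (sin (PI * IZR r * IZR (r' * p' - s' * p) / IZR p) * sin (PI * IZR s * IZR (r' * p' - s' * p) / IZR p')))%R
   = S_Vir p p' (r, s) (r', s') /\
  (sqrt (8 / IZR (p * p')) *
    (sin (PI * IZR r * IZR (r' * p' + s' * p) / IZR p) * sin (PI * IZR s * IZR (r' * p' + s' * p) / IZR p')))%R
   = (- S_Vir p p' (r, s) (r', s'))%R.
Proof.
  intros Hp Hp'.
  assert (Pp : IZR p <> 0%R) by (apply eq_IZR_contrapositive; lia).
  assert (Pp' : IZR p' <> 0%R) by (apply eq_IZR_contrapositive; lia).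
  set (a := (PI * IZR r * IZR r' * IZR p' / IZR p)%R).
  set (b := (PI * IZR s * IZR s' * IZR p / IZR p')%R).
  assert (M1 : (-1 <> 0)%R) by lra.
  assert (Sq : forall k, (powerRZ (-1) k * powerRZ (-1) k = 1)%R).
  { intros k. rewrite <- powerRZ_mult. replace (-1 * -1)%R with 1%R by ring. apply powerRZ_R1. }
  assert (E : S_Vir p p' (r, s) (r', s') =
    (sqrt (8 / IZR (p * p')) * - (powerRZ (-1) (r * s') * powerRZ (-1) (s * r') * (sin a * sin b)))%R).
  { unfold S_Vir. rewrite !Rmult_assoc. f_equal.
    replace ((r + s) * (r' + s'))%Z with (r * r' + (r * s' + (s * r' + s * s')))%Z by ring.
    rewrite !powerRZ_add by exact M1.
    replace (PI * (IZR (p - p') * IZR (r * r')) / IZR p)%R with (- a + PI * IZR (r * r'))%R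
      by (unfold a; rewrite minus_IZR, !mult_IZR; field; exact Pp).
    replace (PI * (IZR (p - p') * IZR (s * s')) / IZR p')%R with (b + PI * IZR (- (s * s')))%R
      by (unfold b; rewrite opp_IZR, minus_IZR, !mult_IZR; field; exact Pp').
    rewrite !sin_plus_PI_Z, sin_neg.
    assert (En : powerRZ (-1) (- (s * s')) = powerRZ (-1) (s * s')).
    { rewrite powerRZ_neg', <- (Rmult_1_r (/ _)), <- (Sq (s * s')%Z), <- Rmult_assoc, Rinv_l; [ring|].
      apply powerRZ_NOR. exact M1. }
    rewrite En.
    transitivity (- ((powerRZ (-1) (r * r') * powerRZ (-1) (r * r')) * (powerRZ (-1) (s * s') * powerRZ
      (-1) (s * s')) *
      (powerRZ (-1) (r * s') * powerRZ (-1) (s * r') * (sin a * sin b))))%R; [ring|].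
    rewrite !Sq. ring. }
  assert (En : powerRZ (-1) (- (r * s')) = powerRZ (-1) (r * s')).
  { rewrite powerRZ_neg', <- (Rmult_1_r (/ _)), <- (Sq (r * s')%Z), <- Rmult_assoc, Rinv_l; [ring|].
    apply powerRZ_NOR. exact M1. }
  rewrite E. split.
  - f_equal.
    replace (PI * IZR r * IZR (r' * p' - s' * p) / IZR p)%R with (a + PI * IZR (- (r * s')))%R
      by (unfold a; rewrite opp_IZR, minus_IZR, !mult_IZR; field; exact Pp).
    replace (PI * IZR s * IZR (r' * p' - s' * p) / IZR p')%R with (- b + PI * IZR (s * r'))%R
      by (unfold b; rewrite minus_IZR, !mult_IZR; field; exact Pp').
    rewrite !sin_plus_PI_Z, sin_neg, En. ring.
  - replace (PI * IZR r * IZR (r' * p' + s' * p) / IZR p)%R with (a + PI * IZR (r * s'))%R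
      by (unfold a; rewrite plus_IZR, !mult_IZR; field; exact Pp).
    replace (PI * IZR s * IZR (r' * p' + s' * p) / IZR p')%R with (b + PI * IZR (s * r'))%R
      by (unfold b; rewrite plus_IZR, !mult_IZR; field; exact Pp').
    rewrite !sin_plus_PI_Z. ring.
Qed.

Lemma cos_diff_exp (a b : R) :
  Cexp (Ci * (a - b)) + Cexp (- (Ci * (a - b))) - (Cexp (Ci * (- a - b)) + Cexp (- (Ci * (- a - b)))) = 4
    * (sin a * sin b)%R.
Proof.
  rewrite <- RtoC_opp, <- !RtoC_minus, !Cexp_cos.
  replace (- a - b)%R with (- (a + b))%R by ring.
  rewrite cos_neg, cos_minus, cos_plus, RtoC_minus, RtoC_plus, !RtoC_mult. ring.
Qed.

(** Summed over a full residue system, the exponentials can be symmetrized under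
    [mu -> - mu]; this gives the even function [4 sin (pi r mu / p) sin (pi s mu / p') K_mu],
    which vanishes on multiples of [p] and of [p'] and so folds onto the Kac table. *)
Lemma chi_num_S p p' r s tau :
  (2 <= p)%Z -> (2 <= p')%Z -> Z.gcd p p' = 1%Z -> (0 < Im tau)%R ->
  chi_num p p' r s (- (1) / tau) =
  gauss_tau (- (1) / tau) * Csum_list (Kac_list p p') (fun rs' => S_Vir p p' (r, s) rs' * chi_num p p'
    (fst rs') (snd rs') tau).
Proof.
  intros Hp Hp' Hc Ht. set (N := (p * p')%Z). assert (HN : (0 < N)%Z) by (unfold N; nia).
  assert (HpC : RtoC (IZR p) <> 0) by (apply IZR_C_neq_0; lia).
  assert (HpC' : RtoC (IZR p') <> 0) by (apply IZR_C_neq_0; lia).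
  assert (HNC : RtoC (IZR N) <> 0) by (apply IZR_C_neq_0; lia).
  assert (EN : RtoC (IZR N) = IZR p * IZR p') by (unfold N; now rewrite mult_IZR, RtoC_mult).
  set (E := fun lam mu : Z => Cexp (PI * Ci * IZR lam * IZR mu / IZR N)).
  set (l1 := (r * p' - s * p)%Z). set (l2 := (- r * p' - s * p)%Z).
  set (F := fun mu : Z => (E l1 mu - E l2 mu) * level_theta N mu tau).
  set (K := gauss_tau (- (1) / tau) / sqrt (IZR (2 * N))).
  assert (H1 : chi_num p p' r s (- (1) / tau) = K * Csum_list (Zrange 0 (Z.to_nat (2 * N))) F).
  { unfold chi_num. fold N l1 l2. rewrite !level_theta_S by assumption. fold K.
    transitivity (K * (Csum_list (Zrange 0 (Z.to_nat (2 * N))) (fun mu => E l1 mu * level_theta N mu tau)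
      + - (1) * Csum_list (Zrange 0 (Z.to_nat (2 * N))) (fun mu => E l2 mu * level_theta N mu tau))).
    { unfold E. ring. }
    rewrite <- Csum_list_scal, <- Csum_list_plus. f_equal. apply Csum_list_ext.
    intros mu _. unfold F. ring. }
  assert (EP : forall lam mu, E lam (mu + 2 * N)%Z = E lam mu).
  { intros lam mu. unfold E. apply (Cexp_eq_mod _ _ lam).
    rewrite plus_IZR, mult_IZR, RtoC_plus, RtoC_mult. field. exact HNC. }
  assert (FP : forall mu, F (mu + 2 * N)%Z = F mu).
  { intros mu. unfold F. now rewrite !EP, level_theta_period. }
  (* symmetrizing in mu turns the exponentials into products of sines *)
  set (G := fun mu : Z => F mu + F (- mu)%Z).
  assert (HG : forall mu, G mu = 4 * (sin (PI * IZR r * IZR mu / IZR p) * sin (PI * IZR s * IZR mu / IZR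
    p'))%R * level_theta N mu tau).
  { intros mu. unfold G, F. rewrite level_theta_opp by assumption.
    rewrite <- cos_diff_exp.
    assert (X1 : RtoC (PI * IZR r * IZR mu / IZR p)%R = PI * IZR r * IZR mu / IZR p).
    { rewrite RtoC_div, !RtoC_mult; [reflexivity|]. apply eq_IZR_contrapositive. lia. }
    assert (X2 : RtoC (PI * IZR s * IZR mu / IZR p')%R = PI * IZR s * IZR mu / IZR p').
    { rewrite RtoC_div, !RtoC_mult; [reflexivity|]. apply eq_IZR_contrapositive. lia. }
    rewrite X1, X2.
    transitivity ((E l1 mu + E l1 (- mu)%Z - (E l2 mu + E l2 (- mu)%Z)) * level_theta N mu tau); [ring|].
    f_equal.
    assert (Y1 : IZR l1 = IZR r * IZR p' - IZR s * IZR p :> C).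
    { unfold l1. now rewrite minus_IZR, !mult_IZR, RtoC_minus, !RtoC_mult. }
    assert (Y2 : IZR l2 = - (IZR r * IZR p') - IZR s * IZR p :> C).
    { unfold l2. rewrite minus_IZR, !mult_IZR, opp_IZR, RtoC_minus, !RtoC_mult, RtoC_opp. ring. }
    unfold E. rewrite Y1, Y2, EN, opp_IZR, RtoC_opp.
    set (a := PI * IZR r * IZR mu / IZR p). set (b := PI * IZR s * IZR mu / IZR p').
    assert (HE : forall x y x' y' : C, x = x' -> y = y' -> Cexp x + Cexp y = Cexp x' + Cexp y') by
      (intros; now subst).
    f_equal; apply HE; unfold a, b; field; split; assumption. }
  assert (H2 : Csum_list (Zrange 0 (Z.to_nat (2 * N))) F = / 2 * Csum_list (Zrange 0 (Z.to_nat (2 * N))) G).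
  { unfold G. rewrite Csum_list_plus.
    assert (Hneg : Csum_list (Zrange 0 (Z.to_nat (2 * N))) (fun mu => F (- mu)%Z) = Csum_list (Zrange 0
      (Z.to_nat (2 * N))) F).
    { rewrite <- (Csum_list_map Z.opp). apply complete_residues_sum.
      - lia.
      - intros x. rewrite Z2Nat.id by lia. apply FP.
      - rewrite map_map. apply NoDup_map_In; [|apply NoDup_Zrange].
        intros x y Hx Hy Exy. apply in_Zrange in Hx. apply in_Zrange in Hy.
        apply mod_eq_divide in Exy; [|lia]. destruct Exy as [k Ek]. rewrite Z2Nat.id in Ek by lia.
        assert (k = 0)%Z by nia. nia.
      - unfold Zrange. rewrite !length_map, length_seq. reflexivity. }
    rewrite Hneg. field. }
  rewrite H1, H2.
  unfold N at 1. rewrite (residues_Kac p p' Hp Hp' Hc G).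
  - transitivity (gauss_tau (- (1) / tau) * (/ sqrt (IZR (2 * N)) * Csum_list (Kac_list p p') (fun mn =>
    G (fst mn * p' - snd mn * p)%Z + G (fst mn * p' + snd mn * p)%Z))).
    { unfold K. field. intros e. apply RtoC_inj in e.
      assert (h : (0 < IZR (2 * N))%R) by (apply IZR_lt; lia). pose proof (sqrt_lt_R0 _ h). lra. }
    f_equal. rewrite <- Csum_list_scal. apply Csum_list_ext. intros [r' s'] _. cbn [fst snd].
    rewrite !HG. destruct (S_Vir_sines p p' r s r' s' Hp Hp') as [S1 S2].
    assert (Esq : RtoC (sqrt (8 / IZR (p * p'))) = 4 / sqrt (IZR (2 * N))).
    { assert (h : (0 < IZR N)%R) by (apply IZR_lt; lia).
      assert (h2 : (0 < IZR (2 * N))%R) by (apply IZR_lt; lia).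
      rewrite <- RtoC_div by (pose proof (sqrt_lt_R0 _ h2); lra). f_equal. fold N.
      replace (8 / IZR N)%R with (4 ^ 2 / IZR (2 * N))%R by (rewrite mult_IZR; field; lra).
      rewrite sqrt_div by lra. rewrite sqrt_pow2 by lra. reflexivity. }
    apply (f_equal RtoC) in S1. apply (f_equal RtoC) in S2.
    rewrite RtoC_mult, Esq in S1, S2. rewrite RtoC_opp in S2.
    unfold chi_num. cbn [fst snd]. fold N.
    replace (- r' * p' - s' * p)%Z with (- (r' * p' + s' * p))%Z by ring.
    rewrite level_theta_opp by assumption.
    transitivity ((4 / sqrt (IZR (2 * N)) * (sin (PI * IZR r * IZR (r' * p' - s' * p) / IZR p) * sin (PI
      * IZR s * IZR (r' * p' - s' * p) / IZR p'))%R) * level_theta N (r' * p' - s' * p) tau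
     + (4 / sqrt (IZR (2 * N)) * (sin (PI * IZR r * IZR (r' * p' + s' * p) / IZR p) * sin (PI * IZR s *
       IZR (r' * p' + s' * p) / IZR p'))%R) * level_theta N (r' * p' + s' * p) tau).
    { unfold Cdiv. ring. }
    rewrite S1, S2. ring.
  - intros x. unfold G. fold N. rewrite FP. f_equal.
    rewrite <- (FP (- (x + 2 * N))%Z). f_equal. ring.
  - intros x. unfold G. rewrite Z.opp_involutive. ring.
  - intros k. rewrite HG. replace (PI * IZR r * IZR (k * p) / IZR p)%R with (PI * IZR (r * k))%R.
    + rewrite sin_PI_Z, Rmult_0_l. ring.
    + rewrite !mult_IZR. field. apply eq_IZR_contrapositive. lia.
  - intros k. rewrite HG. replace (PI * IZR s * IZR (k * p') / IZR p')%R with (PI * IZR (s * k))%R.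
    + rewrite sin_PI_Z, Rmult_0_r. ring.
    + rewrite !mult_IZR. field. apply eq_IZR_contrapositive. lia.
Qed.

(** * The translation [tau + 1] *)

Lemma epow_tau_plus_1 tau y : epow (tau + 1) y = Cexp (2 * PI * Ci * y) * epow tau y.
Proof. unfold epow. rewrite <- Cexp_plus. f_equal. ring. Qed.

Lemma epow_tau_plus_1_nat tau n : epow (tau + 1) (INR n) = epow tau (INR n).
Proof.
  rewrite epow_tau_plus_1, INR_IZR_INZ, Cexp_2PI_Z. ring.
Qed.

Lemma Cprod_pos_ext u v : (forall n, u (S n) = v (S n)) -> Cprod_pos u = Cprod_pos v.
Proof.
  intros H. unfold Cprod_pos. f_equal. apply FunctionalExtensionality.functional_extensionality.
  intros N. now apply Cprod_ext.
Qed.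

Lemma eta_T tau : eta (tau + 1) = Cexp (2 * PI * Ci / 24) * eta tau.
Proof.
  unfold eta. rewrite (Cprod_pos_ext _ (fun n => 1 - epow tau (INR n))).
  - rewrite epow_tau_plus_1. replace (2 * PI * Ci * (1 / 24)) with (2 * PI * Ci / 24) by field. ring.
  - intros n. now rewrite epow_tau_plus_1_nat.
Qed.

Lemma theta_T e e' u tau : (e = 0 \/ e = 1)%nat -> (e' = 0 \/ e' = 1)%nat ->
  theta e e' u (tau + 1) = Cexp (2 * PI * Ci * INR e / 8) * theta e (e * e' + (1 - e) * (1 - e')) u tau.
Proof.
  intros He He'. unfold theta.
  set (e2 := (e * e' + (1 - e) * (1 - e'))%nat).
  assert (Hs : forall (n : nat) (y : C) (k : Z), y = INR n - (1 - INR e) / 2 - IZR k ->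
     (-1) ^ e' * Cexp (2 * PI * Ci * y) = (-1) ^ e2).
  { intros n y k ->. rewrite !sign_pow, <- Cexp_plus.
    destruct He as [-> | ->], He' as [-> | ->]; unfold e2; simpl Nat.add; simpl Nat.mul; simpl Nat.sub.
    - apply (Cexp_eq_mod _ _ (Z.of_nat n - k - 1)). rewrite !minus_IZR, <- INR_IZR_INZ, !RtoC_minus.
      simpl. field.
    - apply (Cexp_eq_mod _ _ (Z.of_nat n - k)). rewrite !minus_IZR, <- INR_IZR_INZ, !RtoC_minus. simpl. field.
    - apply (Cexp_eq_mod _ _ (Z.of_nat n - k)). rewrite !minus_IZR, <- INR_IZR_INZ, !RtoC_minus. simpl. field.
    - apply (Cexp_eq_mod _ _ (Z.of_nat n - k)). rewrite !minus_IZR, <- INR_IZR_INZ, !RtoC_minus. simpl. field. }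
  rewrite (Cprod_pos_ext _ (fun n => (1 - epow tau (INR n)) *
    (1 + (-1) ^ e2 * epow u 1 * epow tau (INR n - (1 - INR e) / 2)) *
    (1 + (-1) ^ e2 * epow u (-1) * epow tau (INR n - (1 + INR e) / 2)))).
  - rewrite epow_tau_plus_1. replace (2 * PI * Ci * (INR e / 8)) with (2 * PI * Ci * INR e / 8) by field. ring.
  - intros n. rewrite epow_tau_plus_1_nat, !epow_tau_plus_1.
    rewrite <- (Hs (S n) (INR (S n) - (1 - INR e) / 2) 0%Z) at 1 by ring.
    rewrite <- (Hs (S n) (INR (S n) - (1 + INR e) / 2) (Z.of_nat e)) by (rewrite <- INR_IZR_INZ; field).
    ring.
Qed.

Lemma level_theta_T N lam tau : (0 < N)%Z -> (0 < Im tau)%R ->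
  level_theta N lam (tau + 1) = Cexp (2 * PI * Ci * IZR lam ^ 2 / (4 * IZR N)) * level_theta N lam tau.
Proof.
  intros HN Ht. unfold level_theta.
  rewrite <- Cseries_Z_scal by now apply geo_level_term.
  apply Cseries_Z_ext. intros n. unfold level_term.
  rewrite epow_tau_plus_1, level_exponent by exact HN. f_equal.
  apply (Cexp_eq_mod _ _ (N * n ^ 2 + n * lam)).
  rewrite plus_IZR, !mult_IZR, RtoC_plus, !RtoC_mult.
  replace (IZR (n ^ 2)) with (IZR n * IZR n)%R by (rewrite <- mult_IZR; f_equal; ring).
  rewrite RtoC_mult. field. apply IZR_C_neq_0. lia.
Qed.

Lemma Im_plus_1 tau : (0 < Im tau)%R -> (0 < Im (tau + 1))%R.
Proof. destruct tau; simpl. lra. Qed.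

(** Both theta series of [chi] acquire the same phase, their exponents
    [lambda^2 / 4 p p'] differing by the integer [r s]. *)
Lemma chi_T p p' r s tau : (2 <= p)%Z -> (2 <= p')%Z -> (0 < Im tau)%R ->
  chi p p' r s (tau + 1) =
  Cexp (2 * PI * Ci * (IZR ((r * p' - s * p) ^ 2) / IZR (4 * p * p') - 1 / 24)) * chi p p' r s tau.
Proof.
  intros Hp Hp' Ht. rewrite !chi_eq by (try apply Im_plus_1; assumption).
  assert (HN : (0 < p * p')%Z) by nia.
  assert (HpC : RtoC (IZR p) <> 0) by (apply IZR_C_neq_0; lia).
  assert (HpC' : RtoC (IZR p') <> 0) by (apply IZR_C_neq_0; lia).
  assert (EN : RtoC (IZR (p * p')) = IZR p * IZR p') by now rewrite mult_IZR, RtoC_mult.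
  assert (E4 : RtoC (IZR (4 * p * p')) = 4 * IZR p * IZR p') by now rewrite !mult_IZR, !RtoC_mult.
  set (l1 := (r * p' - s * p)%Z). set (l2 := (- r * p' - s * p)%Z).
  assert (Y1 : IZR l1 = IZR r * IZR p' - IZR s * IZR p :> C).
  { unfold l1. now rewrite minus_IZR, !mult_IZR, RtoC_minus, !RtoC_mult. }
  assert (Y2 : IZR l2 = - (IZR r * IZR p') - IZR s * IZR p :> C).
  { unfold l2. rewrite minus_IZR, !mult_IZR, opp_IZR, RtoC_minus, !RtoC_mult, RtoC_opp. ring. }
  assert (Ysq : IZR (l1 ^ 2) = IZR l1 * IZR l1 :> C).
  { rewrite <- RtoC_mult, <- mult_IZR. do 2 f_equal. ring. }
  unfold chi_num. fold l1 l2. rewrite !level_theta_T by assumption.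
  assert (E2 : Cexp (2 * PI * Ci * IZR l2 ^ 2 / (4 * IZR (p * p'))) = Cexp (2 * PI * Ci * IZR l1 ^ 2 / (4
    * IZR (p * p')))).
  { apply (Cexp_eq_mod _ _ (r * s)). rewrite Y1, Y2, EN, mult_IZR, RtoC_mult. field. split; assumption. }
  rewrite E2, eta_T.
  assert (E3 : Cexp (2 * PI * Ci * IZR l1 ^ 2 / (4 * IZR (p * p'))) =
     Cexp (2 * PI * Ci / 24) * Cexp (2 * PI * Ci * (IZR (l1 ^ 2) / IZR (4 * p * p') - 1 / 24))).
  { rewrite <- Cexp_plus. f_equal. rewrite Ysq, E4, EN. field. split; assumption. }
  rewrite E3. field. split; [now apply eta_neq_0|apply Cexp_neq_0].
Qed.

Lemma T_char_T p p' e e' r s x tau u t :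
  (2 <= p)%Z -> (2 <= p')%Z -> (e = 0 \/ e = 1)%nat -> (e' = 0 \/ e' = 1)%nat -> (0 < Im tau)%R ->
  T_char p p' e e' r s x (tau + 1) u t =
  Cexp (2 * PI * Ci *
        ((IZR p' / IZR p)%R * (x - Ci * INR e / 2) ^ 2
         + IZR ((r * p' - s * p) ^ 2) / IZR (4 * p * p')
         - (1 - INR e) / 8)) *
  T_char p p' e (e * e' + (1 - e) * (1 - e')) r s x tau u t.
Proof.
  intros Hp Hp' He He' Ht. unfold T_char. set (a := (IZR p' / IZR p)%R).
  set (e2 := (e * e' + (1 - e) * (1 - e'))%nat).
  rewrite eta_T, theta_T, chi_T by assumption. fold e2.
  rewrite (epow_tau_plus_1 tau).
  replace (e * e2)%nat with (e * e')%nat by (unfold e2; destruct He as [-> | ->]; simpl; lia).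
  set (l := IZR ((r * p' - s * p) ^ 2) / IZR (4 * p * p')).
  set (X := (x - Ci * INR e / 2) ^ 2).
  pose proof (eta_neq_0 tau Ht) as Heta.
  assert (E : Cexp (2 * PI * Ci * (a * X + l - (1 - INR e) / 8)) * Cexp (2 * PI * Ci / 24) ^ 2 =
    Cexp (2 * PI * Ci * (a * X)) * Cexp (2 * PI * Ci * INR e / 8) * Cexp (2 * PI * Ci * (l - 1 / 24))).
  { rewrite Cexp_pow, <- !Cexp_plus. f_equal. simpl INR. rewrite RtoC_plus. field. }
  assert (H24 : Cexp (2 * PI * Ci / 24) <> 0) by apply Cexp_neq_0.
  set (w := Cexp (2 * PI * Ci / 24)) in *.
  set (ph := Cexp (2 * PI * Ci * (a * X + l - (1 - INR e) / 8))) in *.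
  transitivity ((-1) ^ (e * e') * epow tau (a * X) * epow u (2 * Ci * a * (x - Ci * INR e / 2)) * epow t
    (3 * (1 - 2 * a)) *
    theta e e2 u tau * chi p p' r s tau / (w ^ 2 * eta tau ^ 2) *
    (Cexp (2 * PI * Ci * (a * X)) * Cexp (2 * PI * Ci * INR e / 8) * Cexp (2 * PI * Ci * (l - 1 / 24)))).
  - field. split; assumption.
  - rewrite <- E. field. split; assumption.
Qed.

(** * The inversion [- 1 / tau] *)

Lemma Ci_pow_inv n : / Ci ^ n = Cexp (- (PI * Ci * INR n / 2)).
Proof.
  assert (E : Ci = Cexp (PI * Ci / 2)).
  { unfold Cexp. apply Ceq; simpl;
    match goal with |- context [exp ?a] => replace a with 0%R by field end;
    match goal with |- context [cos ?a] => replace a with (PI / 2)%R by field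
                  | |- context [sin ?a] => replace a with (PI / 2)%R by field end;
    rewrite exp_0, ?cos_PI2, ?sin_PI2; ring. }
  rewrite E at 1. rewrite Cexp_pow, <- Cexp_opp. f_equal. field.
Qed.

Section Inversion.

Variables (p p' : Z) (e e' : nat).
Hypothesis Hp : (2 <= p)%Z.
Hypothesis Hp' : (2 <= p')%Z.
Variables (x tau u t : C).
Hypothesis Ht : (0 < Im tau)%R.

Let a : R := (IZR p' / IZR p)%R.
Let X : C := x - Ci * INR e / 2.
Let c : C := Ci * INR e' / 2.

(** The integrand is a Gaussian in [x'] with leading coefficient [2 pi i a tau]. *)
Let A : C := PI * Ci * ((2 * a)%R * tau).
Let B : C := 4 * PI * Ci * a * (Ci * u - X - tau * c).
Let D : C := 2 * PI * Ci * a * (tau * c ^ 2 - 2 * c * (Ci * u - X)).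
Let k (rs rs' : Z * Z) : C :=
  / Ci ^ (e * e') * S_Vir p p' rs rs' * sqrt (2 * a) * (-1) ^ (e' * e) *
  epow t (3 * (1 - 2 * a)) * (theta e' e u tau / eta tau ^ 2) * chi p p' (fst rs') (snd rs') tau.

Lemma kernel_gauss rs rs' (x' : R) :
  S_tt p p' e e' rs x rs' x' * T_char p p' e' e (fst rs') (snd rs') x' tau u t =
  k rs rs' * gauss A B D x'.
Proof.
  unfold S_tt, T_char. fold a.
  replace (gauss A B D x') with
    (Cexp (- (4) * PI * Ci * a * (x - Ci * INR e / 2) * (x' - Ci * INR e' / 2)) *
     epow tau (a * (x' - Ci * INR e' / 2) ^ 2) *
     epow u (2 * Ci * a * (x' - Ci * INR e' / 2))).
  - unfold k. ring.
  - unfold epow, gauss. rewrite <- !Cexp_plus. f_equal. unfold A, B, D, X, c.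
    rewrite RtoC_mult. field.
Qed.

Lemma a_pos : (0 < a)%R.
Proof. apply Rdiv_lt_0_compat; apply IZR_lt; lia. Qed.

Lemma Re_A_neg : (Re A < 0)%R.
Proof.
  apply Re_PI_Ci_neg, Im_scale_pos; [|exact Ht]. pose proof a_pos. lra.
Qed.

Lemma kernel_integrable rs rs' : Cintegrable_R (fun x' : R =>
  S_tt p p' e e' rs x rs' x' * T_char p p' e' e (fst rs') (snd rs') x' tau u t).
Proof.
  replace (fun x' : R => _) with (fun x' : R => k rs rs' * gauss A B D x').
  - apply gauss_integrable, Re_A_neg.
  - apply FunctionalExtensionality.functional_extensionality. intros x'. symmetry. apply kernel_gauss.
Qed.

Lemma kernel_integral rs rs' :
  Cintegral_R (fun x' : R => S_tt p p' e e' rs x rs' x' * T_char p p' e' e (fst rs') (snd rs') x' tau u t)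
  = k rs rs' * (Cexp (- (2 * PI * Ci * a * (Ci * u - X) ^ 2 / tau)) * (gauss_tau tau / sqrt (2 * a))).
Proof.
  pose proof a_pos as Ha. pose proof Re_A_neg as HA. pose proof (Im_pos_neq_0 tau Ht) as Ht0.
  assert (HaC : RtoC a <> 0) by (intros h; apply RtoC_inj in h; lra).
  rewrite (Cintegral_ext _ _ (kernel_gauss rs rs')), gauss_integral_scal, gauss_integral by exact HA.
  f_equal. f_equal.
  - f_equal. unfold D, B, A. rewrite RtoC_mult. field.
    repeat split; first [exact Ht0|exact HaC|apply Ci_neq_0|apply PI_neq_0_C].
  - change (gauss_int A) with (gauss_tau ((2 * a)%R * tau)).
    rewrite <- (gauss_tau_scale tau (2 * a)) by first [exact Ht|lra]. field.
    intros h. apply RtoC_inj in h. pose proof (sqrt_lt_R0 (2 * a)). lra.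
Qed.

End Inversion.

(** The powers of the Gaussian integral [g] at [- 1 / tau] are [g] from theta, [g^-3] from
    [eta^3] and [g] from [chi_num]; what remains is [1 / g], the Gaussian integral at [tau],
    which is also the value of the integral over [x']. *)
Lemma T_char_S p p' e e' r s x tau u t :
  (2 <= p)%Z -> (2 <= p')%Z -> Z.gcd p p' = 1%Z ->
  (e = 0 \/ e = 1)%nat -> (e' = 0 \/ e' = 1)%nat -> (0 < Im tau)%R ->
  T_char p p' e e' r s x (- (1) / tau) (u / tau) (t - u ^ 2 / (6 * tau)) =
  Csum_list (Kac_list p p') (fun rs' =>
     Cintegral_R (fun x' : R =>
       S_tt p p' e e' (r, s) x rs' x' *
       T_char p p' e' e (fst rs') (snd rs') x' tau u t)).
Proof.
  intros Hp Hp' Hc He He' Ht.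
  pose proof (Im_inv_pos tau Ht) as Ht'. pose proof (Im_pos_neq_0 tau Ht) as Ht0.
  set (a := (IZR p' / IZR p)%R).
  assert (Ha : (0 < a)%R) by (apply a_pos; assumption).
  assert (Hsq : RtoC (sqrt (2 * a)) <> 0).
  { intros h. apply RtoC_inj in h. pose proof (sqrt_lt_R0 (2 * a)). lra. }
  pose proof (eta_neq_0 tau Ht) as Heta. pose proof (eta_neq_0 _ Ht') as Heta'.
  set (X := x - Ci * INR e / 2).
  set (num := Csum_list (Kac_list p p') (fun rs' => S_Vir p p' (r, s) rs' * chi_num p p' (fst rs') (snd
    rs') tau)).
  set (M := Cexp (- (PI * Ci * INR (e * e') / 2)) * (-1) ^ (e * e') * epow t (3 * (1 - 2 * a)) * theta e'
    e u tau *
    Cexp (- (2 * PI * Ci * a * (Ci * u - X) ^ 2 / tau)) * gauss_tau tau / eta tau ^ 3).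
  transitivity (M * num).
  - unfold T_char. fold a X. rewrite chi_eq, chi_num_S, theta_S by assumption. fold num.
    set (g := gauss_tau (- (1) / tau)).
    pose proof (eta3_S tau Ht) as H3. fold g in H3.
    pose proof (gauss_tau_inv tau Ht) as Hg. fold g in Hg.
    assert (Hg0 : g <> 0).
    { intros h. rewrite h in Hg. rewrite Cmult_0_r in Hg. apply RtoC_inj in Hg. lra. }
    assert (E : epow (- (1) / tau) (a * X ^ 2) * epow (u / tau) (2 * Ci * a * X) *
       epow (t - u ^ 2 / (6 * tau)) (3 * (1 - 2 * a)) * Cexp (PI * Ci * u ^ 2 / tau) =
       epow t (3 * (1 - 2 * a)) * Cexp (- (2 * PI * Ci * a * (Ci * u - X) ^ 2 / tau))).
    { unfold epow. rewrite <- !Cexp_plus. f_equal.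
      transitivity (2 * PI * Ci * t * (3 * (1 - 2 * a)) + - (2 * PI * Ci * a * (X ^ 2 - 2 * Ci * u * X -
        u ^ 2) / tau)).
      - field. exact Ht0.
      - transitivity (2 * PI * Ci * t * (3 * (1 - 2 * a)) + - (2 * PI * Ci * a * (X ^ 2 - 2 * Ci * u * X
        + Ci ^ 2 * u ^ 2) / tau)).
        + rewrite Ci2. field. exact Ht0.
        + field. exact Ht0. }
    set (P := Cexp (- (PI * Ci * INR (e * e') / 2))).
    transitivity ((-1) ^ (e * e') * P * theta e' e u tau * num * g ^ 2 / eta (- (1) / tau) ^ 3 *
      (epow (- (1) / tau) (a * X ^ 2) * epow (u / tau) (2 * Ci * a * X) *
       epow (t - u ^ 2 / (6 * tau)) (3 * (1 - 2 * a)) * Cexp (PI * Ci * u ^ 2 / tau))).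
    { field. exact Heta'. }
    rewrite E, H3. unfold M. fold P.
    replace (gauss_tau tau) with (/ g) by (rewrite <- (Cmult_1_r (/ g)), <- Hg; field; exact Hg0).
    field. split; assumption.
  - unfold num. rewrite <- Csum_list_scal. apply Csum_list_ext. intros rs' _.
    rewrite kernel_integral by assumption. fold a X.
    rewrite chi_eq, Ci_pow_inv by assumption. rewrite (Nat.mul_comm e' e). unfold M.
    field. split; assumption.
Qed.

Theorem theorem3p7
    (p p' : Z) (hp : (2 <= p)%Z) (hp' : (2 <= p')%Z) (hpp' : Z.gcd p p' = 1%Z)
    (e e' : nat) (he : e = 0%nat \/ e = 1%nat) (he' : e' = 0%nat \/ e' = 1%nat)
    (r s : Z) (hrs : Kac p p' (r, s)) (x : C)
    (tau u t : C) (htau : (0 < Im tau)%R) :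
  let a : R := (IZR p' / IZR p)%R in
  ((forall r' s' : Z, Kac p p' (r', s') ->
      Cintegrable_R (fun x' : R =>
        S_tt p p' e e' (r, s) x (r', s') x' * T_char p p' e' e r' s' x' tau u t)) /\
   T_char p p' e e' r s x (- (1) / tau) (u / tau) (t - u ^ 2 / (6 * tau)) =
   Csum_list (Kac_list p p') (fun rs' =>
     Cintegral_R (fun x' : R =>
       S_tt p p' e e' (r, s) x rs' x' *
       T_char p p' e' e (fst rs') (snd rs') x' tau u t)))
  /\
  T_char p p' e e' r s x (tau + 1) u t =
  Cexp (2 * PI * Ci *
        (a * (x - Ci * INR e / 2) ^ 2
         + IZR ((r * p' - s * p) ^ 2) / IZR (4 * p * p')
         - (1 - INR e) / 8)) *
  T_char p p' e (e * e' + (1 - e) * (1 - e')) r s x tau u t.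
Proof.
  intros a. split; [split|].
  - intros r' s' _. exact (kernel_integrable p p' e e' hp hp' x tau u t htau (r, s) (r', s')).
  - now apply T_char_S.
  - now apply T_char_T.
Qed.
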